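(* Suppose that $\lambda_i>0$ for every $i\in\{1,\dots,N\}$ and let $\bar u\in\mathbb U$ be any function, with state $f_{\bar u}$ and costate $g_{\bar u}$. Define $p(\bar u)=(p_1(\bar u),\dots,p_N(\bar u))^T:[0,T]\to\mathbb R^N$ by $$p_i(\bar u)(t):=\int_{\mathbb R^6}\big(v\times m_i(x)\big)\cdot\partial_v f_{\bar u}(t,x,v)\;g_{\bar u}(t,x,v)\,d(x,v),\qquad i=1,\dots,N.$$ Then $p(\bar u)\in C([0,T];\mathbb R^N)$, and the following items are equivalent: (NC1) For all $u=(u_1,\dots,u_N)\in\mathbb U$, $$\int_0^T\big(\lambda_i\bar u_i-p_i(\bar u)\big)(u_i-\bar u_i)\,dt\ge0,\qquad i=1,\dots,N.$$ (NC2) For almost all $t\in[0,T]$ and every $i\in\{1,\dots,N\}$, $$\bar u_i(t)=\mathbb P_{[a_i(t),b_i(t)]}\Big(\frac1{\lambda_i}\,p_i(\bar u)(t)\Big),\qquad\text{where } \mathbb P_{[a,b]}(\xi)=\min\{\max\{\xi,a\},b\},\ \xi\in\mathbb R.$$ Moreover, if $\bar u$ is a locally optimal solution of the problem of minimizing $J$ over $\mathbb U$, i.e., there exists $\delta>0$ such that $J(\bar u)\le J(u)$ for every $u\in\mathbb U$ with $\|\bar u-u\|_{L^2([0,T];\mathbb R^N)}<\delta$, then $\bar u$ satisfies (NC1) and (NC2).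
   Context: Data: $T>0$, $\beta>3$, $N\ge1$, $M>0$; fixed $m_1,\dots,m_N\in W^{2,\beta}(\mathbb R^3;\mathbb R^3)$ with $\|m_i\|_{W^{2,\beta}}\le M$, $\operatorname{div} m_i=0$; fixed $a,b\in L^2([0,T];\mathbb R^N)$ with $a_i\le0\le b_i$ a.e. for all $i$; $\mathring f,f_d\in C^2_c(\mathbb R^6)$ with $\mathring f\ge0$ and $\|\mathring f\|_{L^p}=\|f_d\|_{L^p}$ for all $p\in[1,\infty]$. Admissible controls: $\mathbb U=\mathbb U_1\times\dots\times\mathbb U_N$, $\mathbb U_i=\{w\in L^2([0,T]): a_i\le w\le b_i\text{ a.e.}\}$. Control-to-field operator: $B(u)(t,x)=\sum_{i=1}^N u_i(t)m_i(x)$ for $u\in L^2([0,T];\mathbb R^N)$. Put $\mathcal W=L^2(0,T;W^{2,\beta}(\mathbb R^3;\mathbb R^3))$ and $\mathbb B_K=\{B\in\mathcal W:\|B\|_{\mathcal W}\le K\}$, where $K>0$ is fixed (depending only on $N,a,b,M$) such that $\|B(u)\|_{\mathcal W}<K/2$ for all $u\in\mathbb U$. State: $\psi_f(t,x)=\iint\frac{f(t,y,w)}{|x-y|}\,dw\,dy$. For $B\in\mathbb B_K$, $f_B$ is the unique strong solution of $\partial_tf+v\cdot\partial_xf-\partial_x\psi_f\cdot\partial_vf+(v\times B)\cdot\partial_vf=0$, $f|_{t=0}=\mathring f$, i.e. the unique $f\in W^{1,2}(0,T;C_b(\mathbb R^6))\cap C([0,T];C^1_b(\mathbb R^6))\cap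 L^\infty(0,T;W^{2,\beta}(\mathbb R^6))$ with $\operatorname{supp} f(t)$ in a ball independent of $t$, satisfying the equation a.e. and the initial condition everywhere. (Existence and uniqueness are known, and there is $R>0$ depending only on $\mathring f,T,K,\beta$ with $\operatorname{supp}f_B(t)\subset B_R(0)\subset\mathbb R^6$ for all $t$ and all $B\in\mathbb B_K$.) Write $f_u:=f_{B(u)}$ for $u\in\mathbb U$. Cost functional: $J(u)=\frac12\|f_u(T)-f_d\|_{L^2(\mathbb R^6)}^2+\sum_{i=1}^N\frac{\lambda_i}2\|u_i\|^2_{L^2([0,T])}$. Costate: $R_Z\ge R$ is a constant such that for all $B\in\mathbb B_K$ the characteristic flow $Z_B(s,t,x,v)$ of $\dot x=v$, $\dot v=-\partial_x\psi_{f_B}(s,x)+v\times B(s,x)$ with $Z_B(t,t,x,v)=(x,v)$ satisfies $|Z_B(s,t,z)|\le R_Z$ for $z\in B_R(0)$, $s,t\in[0,T]$. Fix $\chi\in C^2_c(\mathbb R^6;[0,1])$ with $\chi=1$ on $B_{R_Z}(0)$ and $\operatorname{supp}\chi\subset B_{2R_Z}(0)$. Put $\Phi_{\varphi,\eta}(t,x)=-\iint\frac{x-y}{|x-y|^3}\cdot\partial_v\varphi(t,y,w)\,\eta(t,y,w)\,dy\,dw$. For $u\in\mathbb U$, $g_u$ is the unique strong solution (in $W^{1,2}(0,T;C_b)\cap C([0,T];C_b^1(\mathbb R^6))\cap L^\infty(0,T;H^2(\mathbb R^6))$, with supports in a ball $B_{R^*}(0)$ independent of $t$) of $$\partial_tg+v\cdot\partial_xg-\partial_x\psi_{f_u}\cdot\partial_vg+(v\times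 B(u))\cdot\partial_vg=\Phi_{f_u,g}\,\chi,\qquad g|_{t=T}=f_u(T)-f_d.$$ Existence and uniqueness are known, and $g_u|_{B_R(0)}$ does not depend on the choice of $\chi$. *)

(* Defs.v *)
From HB Require Import structures.
From mathcomp Require Import all_boot all_order all_algebra.
From mathcomp Require Import all_classical all_reals all_analysis.

Set Implicit Arguments.
Unset Strict Implicit.
Unset Printing Implicit Defensive.

Import Order.TTheory GRing.Theory Num.Theory.
Import numFieldNormedType.Exports.

Local Open Scope classical_set_scope.
Local Open Scope ring_scope.

(* [lebesgue_measure] lives on [measurableTypeR R], an alias of [R]; the alias *)
(* receives the normed structure of [R], so that calculus and integration are  *)
(* available on the same carrier, and on its products.                         *)
#[short(type="measNormedModType")]
HB.structure Definition MeasNormedModule d (R : realType) :=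
  {E of Measurable d E & NormedModule R E}.

HB.instance Definition _ (R : realType) :=
  NormedModule.copy (g_sigma_algebraType R.-ocitv.-measurable) R.

HB.instance Definition _ d1 d2 (R : realType)
    (A : measNormedModType d1 R) (B : measNormedModType d2 R) :=
  Measurable.on (A * B)%type.

Section ProductSigmaFinite.
Local Open Scope ereal_scope.
Context d1 d2 (T1 : measurableType d1) (T2 : measurableType d2) (R : realType).
Variable m1 : {sigma_finite_measure set T1 -> \bar R}.
Variable m2 : {sigma_finite_measure set T2 -> \bar R}.

Lemma sigma_finite_product_measure1 : sigma_finite setT (m1 \x m2).
Proof.
have /sigma_finiteP[F [TF ndF Foo]] := sigma_finiteT m1.
have /sigma_finiteP[G [TG ndG Goo]] := sigma_finiteT m2.
exists (fun n => F n `*` G n).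
  rewrite -setXTT TF TG predeqE => -[x y]; split.
    move=> [/= [n _ Fnx] [k _ Gky]]; exists (maxn n k) => //; split.
    - by move: x Fnx; exact/subsetPset/ndF/leq_maxl.
    - by move: y Gky; exact/subsetPset/ndG/leq_maxr.
  by move=> [n _ []/= ? ?]; split; exists n.
move=> k; have [? ?] := Foo k; have [? ?] := Goo k.
split; first exact: measurableX.
by rewrite product_measure1E// lte_mul_pinfty// ge0_fin_numE.
Qed.

End ProductSigmaFinite.

Section Calculus.
Context d (R : realType) (E : measNormedModType d R).
Variables (mu : {measure set E -> \bar R}) (n : nat) (e : 'I_n -> E).

Definition tsupport (f : E -> R) : set E := closure [set x | f x != 0].

Definition partial (s : seq 'I_n) (f : E -> R) : E -> R :=
  foldr (fun i g => 'D_(e i) g) f s.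

Definition class_C (k : nat) (f : E -> R) : Prop :=
  (forall s i x, (size s < k)%N -> derivable (partial s f) x (e i)) /\
  (forall s, (size s <= k)%N -> continuous (partial s f)).

Definition class_Cc (k : nat) (f : E -> R) : Prop :=
  class_C k f /\ compact (tsupport f).

Definition test_function (Om : set E) (phi : E -> R) : Prop :=
  [/\ forall k, class_C k phi, compact (tsupport phi) & tsupport phi `<=` Om].

Definition loc_integrable (Om : set E) (f : E -> R) : Prop :=
  forall A, compact A -> A `<=` Om -> mu.-integrable A (EFin \o f).

(* [w] is the weak derivative of [f] on [Om] in the directions listed in [s] *)
Definition weak_partial (Om : set E) (s : seq 'I_n) (f w : E -> R) : Prop :=
  [/\ loc_integrable Om f, loc_integrable Om w &
    forall phi, test_function Om phi ->
      \int[mu]_(x in Om) (f x * partial s phi x) =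
      (-1) ^+ size s * \int[mu]_(x in Om) (w x * phi x)].

Definition order k (al : {ffun 'I_n -> 'I_k.+1}) : nat := (\sum_i al i)%N.

Definition dirs k (al : {ffun 'I_n -> 'I_k.+1}) : seq 'I_n :=
  flatten [seq nseq (al i) i | i <- enum 'I_n].

Definition weak_jet k (f : E -> R) (w : {ffun 'I_n -> 'I_k.+1} -> E -> R) : Prop :=
  forall al, (order al <= k)%N -> weak_partial setT (dirs al) f (w al).

(* Norm of W^{k,b}(E). Weak derivatives are unique up to null sets, so the     *)
(* infimum ranges over at most one value; it is +oo when some weak derivative  *)
(* of order at most [k] does not exist.                                        *)
Definition sobolev_norm (k : nat) (b : R) (f : E -> R) : \bar R :=
  ereal_inf [set N | exists2 w : {ffun 'I_n -> 'I_k.+1} -> E -> R,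
    weak_jet f w &
    N = ((\sum_(al : {ffun 'I_n -> 'I_k.+1} | (order al <= k)%N)
           \int[mu]_x (`|w al x| `^ b)%:E) `^ b^-1)%E].

Definition sobolev (k : nat) (b : R) : set (E -> R) :=
  [set f | (sobolev_norm k b f < +oo)%E].

Definition sup_norm (f : E -> R) : \bar R := ereal_sup (range (fun x => `|f x|%:E)).

Definition Cb : set (E -> R) := [set f | continuous f /\ (sup_norm f < +oo)%E].

Definition C1b_norm (f : E -> R) : \bar R :=
  (sup_norm f + \sum_i sup_norm (partial [:: i] f))%E.

Definition C1b : set (E -> R) := [set f | class_C 1 f /\ (C1b_norm f < +oo)%E].

End Calculus.

(* Functions of time in [0, T] with values in a space [S] of functions normed  *)
(* by [nrm]; values outside [0, T] are irrelevant.                             *)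
Section Bochner.
Variables (R : realType) (T : R) (X : zmodType) (S : set X) (nrm : X -> \bar R).
Local Notation mu := (@lebesgue_measure R).

Definition simple_map (g : measurableTypeR R -> X) : Prop :=
  [/\ finite_set (range g), range g `<=` S & forall x, measurable (g @^-1` [set x])].

Definition strongly_measurable (f : R -> X) : Prop :=
  exists2 s : nat -> R -> X, (forall n, simple_map (s n)) &
    {ae mu, forall t, t \in `[0, T] -> nrm (s n t - f t) @[n --> \oo] --> 0%E}.

Definition bochner_norm (q : \bar R) (f : R -> X) : \bar R :=
  ('N[mu]_q [ (nrm \o f) \_ `[0%R, T]%classic ])%E.

Definition bochner (q : \bar R) : set (R -> X) :=
  [set f | [/\ {ae mu, forall t, t \in `[0, T] -> S (f t)},
               strongly_measurable f & (bochner_norm q f < +oo)%E]].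

Definition continuous_in : set (R -> X) :=
  [set f | forall t0, t0 \in `[0, T] -> S (f t0) /\
     nrm (f t - f t0) @[t --> within `[0, T]%classic (nbhs t0)] --> 0%E].

End Bochner.

Section Space.
Variable R : realType.

Definition space3 : Type := (measurableTypeR R * measurableTypeR R * measurableTypeR R)%type.
Definition space6 : Type := (space3 * space3)%type.

Local Notation mu := (@lebesgue_measure R).

Definition leb2 := (mu \x mu)%E.
HB.instance Definition _ := Measure.on leb2.
HB.instance Definition _ :=
  Measure_isSigmaFinite.Build _ _ _ leb2 (sigma_finite_product_measure1 mu mu).

Definition leb3 := (leb2 \x mu)%E.
HB.instance Definition _ := Measure.on leb3.
HB.instance Definition _ :=
  Measure_isSigmaFinite.Build _ _ _ leb3 (sigma_finite_product_measure1 leb2 mu).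

Definition leb6 := (leb3 \x leb3)%E.
HB.instance Definition _ := Measure.on leb6.
HB.instance Definition _ :=
  Measure_isSigmaFinite.Build _ _ _ leb6 (sigma_finite_product_measure1 leb3 leb3).

Definition vec3 (c : 'I_3 -> R) : space3 :=
  (c ord0, c (inord 1), c (inord 2)).

Definition coord (x : space3) (i : 'I_3) : R := tnth [tuple x.1.1; x.1.2; x.2] i.

Definition dot (x y : space3) : R := \sum_i coord x i * coord y i.

Definition cross (x y : space3) : space3 :=
  (x.1.2 * y.2 - x.2 * y.1.2, x.2 * y.1.1 - x.1.1 * y.2,
   x.1.1 * y.1.2 - x.1.2 * y.1.1).

(* Euclidean norms; the norm inherited from products is the max norm *)
Definition enorm3 (x : space3) : R := Num.sqrt (dot x x).
Definition enorm6 (z : space6) : R := Num.sqrt (dot z.1 z.1 + dot z.2 z.2).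

Definition ball6 (r : R) : set space6 := [set z | enorm6 z < r].

Definition basis1 (i : 'I_1) : measurableTypeR R := (1 : R).
Definition basis3 (i : 'I_3) : space3 := vec3 (fun j => (i == j)%:R).
Definition basis6 (i : 'I_(3 + 3)) : space6 :=
  match fintype.split i with
  | inl j => (basis3 j, 0)
  | inr j => (0, basis3 j)
  end.

Definition grad (h : space3 -> R) (x : space3) : space3 :=
  vec3 (fun i => 'D_(basis3 i) h x).

Definition gradx (h : space6 -> R) (z : space6) : space3 :=
  vec3 (fun i => 'D_(basis6 (lshift 3 i)) h z).

Definition gradv (h : space6 -> R) (z : space6) : space3 :=
  vec3 (fun i => 'D_(basis6 (rshift 3 i)) h z).

Definition vsobolev_norm (k : nat) (b : R) (m : space3 -> space3) : \bar R :=
  ((\sum_(i < 3) sobolev_norm leb3 basis3 k b (fun x => coord (m x) i) `^ b)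
     `^ b^-1)%E.

Definition vsobolev (k : nat) (b : R) : set (space3 -> space3) :=
  [set m | (vsobolev_norm k b m < +oo)%E].

Definition divergence_free (m : space3 -> space3) : Prop :=
  exists2 w : 'I_3 -> space3 -> R,
    forall i, weak_partial leb3 basis3 setT [:: i] (fun x => coord (m x) i) (w i) &
    {ae leb3, forall x, \sum_i w i x = 0}.

Section Time.
Variable T : R.

Definition L2 (w : R -> R) : Prop :=
  measurable_fun (`[0, T]%classic : set (measurableTypeR R)) w /\
  mu.-integrable `[0, T]%classic (fun t => (w t ^+ 2)%:E).

Definition sqnorm_L2 (w : R -> R) : R := \int[mu]_(t in `[0, T]) (w t ^+ 2).

Definition admissible N (a b u : 'I_N -> R -> R) : Prop :=
  forall i, L2 (u i) /\
    {ae mu, forall t, t \in `[0, T] -> a i t <= u i t <= b i t}.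

(* Joint measurability selects, in each class of L^2(0,T;W^{2,b}), the         *)
(* representatives that are functions of (t, x): without it "a.e. (t, x, v)"   *)
(* would depend on the representatives chosen at the individual times.         *)
Definition fields (b : R) : set (R -> space3 -> space3) :=
  [set B | bochner T (vsobolev 2 b) (vsobolev_norm 2 b) 2%:E B /\
     measurable_fun [set tx : measurableTypeR R * space3 | (tx.1 : R) \in `[0, T]]
       (fun tx => B tx.1 tx.2)].

Definition field_norm (b : R) (B : R -> space3 -> space3) : \bar R :=
  bochner_norm T (vsobolev_norm 2 b) 2%:E B.

Definition field_ball (b K : R) : set (R -> space3 -> space3) :=
  [set B | fields b B /\ (field_norm b B <= K%:E)%E].

Definition control_field N (m : 'I_N -> space3 -> space3) (u : 'I_N -> R -> R)
    (t : R) (x : space3) : space3 :=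
  vec3 (fun j => \sum_i u i t * coord (m i x) j).

Definition potential (h : space6 -> R) (x : space3) : R :=
  \int[leb6]_z (h z / enorm3 (x - z.1)).

(* [W^{1,2}(0,T;C_b)], with [ft] the weak time derivative of [f]; an identity  *)
(* between Bochner integrals in C_b is an identity at every point of R^6.      *)
Definition W12_Cb (f ft : R -> space6 -> R) : Prop :=
  [/\ bochner T (@Cb _ R space6) (@sup_norm _ R space6) 2%:E f,
      bochner T (@Cb _ R space6) (@sup_norm _ R space6) 2%:E ft &
      forall z, weak_partial mu basis1 `]0, T[%classic [:: ord0]
                  (fun t => f t z) (fun t => ft t z)].

Definition solution_space (q : R) (f ft : R -> space6 -> R) : Prop :=
  [/\ W12_Cb f ft,
      continuous_in T (C1b basis6) (C1b_norm basis6) f,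
      bochner T (sobolev leb6 basis6 2 q) (sobolev_norm leb6 basis6 2 q) +oo%E f &
      exists r : R, forall t, t \in `[0, T] -> tsupport (f t) `<=` ball6 r].

(* f_t + v . d_x f - d_x psi . d_v f + (v x B) . d_v f at a fixed time *)
Definition vlasov (psi : space3 -> R) (B : space3 -> space3) (f ft : space6 -> R)
    (z : space6) : R :=
  ft z + dot z.2 (gradx f z) - dot (grad psi z.1) (gradv f z)
    + dot (cross z.2 (B z.1)) (gradv f z).

Definition strong_state (b : R) (f0 : space6 -> R) (B : R -> space3 -> space3)
    (f : R -> space6 -> R) : Prop :=
  exists2 ft, solution_space b f ft &
    {ae (mu \x leb6)%E, forall tz, (tz.1 : R) \in `[0, T] ->
       vlasov (potential (f tz.1)) (B tz.1) (f tz.1) (ft tz.1) tz.2 = 0}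
    /\ f 0 = f0.

Definition is_state (b : R) (f0 : space6 -> R) (B : R -> space3 -> space3)
    (f : R -> space6 -> R) : Prop :=
  strong_state b f0 B f /\
  forall f', strong_state b f0 B f' -> forall t, t \in `[0, T] -> f' t = f t.

Definition Phi (phi eta : space6 -> R) (x : space3) : R :=
  - \int[leb6]_z (dot (x - z.1) (gradv phi z) / enorm3 (x - z.1) ^+ 3 * eta z).

Definition strong_costate (chi fd : space6 -> R) (B : R -> space3 -> space3)
    (f g : R -> space6 -> R) : Prop :=
  exists2 gt, solution_space 2 g gt &
    {ae (mu \x leb6)%E, forall tz, (tz.1 : R) \in `[0, T] ->
       vlasov (potential (f tz.1)) (B tz.1) (g tz.1) (gt tz.1) tz.2 =
       Phi (f tz.1) (g tz.1) tz.2.1 * chi tz.2}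
    /\ g T = (fun z => f T z - fd z).

Definition is_costate (chi fd : space6 -> R) (B : R -> space3 -> space3)
    (f g : R -> space6 -> R) : Prop :=
  strong_costate chi fd B f g /\
  forall g', strong_costate chi fd B f g' -> forall t, t \in `[0, T] -> g' t = g t.

(* [Z] solves x' = v, v' = F(s, x, v) on [0, T] in the sense of Caratheodory   *)
Definition solves_ode (F : R -> space6 -> space3) (Z : R -> space6) : Prop :=
  [/\ {within `[0, T]%classic, continuous Z},
      forall i, mu.-integrable `[0, T]%classic (fun s => (coord (F s (Z s)) i)%:E) &
      forall s1 s2, 0 <= s1 -> s1 <= s2 -> s2 <= T -> forall i,
        coord (Z s2).1 i - coord (Z s1).1 i =
          \int[mu]_(s in `[s1, s2]) coord (Z s).2 i /\
        coord (Z s2).2 i - coord (Z s1).2 i =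
          \int[mu]_(s in `[s1, s2]) coord (F s (Z s)) i].

Definition force (B : R -> space3 -> space3) (f : R -> space6 -> R) (s : R)
    (z : space6) : space3 :=
  cross z.2 (B s z.1) - grad (potential (f s)) z.1.

(* Every field of W^{2,b}, b > 3, has a continuous representative; the         *)
(* characteristics, unlike the a.e. equations, need that representative.       *)
Definition flow_bound (b K r rZ : R)
    (state : (R -> space3 -> space3) -> R -> space6 -> R) : Prop :=
  forall B, field_ball b K B ->
    {ae mu, forall t, t \in `[0, T] -> continuous (B t)} ->
  forall Z t s, solves_ode (force B (state B)) Z ->
    t \in `[0, T] -> s \in `[0, T] -> ball6 r (Z t) -> enorm6 (Z s) <= rZ.

Definition cost N (lam : 'I_N -> R) (fd : space6 -> R)
    (fu : ('I_N -> R -> R) -> R -> space6 -> R) (u : 'I_N -> R -> R) : R :=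
  2^-1 * \int[leb6]_z ((fu u T z - fd z) ^+ 2)
    + \sum_i lam i / 2 * sqnorm_L2 (u i).

Definition locally_optimal N (a b : 'I_N -> R -> R) (J : ('I_N -> R -> R) -> R)
    (ubar : 'I_N -> R -> R) : Prop :=
  admissible a b ubar /\
  exists2 delta : R, 0 < delta & forall u, admissible a b u ->
    Num.sqrt (\sum_i sqnorm_L2 (fun t => ubar i t - u i t)) < delta ->
    J ubar <= J u.

Definition p_fun N (m : 'I_N -> space3 -> space3) (f g : R -> space6 -> R)
    (i : 'I_N) (t : R) : R :=
  \int[leb6]_z (dot (cross z.2 (m i z.1)) (gradv (f t) z) * g t z).

Definition proj_itv (a b xi : R) : R := Num.min (Num.max xi a) b.

Definition variational_inequality N (lam : 'I_N -> R) (a b p ubar : 'I_N -> R -> R) :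
    Prop :=
  forall u, admissible a b u -> forall i,
    0 <= \int[mu]_(t in `[0, T]) ((lam i * ubar i t - p i t) * (u i t - ubar i t)).

Definition projection_formula N (lam : 'I_N -> R) (a b p ubar : 'I_N -> R -> R) :
    Prop :=
  {ae mu, forall t, t \in `[0, T] -> forall i,
    ubar i t = proj_itv (a i t) (b i t) ((lam i)^-1 * p i t)}.

End Time.
End Space.

(* Main.v *)
(* Write [d = f_u - f_ubar], [w = u - ubar] for two admissible controls. At almost   *)
(* every time [d] solves a transport equation with divergence-free coefficients and  *)
(* source [dpsi_d . dv f - (v x B(w)) . dv f]; since the kernel [1/|x|^2] and the    *)
(* squares [|m_i|^2 <= 1 + |m_i|^beta] are locally integrable, multiplying by [d]    *)
(* gives [(int d^2)' <= C (int d^2 + |w|^2)], so [int d^2 <= C ||w||^2] by Gronwall. *)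
(* Pairing [d] with the costate [g], the source [Phi chi] of [g] is by Fubini the    *)
(* adjoint of [d |-> dpsi_d . dv f], so that, up to [O(||w||^2)], [int d(T) g(T)]    *)
(* equals [- sum_i int w_i p_i]. As [g(T) = f_ubar(T) - fd], this yields             *)
(*   [J(ubar + h w) - J(ubar) <= h sum_i int (lam_i ubar_i - p_i) w_i + C h^2],      *)
(* and local optimality forces the linear term to be nonnegative. The variational    *)
(* inequality is compared with the projection formula by testing it with the         *)
(* projection itself.                                                                *)
Require Import Defs.
From HB Require Import structures.
From mathcomp Require Import all_boot all_order all_algebra.
From mathcomp Require Import all_classical all_reals all_analysis.
From mathcomp Require Import measurable_realfun ring lra.

Set Implicit Arguments.
Unset Strict Implicit.
Unset Printing Implicit Defensive.

Import Order.TTheory GRing.Theory Num.Theory.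
Import numFieldNormedType.Exports.

Local Open Scope classical_set_scope.
Local Open Scope ring_scope.

(* MathComp's [vector.coord] shadows the coordinates of [space3]. *)
Local Notation coord := Defs.coord.

(** * Real-valued integrals *)

(** The cost is quadratic in the terminal state. Write [d] for the difference of a perturbed state
    and the state of [ubar], and [e] for the increment of the control. Since the costate ends at
    [g(T) = f(T) - fd], the tracking part of [J] grows by [int d(T) g(T)] plus half of [int d(T)^2],
    and the control part expands explicitly. Two estimates then give the first-order expansion of
    [J]: [int d(T)^2] is at most a multiple of [||e||^2], and [int d(T) g(T)] equals minus the sum
    of the integrals of [e_k p_k], up to such a multiple. Both are stated in [state_perturbation];
    they come from pairing with the costate instead of differentiating the control-to-state map.

    At one fixed time they reduce to [energy_step]. The transport operator is a derivation with
    divergence-free coefficients, so it integrates to zero on [d^2] and on [d g] ([transport_null]).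
    Of the two sources of the equation of [d], the self-consistent one is adjoint to the right-hand
    side of the costate equation ([grad_potential_adjoint]) and cancels, while the one from the
    control pairs with [g] to give [p]. The rest is quadratic: [grad_potential_remainder] follows
    from Schur's test for the kernel [1/|x|^2], and [cross_remainder] from Young's inequality and
    the local square-integrability of the fields ([vsobolev_loc]). The force is known through
    [is_derive_potential], and integrations by parts are made line by line ([line_null]), since the
    coefficients are merely measurable in the other directions.

    To pass to [[0, T]], [weak_derivative_primitive] shows that at every point of phase space a
    strong solution is a primitive of its weak time derivative, and [time_product] turns this into a
    product rule for [int F G]. Then [gronwall] bounds [int d^2], and integrating the pairing in
    time gives the second estimate.

    Admissible controls form a convex set, so local optimality may be tested along segments;
    [first_order_nonneg] keeps the linear term, which is (NC1). For the equivalence with (NC2),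
    [vi_projection] tests (NC1) with the pointwise projection itself: by [proj_itv_gap] this forces
    the square of the difference to have integral zero. Continuity of [p] comes from the continuity
    in time of state and costate in the [C^1] norm ([p_fun_continuous]). *)

Section RealIntegral.
Context d (T : measurableType d) (R : realType) (mu : {measure set T -> \bar R}).
Implicit Types (D : set T) (f g : T -> R).

Definition intble D f := mu.-integrable D (EFin \o f).

Lemma intble_meas D f : intble D f -> measurable_fun D f.
Proof. by case/integrableP => /measurable_EFinP. Qed.

Lemma intble_ext D f g : (forall x, f x = g x) -> intble D f -> intble D g.
Proof. by move=> /funext ->. Qed.

Lemma intble0 D : intble D (fun=> 0).
Proof. exact: integrable0. Qed.

Lemma intbleD D f g : measurable D -> intble D f -> intble D g ->
  intble D (fun x => f x + g x).
Proof. by move=> mD fi gi; have := integrableD mD fi gi. Qed.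

Lemma intbleB D f g : measurable D -> intble D f -> intble D g ->
  intble D (fun x => f x - g x).
Proof. by move=> mD fi gi; have := integrableB mD fi gi. Qed.

Lemma intbleZ D f r : measurable D -> intble D f -> intble D (fun x => r * f x).
Proof. by move=> mD fi; have := integrableZl mD r fi. Qed.

Lemma intbleN D f : measurable D -> intble D f -> intble D (fun x => - f x).
Proof.
by move=> mD /(intbleZ (-1) mD); apply: intble_ext => x; rewrite mulN1r.
Qed.

Lemma intble_norm D f : intble D f -> intble D (fun x => `|f x|).
Proof. by move=> fi; have := integrable_norm fi. Qed.

Lemma intble_sum (I : Type) (s : seq I) (h : I -> T -> R) D : measurable D ->
  (forall i, intble D (h i)) -> intble D (fun x => \sum_(i <- s) h i x).
Proof.
move=> mD hi; elim: s => [|i s IH].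
  by apply: intble_ext (intble0 D) => x; rewrite big_nil.
by apply: intble_ext (intbleD mD (hi i) IH) => x; rewrite big_cons.
Qed.

Lemma intble_aele D f g : measurable D -> measurable_fun D f ->
  {ae mu, forall x, D x -> `|f x| <= g x} -> intble D g -> intble D f.
Proof.
move=> mD mf fg gi; apply/integrableP; split; first exact/measurable_EFinP.
have /integrableP[_] := intble_norm gi; apply: le_lt_trans.
apply: ae_ge0_le_integral => //.
- by do 2 apply: measurableT_comp => //.
- by apply: measurableT_comp => //; exact: measurable_int (intble_norm gi).
- apply: filterS fg => x fg Dx /=; rewrite lee_fin normr_id.
  exact: le_trans (fg Dx) (ler_norm _).
Qed.

Lemma intble_le D f g : measurable D -> measurable_fun D f ->
  (forall x, D x -> `|f x| <= g x) -> intble D g -> intble D f.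
Proof. by move=> mD mf fg; apply: intble_aele => //; exact: aeW. Qed.

Lemma intble_mul_bd D f g C : measurable D -> measurable_fun D g ->
  (forall x, D x -> `|g x| <= C) -> intble D f -> intble D (fun x => g x * f x).
Proof.
move=> mD mg gC fi.
have mf := intble_meas fi.
apply: (intble_le mD _ _ (intbleZ C mD (intble_norm fi))).
  exact: measurable_funM.
by move=> x Dx; rewrite normrM ler_wpM2r// gC.
Qed.

Lemma intble_cst D r : measurable D -> (mu D < +oo)%E -> intble D (fun=> r).
Proof.
move=> mD Doo; apply: measurable_bounded_integrable => //.
by exists `|r|; split => // x rx y _ /=; exact: ltW.
Qed.

Lemma intble_sub D E f : measurable D -> measurable E -> E `<=` D ->
  intble D f -> intble E f.
Proof. by move=> mD mE ED; exact: integrableS. Qed.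

Lemma intble_patch D f : measurable D ->
  intble D f <-> intble setT (f \_ D).
Proof.
move=> mD; rewrite /intble -restrict_EFin; split.
  by move=> /(integrable_mkcond _ mD).
by move=> ?; apply/(integrable_mkcond _ mD).
Qed.

Lemma intble_indicM D f : measurable D ->
  intble D f <-> intble setT (fun x => \1_D x * f x).
Proof.
move=> mD; rewrite intble_patch//; suff -> : f \_ D = (fun x => \1_D x * f x) by [].
apply/funext => x; rewrite patchE indicE; case: ifPn => xD.
  by rewrite mul1r.
by rewrite mul0r.
Qed.

Lemma Rint_indicM D f :
  \int[mu]_(x in D) f x = \int[mu]_x (\1_D x * f x).
Proof.
rewrite Rintegral_mkcond; apply: eq_Rintegral => x _.
rewrite patchE indicE; case: ifPn => xD.
  by rewrite mul1r.
by rewrite mul0r.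
Qed.

Lemma RintN D f : measurable D -> intble D f ->
  \int[mu]_(x in D) (- f x) = - \int[mu]_(x in D) f x.
Proof.
move=> mD fi; rewrite -mulN1r -(RintegralZl _ mD fi).
by apply: eq_Rintegral => x _; rewrite mulN1r.
Qed.

Lemma Rint_sum (I : Type) (s : seq I) (h : I -> T -> R) D : measurable D ->
  (forall i, intble D (h i)) ->
  \int[mu]_(x in D) (\sum_(i <- s) h i x) = \sum_(i <- s) \int[mu]_(x in D) h i x.
Proof.
move=> mD hi; elim: s => [|i s IH].
  rewrite big_nil -[RHS](mul0r (fine (mu D))) -Rintegral_cst//.
  by apply: eq_Rintegral => x _; rewrite big_nil.
rewrite big_cons -IH -(RintegralD mD (hi i) (intble_sum s mD hi)).
by apply: eq_Rintegral => x _; rewrite big_cons.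
Qed.

Lemma Rint_aeeq D f g : measurable D -> measurable_fun D f ->
  measurable_fun D g -> {ae mu, forall x, D x -> f x = g x} ->
  \int[mu]_(x in D) f x = \int[mu]_(x in D) g x.
Proof.
move=> mD mf mg fg; rewrite /Rintegral; congr fine; apply: ae_eq_integral => //.
- exact/measurable_EFinP.
- exact/measurable_EFinP.
- by apply: filterS fg => x fg Dx; rewrite fg.
Qed.

Lemma Rint_aele D f g : measurable D -> intble D f -> intble D g ->
  {ae mu, forall x, D x -> f x <= g x} ->
  \int[mu]_(x in D) f x <= \int[mu]_(x in D) g x.
Proof.
(* [min f g] agrees with [f] almost everywhere and lies below [g] everywhere, which is what
   [le_Rintegral] asks for. *)
move=> mD fi gi fg; pose h x := Num.min (f x) (g x).
have mf := intble_meas fi; have mg := intble_meas gi.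
have mh : measurable_fun D h by exact: measurable_minr.
have hi : intble D h.
  apply: (intble_le mD mh _ (intbleD mD (intble_norm fi) (intble_norm gi))).
  by move=> x _; rewrite /h; case: (ltP (f x) (g x)) => _; rewrite ?lerDl ?lerDr.
have -> : \int[mu]_(x in D) f x = \int[mu]_(x in D) h x.
  apply: Rint_aeeq => //.
  by apply: filterS fg => x fg Dx; rewrite /h; apply/esym/min_idPl/fg.
by apply: le_Rintegral => // x _; rewrite /h ge_min lexx orbT.
Qed.

Lemma Rint_le D f g : measurable D -> intble D f -> intble D g ->
  (forall x, D x -> f x <= g x) ->
  \int[mu]_(x in D) f x <= \int[mu]_(x in D) g x.
Proof. exact: le_Rintegral. Qed.

Lemma Rint_norm_le D f g : measurable D -> measurable_fun D f -> intble D g ->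
  {ae mu, forall x, D x -> `|f x| <= g x} ->
  `|\int[mu]_(x in D) f x| <= \int[mu]_(x in D) g x.
Proof.
move=> mD mf gi fg; have fi := intble_aele mD mf fg gi.
apply: le_trans (le_normr_Rintegral mD fi) _.
exact: (Rint_aele mD (intble_norm fi) gi fg).
Qed.

Lemma Rint_aege0 D f : measurable D -> intble D f ->
  {ae mu, forall x, D x -> 0 <= f x} -> 0 <= \int[mu]_(x in D) f x.
Proof.
move=> mD fi f0; have := Rint_aele mD (intble0 D) fi f0.
by rewrite Rintegral_cst// mul0r.
Qed.

Lemma Rint_eq0 D f : (forall x, D x -> f x = 0) -> \int[mu]_(x in D) f x = 0.
Proof.
move=> f0; rewrite (_ : \int[mu]_(x in D) f x = \int[mu]_(x in D) (fun=> 0 : R) x).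
  by rewrite /Rintegral integral0.
by apply: eq_Rintegral => x /set_mem; exact: f0.
Qed.

Lemma Rint_supp D f : (forall x, ~ D x -> f x = 0) ->
  \int[mu]_(x in D) f x = \int[mu]_x f x.
Proof.
move=> f0; rewrite Rint_indicM; apply: eq_Rintegral => x _.
rewrite indicE; case: (boolP (x \in D)) => xD; rewrite ?mul1r// mul0r.
by rewrite f0// => Dx; rewrite mem_set in xD.
Qed.

Lemma intble_supp D f : measurable D -> (forall x, ~ D x -> f x = 0) ->
  intble D f -> intble setT f.
Proof.
move=> mD f0 /(intble_indicM _ mD); apply: intble_ext => x.
rewrite indicE; case: (boolP (x \in D)) => xD; rewrite ?mul1r// mul0r.
by rewrite f0// => Dx; rewrite mem_set in xD.
Qed.

Lemma intble_fine D (F : T -> \bar R) : measurable D -> mu.-integrable D F ->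
  intble D (fine \o F).
Proof.
move=> mD Fi; apply: (le_integrable mD _ _ Fi).
  apply/measurable_EFinP; apply: (measurableT_comp (fine_measurable measurableT)).
  exact: measurable_int Fi.
by move=> x _ /=; case: (F x) => [r||] //=; rewrite leey.
Qed.

End RealIntegral.

(** * Fubini and Tonelli for real-valued integrands *)

Section RealFubini.
Context d1 d2 (T1 : measurableType d1) (T2 : measurableType d2) (R : realType).
Variables (m1 : {sigma_finite_measure set T1 -> \bar R})
          (m2 : {sigma_finite_measure set T2 -> \bar R}).
Local Notation m12 := (m1 \x m2)%E.

Lemma fubini_intble1 (F : T1 * T2 -> R) : intble m12 setT F ->
  intble m1 setT (fun x => \int[m2]_y F (x, y)).
Proof. by move=> Fi; exact: intble_fine (integrable_fubini_F Fi). Qed.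

Lemma integrable_fubini_G (F : T1 * T2 -> \bar R) : m12.-integrable setT F ->
  m2.-integrable setT (fubini_G m1 F).
Proof.
move=> Fi; apply/integrableP; split; first exact: measurable_fubini_G Fi.
have mF := measurable_int _ Fi.
apply: le_lt_trans ((integrable21ltyP m1 m2 mF).1 Fi).
apply: ge0_le_integral => //.
- by apply: measurableT_comp => //; exact: measurable_fubini_G Fi.
- apply: (measurable_fun_fubini_tonelli_G (fun z => `|F z|)%E) => //.
  exact: measurableT_comp.
- move=> y _; apply: le_abse_integral => //.
  exact: measurableT_comp mF (pair2_measurable y).
Qed.

Lemma fubini_intble2 (F : T1 * T2 -> R) : intble m12 setT F ->
  intble m2 setT (fun y => \int[m1]_x F (x, y)).
Proof. by move=> Fi; exact: intble_fine (integrable_fubini_G Fi). Qed.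

(** On slices that fail to be integrable the real inner integral takes the default value [0]; these
    slices form a null set, so the extended-real theorem carries over. *)
Lemma fubiniR1 (F : T1 * T2 -> R) : intble m12 setT F ->
  \int[m12]_z F z = \int[m1]_x \int[m2]_y F (x, y).
Proof.
move=> Fi; rewrite {1}/Rintegral -(integral12_prod_meas1 Fi); congr fine.
have Gi := integrable_fubini_F Fi.
apply: ae_eq_integral => //.
- exact: measurable_int Gi.
- exact: measurable_int (fubini_intble1 Fi).
apply: filterS (ae_integrable1 Fi) => x xi _.
by rewrite /Rintegral fineK//; exact: integrable_fin_num.
Qed.

Lemma fubiniR2 (F : T1 * T2 -> R) : intble m12 setT F ->
  \int[m12]_z F z = \int[m2]_y \int[m1]_x F (x, y).
Proof.
move=> Fi; rewrite {1}/Rintegral -(integral21_prod_meas1 Fi); congr fine.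
have Gi := integrable_fubini_G Fi.
apply: ae_eq_integral => //.
- exact: measurable_int Gi.
- exact: measurable_int (fubini_intble2 Fi).
apply: filterS (ae_integrable2 Fi) => x xi _.
by rewrite /Rintegral fineK//; exact: integrable_fin_num.
Qed.

Lemma fubini_ae1 (F : T1 * T2 -> R) : intble m12 setT F ->
  {ae m1, forall x, intble m2 setT (fun y => F (x, y))}.
Proof. exact: ae_integrable1. Qed.

Lemma fubini_ae2 (F : T1 * T2 -> R) : intble m12 setT F ->
  {ae m2, forall y, intble m1 setT (fun x => F (x, y))}.
Proof. exact: ae_integrable2. Qed.

Lemma tonelli_intble1 (F : T1 * T2 -> R) (g : T1 -> R) : measurable_fun setT F ->
  intble m1 setT g ->
  {ae m1, forall x, (\int[m2]_y `|F (x, y)|%:E <= (g x)%:E)%E} ->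
  intble m12 setT F.
Proof.
move=> mF gi Fg; apply/(integrable12ltyP _ _ (_ : measurable_fun setT _)).
  exact/measurable_EFinP.
have /integrableP[_] := gi; apply: le_lt_trans.
apply: ae_ge0_le_integral => //.
- by move=> x _; exact: integral_ge0.
- apply: (measurable_fun_fubini_tonelli_F (fun z => `|(F z)%:E|)%E) => //.
  by apply: measurableT_comp => //; exact/measurable_EFinP.
- by apply: measurableT_comp => //; exact: measurable_int gi.
- apply: filterS Fg => x Fg _; apply: le_trans Fg _ => /=.
  by rewrite lee_fin ler_norm.
Qed.

Lemma tonelli_intble2 (F : T1 * T2 -> R) (g : T2 -> R) : measurable_fun setT F ->
  intble m2 setT g ->
  {ae m2, forall y, (\int[m1]_x `|F (x, y)|%:E <= (g y)%:E)%E} ->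
  intble m12 setT F.
Proof.
move=> mF gi Fg; apply/(integrable21ltyP _ _ (_ : measurable_fun setT _)).
  exact/measurable_EFinP.
have /integrableP[_] := gi; apply: le_lt_trans.
apply: ae_ge0_le_integral => //.
- by move=> x _; exact: integral_ge0.
- apply: (measurable_fun_fubini_tonelli_G (fun z => `|(F z)%:E|)%E) => //.
  by apply: measurableT_comp => //; exact/measurable_EFinP.
- by apply: measurableT_comp => //; exact: measurable_int gi.
- apply: filterS Fg => x Fg _; apply: le_trans Fg _ => /=.
  by rewrite lee_fin ler_norm.
Qed.

Lemma intble_tensor (f : T1 -> R) (g : T2 -> R) : intble m1 setT f ->
  intble m2 setT g -> intble m12 setT (fun z => f z.1 * g z.2).
Proof.
move=> fi gi.
have mf := intble_meas fi; have mg := intble_meas gi.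
apply: (@tonelli_intble1 _ (fun x => (\int[m2]_y `|g y|) * `|f x|)).
- by apply: measurable_funM; apply: measurableT_comp.
- exact: intbleZ (intble_norm fi).
- apply: aeW => x /=; rewrite EFinM /Rintegral fineK; last first.
    exact: (integrable_fin_num _ (intble_norm gi)).
  have -> : (\int[m2]_y `|f x * g y|%:E = \int[m2]_y (`|f x|%:E * `|g y|%:E))%E.
    by apply: eq_integral => y _; rewrite normrM EFinM.
  by rewrite muleC ge0_integralZl_EFin//; do 2 apply: measurableT_comp => //.
Qed.

Lemma Rint_tensor (f : T1 -> R) (g : T2 -> R) : intble m1 setT f ->
  intble m2 setT g ->
  \int[m12]_z (f z.1 * g z.2) = (\int[m1]_x f x) * \int[m2]_y g y.
Proof.
move=> fi gi; rewrite fubiniR1; last exact: intble_tensor.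
rewrite -RintegralZr//; apply: eq_Rintegral => x _.
exact: (RintegralZl (f x) measurableT gi).
Qed.

(** Tonelli applies to the positive and the negative part separately, and their difference is taken
    in the extended reals; so measurability in the parameter holds even where the slices are not
    integrable. *)
Lemma meas_fubini1 (F : T1 * T2 -> R) : measurable_fun setT F ->
  measurable_fun setT (fun x => \int[m2]_y F (x, y)).
Proof.
move=> mF; apply: (measurableT_comp (fine_measurable measurableT)).
have mE : measurable_fun setT (EFin \o F) by exact/measurable_EFinP.
rewrite (_ : (fun _ => _) = (fun x => fubini_F m2 (EFin \o F)^\+%E x -
   fubini_F m2 (EFin \o F)^\-%E x)%E).
  apply: emeasurable_funB; apply: measurable_fun_fubini_tonelli_F => //.
  - exact: measurable_funepos.
  - exact: measurable_funeneg.
apply/funext => x; rewrite integralE /fubini_F; congr (_ - _)%E;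
  by apply: eq_integral => y _; rewrite ?funeposE ?funenegE.
Qed.

End RealFubini.

(** * Open sets and product sigma-algebras *)

Section BorelBasis.
Variable R : realType.

(** A countable network of measurable sets. It passes to products, and it makes every open set a
    countable union of measurable sets; this ties the topology of [space3] and [space6] to their
    product sigma-algebras. *)
Definition has_mbasis d (E : measNormedModType d R) :=
  exists2 B : nat -> set E, (forall n, measurable (B n)) &
    forall (x : E) (U : set E), nbhs x U -> exists2 n, B n x & B n `<=` U.

Lemma mbasis_open_measurable d (E : measNormedModType d R) (U : set E) :
  has_mbasis E -> open U -> measurable U.
Proof.
move=> [B mB basB] oU.
have -> : U = \bigcup_(n in [set n | B n `<=` U]) B n.
  apply/seteqP; split => [x Ux|x [n /= BU]]; last exact: BU.
  have [n Bx BU] := basB x U (open_nbhs_nbhs (conj oU Ux)).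
  by exists n.
by apply: bigcup_measurable => n _; exact: mB.
Qed.

Lemma mbasis_continuous_measurable d (E : measNormedModType d R) (f : E -> R) :
  has_mbasis E -> continuous f -> measurable_fun setT f.
Proof.
move=> bE /continuousP cf; apply: (measurability _ (RGenOpens.measurableE R)).
move=> _ [_ [a [b ->] <-]]; rewrite setTI.
by apply: mbasis_open_measurable => //; exact/cf/interval_open.
Qed.

Lemma mbasis_prod d1 d2 (E1 : measNormedModType d1 R) (E2 : measNormedModType d2 R) :
  has_mbasis E1 -> has_mbasis E2 -> has_mbasis (E1 * E2)%type.
Proof.
move=> [B1 mB1 bas1] [B2 mB2 bas2].
exists (fun n => if (unpickle n : option (nat * nat)) is Some ij
               then B1 ij.1 `*` B2 ij.2 else set0).
  by move=> n; case: unpickle => [[i j]|]; [exact: measurableX|exact: measurable0].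
move=> [x y] U /= [[V W] /= [xV yW] VWU].
have [i Bx BV] := bas1 x V xV; have [j By BW] := bas2 y W yW.
exists (pickle (i, j)); rewrite pickleK /=; first by [].
by move=> [a b] /= [Ba Bb]; apply: VWU; split; [exact: BV|exact: BW].
Qed.

Lemma mbasis_R : has_mbasis (measurableTypeR R).
Proof.
exists (fun n => if (unpickle n : option (rat * rat)) is Some pq
               then `](ratr pq.1 : R), ratr pq.2[%classic else set0).
  by move=> n; case: unpickle => [[i j]|]; [exact: measurable_itv|exact: measurable0].
move=> x U /nbhs_ballP [e /= e0 xeU].
have [p pe] := @rat_in_itvoo R (x - e) x ltac:(rewrite gtrBl; exact: e0).
have [q qe] := @rat_in_itvoo R x (x + e) ltac:(rewrite ltrDl; exact: e0).
exists (pickle (p, q)); rewrite pickleK /=.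
  by rewrite in_itv/= (itvP pe) (itvP qe).
move=> y /=; rewrite in_itv/= => /andP[py yq]; apply: xeU.
rewrite /ball /= ltr_distlC.
by rewrite (lt_trans _ py) ?(itvP pe)//= (lt_trans yq) ?(itvP qe).
Qed.

End BorelBasis.

(** * Integrals of directional derivatives *)

Section LineIntegral.
Variable R : realType.

(** All conditions concern single lines in the direction [e], and the bound on the support may vary
    with the line. So [H] may carry factors that are only measurable across these lines, such as the
    fields of the transport operator. *)
Definition line_primitive d (E : measNormedModType d R) (e : E) (H H' : E -> R) :=
  [/\ forall z, is_derive z e H (H' z),
      forall z, continuous (fun s : R => H' (z + s *: e)) &
      forall z, exists rho, forall s : R, rho < `|s| -> H (z + s *: e) = 0].

Definition line_null d (E : measNormedModType d R)
    (mu : {measure set E -> \bar R}) (e : E) :=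
  forall H H', line_primitive e H H' -> intble mu setT H' -> \int[mu]_z H' z = 0.

(** Fubini splits off the other factor; almost every slice is integrable, and the property of [m1]
    makes its integral zero. *)
Lemma line_null_prod1 d1 d2 (E1 : measNormedModType d1 R)
    (E2 : measNormedModType d2 R)
    (m1 : {sigma_finite_measure set E1 -> \bar R})
    (m2 : {sigma_finite_measure set E2 -> \bar R}) (e : E1) :
  line_null m1 e -> line_null (m1 \x m2)%E ((e, 0) : (E1 * E2)%type).
Proof.
move=> le H H' [dH cH sH] Hi.
have xye (x : E1) (y : E2) (s : R) :
    ((x, y) : (E1 * E2)%type) + s *: ((e, 0) : (E1 * E2)%type) = (x + s *: e, y).
  by congr pair => /=; rewrite scaler0 addr0.
rewrite (fubiniR2 Hi) (_ : \int[m2]_y _ = \int[m2]_y (fun=> 0 : R) y).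
  exact: Rint_eq0.
have mG := intble_meas (fubini_intble2 Hi).
apply: Rint_aeeq => //.
apply: filterS (fubini_ae2 Hi) => y Hyi _.
apply: (le (fun x => H (x, y))) => //; split.
- move=> x; have [dx vx] := dH (x, y).
  have E (h : R) : h *: ((e, 0) : (E1 * E2)%type) + (x, y) = (h *: e + x, y).
    by rewrite addrC xye addrC.
  have Eq : (fun h : R => h^-1 *: ((fun x => H (x, y)) (h *: e + x) - H (x, y)))
     = (fun h : R => h^-1 *: (H (h *: ((e, 0) : (E1 * E2)%type) + (x, y)) - H (x, y))).
    by apply/funext => h; rewrite E.
  split; first by move: dx; rewrite /derivable /= -/(GRing.scale _ _) Eq.
  by rewrite -vx /derive Eq.
- move=> x; have := cH (x, y).
  by under eq_fun do rewrite xye.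
- move=> x; have [rho rhoP] := sH (x, y); exists rho => s /rhoP.
  by rewrite xye.
Qed.
End LineIntegral.

Section LineIntegralR.
Variable R : realType.

Lemma line_null_prod2 d1 d2 (E1 : measNormedModType d1 R)
    (E2 : measNormedModType d2 R)
    (m1 : {sigma_finite_measure set E1 -> \bar R})
    (m2 : {sigma_finite_measure set E2 -> \bar R}) (e : E2) :
  line_null m2 e -> line_null (m1 \x m2)%E ((0, e) : (E1 * E2)%type).
Proof.
move=> le H H' [dH cH sH] Hi.
have xye (x : E1) (y : E2) (s : R) :
    ((x, y) : (E1 * E2)%type) + s *: ((0, e) : (E1 * E2)%type) = (x, y + s *: e).
  by congr pair => /=; rewrite scaler0 addr0.
rewrite (fubiniR1 Hi) (_ : \int[m1]_y _ = \int[m1]_y (fun=> 0 : R) y).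
  exact: Rint_eq0.
have mG := intble_meas (fubini_intble1 Hi).
apply: Rint_aeeq => //.
apply: filterS (fubini_ae1 Hi) => x Hxi _.
apply: (le (fun y => H (x, y))) => //; split.
- move=> y; have [dx vx] := dH (x, y).
  have E (h : R) : h *: ((0, e) : (E1 * E2)%type) + (x, y) = (x, h *: e + y).
    by rewrite addrC xye addrC.
  have Eq : (fun h : R => h^-1 *: ((fun y => H (x, y)) (h *: e + y) - H (x, y)))
     = (fun h : R => h^-1 *: (H (h *: ((0, e) : (E1 * E2)%type) + (x, y)) - H (x, y))).
    by apply/funext => h; rewrite E.
  split; first by move: dx; rewrite /derivable /= Eq.
  by rewrite -vx /derive Eq.
- move=> y; have := cH (x, y).
  by under eq_fun do rewrite xye.
- move=> y; have [rho rhoP] := sH (x, y); exists rho => s /rhoP.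
  by rewrite xye.
Qed.

Lemma line_null_R :
  line_null (@lebesgue_measure R) (1 : measurableTypeR R).
Proof.
move=> H H' [dH cH sH] Hi.
(* Beyond [rho] both [H] and [H'] vanish, so only [[-r, r]] counts, and [H] is zero at both ends. *)
have [rho rhoP] := sH 0; pose r := Num.max rho 0 + 1.
have z1 (s : R) : (0 : measurableTypeR R) + s *: (1 : measurableTypeR R) = s.
  by rewrite add0r; exact: mulr1.
have H0 (s : R) : rho < `|s| -> H s = 0 by move=> /rhoP; rewrite z1.
have H'0 (s : R) : rho < `|s| -> H' s = 0.
  move=> rs; have [_ <-] := dH s.
  rewrite (@near_eq_derive _ _ _ H (cst 0)); first by rewrite derive_cst.
  near=> t; rewrite /cst; apply: H0; near: t.
  by apply: (@cvgr_norm_gt _ _ _ _ _ id s) => //; exact: cvg_id.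
have r_gt0 : 0 < r by rewrite ltr_wpDl// le_max lexx orbT.
have rho_r : rho < r by rewrite ltr_pwDr// le_max lexx.
have -> : \int[lebesgue_measure]_z H' z =
    \int[lebesgue_measure]_(z in `[-r, r]) H' z.
  apply/esym/Rint_supp => x /negP; rewrite in_itv/= -ler_norml -ltNge => rx.
  exact/H'0/(lt_trans rho_r).
have cH' : continuous (H' : R -> R).
  by move=> x; have := cH 0 x; under eq_fun do rewrite z1.
have dH' (x : R) : is_derive (x : R) (1 : R) (H : R -> R) (H' x) by exact: dH.
have cHc : continuous (H : R -> R).
  by move=> x; apply/differentiable_continuous/derivable1_diffP; case: (dH' x).
rewrite /Rintegral (@continuous_FTC2 _ _ H).
- by rewrite -EFinB H0 ?H0 ?subr0// ?normrN gtr0_norm.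
- by rewrite gtrN.
- exact: continuous_subspaceT.
- split; first by move=> x _; case: (dH' x).
  + exact/cvg_at_right_filter/cHc.
  + exact/cvg_at_left_filter/cHc.
- by move=> x _; rewrite derive1E; have [_ ->] := dH' x.
Unshelve. all: end_near. Qed.
End LineIntegralR.

(** * Translation invariance *)

Section Translation.
Variable R : realType.

Definition translation_invariant d (E : measNormedModType d R)
    (mu : {measure set E -> \bar R}) :=
  forall a : E, measurable_fun setT (fun z => z + a) /\
    forall A, measurable A -> mu ((fun z => z + a) @^-1` A) = mu A.

Lemma translation_invariant_R : translation_invariant (@lebesgue_measure R).
Proof.
move=> a; have ma : measurable_fun setT (fun z : measurableTypeR R => z + a).
  by apply: (@measurable_funD _ _ _ _ id (cst a)).
split => // A mA; pose phi := (fun z : measurableTypeR R => z + a).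
rewrite -[LHS]/(pushforward (@lebesgue_measure R) phi A).
apply/esym; apply: (lebesgue_measure_unique (mu := pushforward (@lebesgue_measure R) phi)) => //= _ [[x y]] _ <- /=.
rewrite /pushforward.
have -> : phi @^-1` `]x, y] = `](x - a : R), (y - a : R)]%classic.
  by apply/seteqP; split => z /=; rewrite !in_itv/= /phi ltrBlDr lerBrDr.
rewrite !lebesgue_measure_itv/= !lte_fin ltrD2r; case: ifP => // _.
by rewrite -!EFinB; congr EFin; rewrite opprB addrA subrK.
Qed.

(** The translated measure has the right values on rectangles, so it is the product measure by
    uniqueness. *)
Lemma translation_invariant_prod d1 d2 (E1 : measNormedModType d1 R)
    (E2 : measNormedModType d2 R)
    (m1 : {sigma_finite_measure set E1 -> \bar R})
    (m2 : {sigma_finite_measure set E2 -> \bar R}) :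
  translation_invariant m1 -> translation_invariant m2 ->
  @translation_invariant _ (E1 * E2)%type (m1 \x m2)%E.
Proof.
move=> t1 t2 [a b]; have [ma tA] := t1 a; have [mb tB] := t2 b.
pose phi : (E1 * E2)%type -> (E1 * E2)%type := fun z => z + (a, b).
have mphi : measurable_fun setT phi.
  apply/measurable_fun_pairP; split.
    exact: (measurableT_comp ma measurable_fst).
  exact: (measurableT_comp mb measurable_snd).
split => // X mX.
rewrite -[LHS]/(pushforward (m1 \x m2)%E phi X).
apply/esym; apply: (product_measure_unique (m' := pushforward (m1 \x m2)%E phi)) => // A B mA mB.
rewrite -[LHS]/((m1 \x m2)%E (((fun z => z + a) @^-1` A) `*` ((fun z => z + b) @^-1` B))).
rewrite product_measure1E; first by rewrite tA// tB.
  by rewrite -[X in measurable X]setTI; exact: ma.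
by rewrite -[X in measurable X]setTI; exact: mb.
Qed.

Lemma ge0_integral_translation d (E : measNormedModType d R)
    (mu : {measure set E -> \bar R}) (f : E -> \bar R) (a : E) :
  translation_invariant mu -> measurable_fun setT f -> (forall x, 0 <= f x)%E ->
  (\int[mu]_z f (z + a)%R = \int[mu]_z f z)%E.
Proof.
move=> /(_ a) [ma ta] mf f0.
have /= <- := ge0_integral_pushforward ma mu measurableT mf (fun x _ => f0 x).
by apply: eq_measure_integral => A mA _; exact: ta.
Qed.

Lemma intble_translation d (E : measNormedModType d R)
    (mu : {measure set E -> \bar R}) (f : E -> R) (a : E) :
  translation_invariant mu -> intble mu setT f ->
  intble mu setT (fun z => f (z + a)).
Proof.
move=> tr fi; have mf := intble_meas fi; have [ma ta] := tr a.
apply/integrableP; split.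
  by apply/measurable_EFinP; exact: (measurableT_comp mf ma).
rewrite (ge0_integral_translation (f := fun z => `|f z|%:E) a tr) //.
- by case/integrableP: fi.
- by do 2 apply: measurableT_comp => //.
Qed.

Lemma Rint_translation d (E : measNormedModType d R)
    (mu : {measure set E -> \bar R}) (f : E -> R) (a : E) :
  translation_invariant mu -> intble mu setT f ->
  \int[mu]_z f (z + a) = \int[mu]_z f z.
Proof.
move=> tr fi; have mf := intble_meas fi; have [ma ta] := tr a.
rewrite /Rintegral; congr fine; rewrite integralE [RHS]integralE.
congr (_ - _)%E.
  rewrite -[RHS](ge0_integral_translation a tr) //.
    by apply: eq_integral => z _; rewrite !funeposE.
  exact/measurable_funepos/measurable_EFinP.
rewrite -[RHS](ge0_integral_translation a tr) //.
  by apply: eq_integral => z _; rewrite !funenegE.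
exact/measurable_funeneg/measurable_EFinP.
Qed.
End Translation.

(** * The Newton kernel *)

Section WeakSingularity.
Variable R : realType.
Local Notation mu := (@lebesgue_measure R).

(* Since [s^2 + t^2 + u^2 >= |s|^(2/3) |t|^(2/3) |u|^(2/3)], the kernel [1/|x|^2] is *)
(* dominated by a product of one-dimensional kernels that are locally integrable.    *)
Definition kappa (s : R) : R := `|s| `^ (- (2 / 3)).

Lemma kappa_ge0 s : 0 <= kappa s. Proof. exact: powR_ge0. Qed.

Lemma kappaN s : kappa (- s) = kappa s. Proof. by rewrite /kappa normrN. Qed.

(** By convention a nonzero power of [0] is [0]. Hence on [[-r, r]], origin included, [kappa] is the
    sum of its restriction to []0, r]] and of the reflection of that restriction. *)
Lemma kappa0 : kappa 0 = 0.
Proof. by rewrite /kappa normr0 powR0// oppr_eq0 mulf_neq0// invr_neq0. Qed.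

Lemma measurable_kappa : measurable_fun setT (kappa : measurableTypeR R -> R).
Proof.
apply: (measurableT_comp (f := (fun x : R => x `^ (- (2 / 3))))).
  exact: measurable_powR.
exact: normr_measurable.
Qed.

(** A primitive is [3 s^(1/3)]. The bound is independent of [a], so it survives the limit
    [a -> 0]. *)
Lemma integral_kappa_away (r a : R) : 0 < a -> a < r ->
  (\int[mu]_(s in `[a, r]) (kappa s)%:E <= (3 * r `^ (1 / 3))%:E)%E.
Proof.
move=> a0 ar; have r0 := lt_trans a0 ar.
pose F (s : R) := 3 * s `^ (1 / 3).
have dF (s : R) : 0 < s -> is_derive s 1 F (kappa s).
  move=> s0; have H := is_derive1_powR (1 / 3) s0.
  have -> : kappa s = 3 * (1 / 3 * s `^ (1 / 3 - 1)).
    rewrite mulrA (_ : 3 * (1 / 3) = 1); last by field.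
    rewrite mul1r /kappa gtr0_norm//; congr (_ `^ _); by field.
  exact: is_deriveZ.
have cF (s : R) : 0 < s -> {for s, continuous F}.
  by move=> /dF[? _]; apply/differentiable_continuous/derivable1_diffP.
rewrite (@continuous_FTC2 _ _ F)//.
- by rewrite -EFinB lee_fin gerBl mulr_ge0// powR_ge0.
- apply/continuous_in_subspaceT => s; rewrite inE/= in_itv/= => /andP[as_ sr].
  have s0 : 0 < s by exact: lt_le_trans as_.
  have : {for s, continuous (fun x : R => x `^ (- (2 / 3)))}.
    apply/differentiable_continuous/derivable1_diffP.
    by case: (is_derive1_powR (- (2 / 3)) s0).
  move=> h; rewrite /continuous_at {2}/kappa (gtr0_norm s0).
  apply: cvg_trans h; apply: near_eq_cvg.
  near=> x; rewrite /kappa gtr0_norm//; near: x.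
  by apply: (@cvgr_gt _ _ _ _ id s) => //; exact: cvg_id.
- split.
  + move=> s; rewrite in_itv/= => /andP[as_ _].
    by case: (dF s (lt_trans a0 as_)).
  + exact/cvg_at_right_filter/cF.
  + exact/cvg_at_left_filter/cF.
- move=> s; rewrite in_itv/= => /andP[as_ _]; rewrite derive1E.
  by have [_ ->] := dF s (lt_trans a0 as_).
Unshelve. all: end_near. Qed.

Lemma intble_kappa_pos (r : R) : 0 < r -> intble mu `]0, r] kappa.
Proof.
move=> r0; apply/integrableP; split.
  apply/measurable_EFinP; apply: measurable_funTS; exact: measurable_kappa.
(* With [n.+2] the left end stays strictly below [r], as [integral_kappa_away] requires, even for
   [n = 0]. *)
pose F n : set (measurableTypeR R) := `[r / n.+2%:R, r]%classic.
have FU : `]0, r]%classic = \bigcup_n F n.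
  apply/seteqP; split => x /=.
    rewrite in_itv/= => /andP[x0 xr].
    have [n nP] : exists n, (r / x < n.+2%:R).
      exists (Num.truncn (r / x)).
      have /andP[_ h] := @truncn_itv _ (r / x) ltac:(rewrite divr_ge0// ltW//).
      by apply: lt_trans h _; rewrite ltr_nat.
    exists n => //; rewrite /F /= in_itv/= xr andbT.
    by rewrite ler_pdivrMr// mulrC -ler_pdivrMr// ltW.
  move=> [n _]; rewrite /F /= !in_itv/= => /andP[h ->]; rewrite andbT.
  by apply: lt_le_trans h; rewrite divr_gt0.
have ndF : nondecreasing_seq F.
  move=> m n mn; rewrite subsetEset /F => x /=; rewrite !in_itv/= => /andP[h ->].
  rewrite andbT; apply: le_trans h.
  by rewrite ler_pM2l// lef_pV2 ?posrE// ler_nat !ltnS.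
rewrite FU.
have mk : measurable_fun setT (fun s : measurableTypeR R => `|(EFin \o kappa) s|%E).
  by apply: measurableT_comp => //; apply/measurable_EFinP; exact: measurable_kappa.
have := @ge0_nondecreasing_set_cvg_integral _ _ _ F (fun s => `|(EFin \o kappa) s|%E) mu
  ndF (fun n => measurable_itv _) (fun n => measurable_funTS mk) (fun n s _ => abse_ge0 _).
move/cvg_lim => <- //.
apply: (@le_lt_trans _ _ (3 * r `^ (1 / 3))%:E); last exact: ltry.
apply: lime_le.
  apply: ereal_nondecreasing_is_cvgn.
  apply: (@ge0_nondecreasing_set_nondecreasing_integral _ _ _ F _ mu ndF) => //.
    by move=> n; exact: measurable_itv.
  by move=> n; exact: measurable_funTS.
apply: nearW => n.
have -> : (\int[mu]_(x in F n) `|(EFin \o kappa) x| =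
    \int[mu]_(s in `[(r / n.+2%:R)%R, r]) (kappa s)%:E)%E.
  by apply: eq_integral => s _; rewrite /= ger0_norm// kappa_ge0.
apply: integral_kappa_away; first by rewrite divr_gt0.
by rewrite ltr_pdivrMr// ltr_pMr// ltr1n.
Qed.

Lemma intble_reflect (f : measurableTypeR R -> R) : intble mu setT f ->
  intble mu setT (fun s => f (- s)).
Proof.
move=> fi; have mN : measurable_fun setT (-%R : measurableTypeR R -> measurableTypeR R).
  exact: oppr_measurable.
have mf := intble_meas fi.
apply/integrableP; split.
  by apply/measurable_EFinP; exact: (measurableT_comp mf mN).
have mE : measurable_fun setT (fun s : measurableTypeR R => `|f s|%:E).
  by do 2 apply: measurableT_comp => //.
have /= <- := ge0_integral_pushforward mN mu measurableT mE
  (fun s _ => abse_ge0 (f s)%:E).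
have /integrableP[_] := fi; apply: le_lt_trans.
rewrite le_eqVlt; apply/orP; left; apply/eqP.
by apply: eq_measure_integral => A mA _; exact: lebesgue_measureN.
Qed.

Lemma intble_kappa (r : R) : 0 < r -> intble mu `[-r, r] kappa.
Proof.
move=> r0; apply/intble_indicM => //.
have /intble_indicM ip := intble_kappa_pos r0.
have {}ip := ip (measurable_itv _).
apply: intble_ext (intbleD measurableT ip (intble_reflect ip)) => s /=.
rewrite kappaN -mulrDl !indicE !mem_setE !in_itv/=.
case: (ltgtP s 0) => [s0|s0|->]; last by rewrite kappa0 !mulr0.
- rewrite oppr_gt0 s0/= add0r lerNl; congr (_%:R * _).
  by rewrite (le_trans (ltW s0) (ltW r0)) andbT.
- rewrite oppr_gt0 ltNge (ltW s0)/= addr0; congr (_%:R * _).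
  by rewrite (le_trans _ (ltW s0))// oppr_le0 ltW.
Qed.

End WeakSingularity.

(** * Boxes, coordinates and Lebesgue measure in dimensions 3 and 6 *)

Section Boxes.
Variable R : realType.

(** The norm of a product space is the maximum norm, so boxes are products of boxes, which suits
    Fubini better than Euclidean balls. *)
Definition box d (E : measNormedModType d R) (r : R) : set E := [set z | `|z| <= r].

Definition finite_boxes d (E : measNormedModType d R)
    (mu : {measure set E -> \bar R}) :=
  forall r, (mu (@box _ E r) < +oo)%E.

Lemma pair_norm_le d1 d2 (E1 : measNormedModType d1 R)
    (E2 : measNormedModType d2 R) (x : E1) (y : E2) r :
  (`|((x, y) : (E1 * E2)%type)| <= r) = (`|x| <= r) && (`|y| <= r).
Proof. by rewrite -ge_max. Qed.

Lemma box_prod d1 d2 (E1 : measNormedModType d1 R) (E2 : measNormedModType d2 R) r :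
  @box _ (E1 * E2)%type r = @box _ E1 r `*` @box _ E2 r.
Proof.
apply/seteqP; split => -[x y]; rewrite /box /= pair_norm_le; first by move/andP.
by move=> [-> ->].
Qed.

Lemma measurable_box d (E : measNormedModType d R) r : has_mbasis E ->
  measurable (@box _ E r).
Proof.
move=> bE; rewrite -[X in measurable X]setCK; apply: measurableC.
apply: mbasis_open_measurable => //.
rewrite [X in open X](_ : _ = (fun z : E => `|z|) @^-1` `]r, +oo[%classic).
  apply: open_comp; last exact: interval_open.
  by move=> z _; exact: norm_continuous.
apply/seteqP; split => z /=; rewrite /box /= in_itv/= andbT ltNge.
  by move/negP.
by move=> /negP.
Qed.

Lemma finite_boxes_R : finite_boxes (@lebesgue_measure R).
Proof.
move=> r; have -> : @box _ (measurableTypeR R) r = `[-r, r]%classic.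
  by apply/seteqP; split => z; rewrite /box /= in_itv/= -ler_norml.
rewrite [X in (X < _)%E](lebesgue_measure_itv `[-r, r])/=.
by case: ifP => // _; rewrite -EFinB ltry.
Qed.

Lemma finite_boxes_prod d1 d2 (E1 : measNormedModType d1 R)
    (E2 : measNormedModType d2 R)
    (m1 : {sigma_finite_measure set E1 -> \bar R})
    (m2 : {sigma_finite_measure set E2 -> \bar R}) :
  has_mbasis E1 -> has_mbasis E2 ->
  finite_boxes m1 -> finite_boxes m2 ->
  @finite_boxes _ (E1 * E2)%type (m1 \x m2)%E.
Proof.
move=> b1 b2 f1 f2 r.
have E : (m1 \x m2)%E (@box _ (E1 * E2)%type r) =
    (m1 (@box _ E1 r) * m2 (@box _ E2 r))%E.
  by rewrite box_prod; apply: product_measure1E; exact: measurable_box.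
rewrite [X in (X < _)%E]E; apply: lte_mul_pinfty => //; last exact: f2.
by rewrite ge0_fin_numE//; exact: f1.
Qed.

Lemma mbasis_space3 : has_mbasis (space3 R).
Proof. by apply: mbasis_prod; [apply: mbasis_prod|]; exact: mbasis_R. Qed.

Lemma mbasis_space6 : has_mbasis (space6 R).
Proof. by apply: mbasis_prod; exact: mbasis_space3. Qed.

Lemma translation_leb3 : @translation_invariant R _ (space3 R) (@leb3 R).
Proof.
apply: translation_invariant_prod; last exact: translation_invariant_R.
by apply: translation_invariant_prod; exact: translation_invariant_R.
Qed.

Lemma translation_leb6 : @translation_invariant R _ (space6 R) (@leb6 R).
Proof. by apply: translation_invariant_prod; exact: translation_leb3. Qed.

Lemma finite_boxes_leb3 : @finite_boxes _ (space3 R) (@leb3 R).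
Proof.
apply: finite_boxes_prod; last exact: finite_boxes_R.
- by apply: mbasis_prod; exact: mbasis_R.
- exact: mbasis_R.
- by apply: finite_boxes_prod; [exact: mbasis_R|exact: mbasis_R|
    exact: finite_boxes_R|exact: finite_boxes_R].
Qed.

Lemma finite_boxes_leb6 : @finite_boxes _ (space6 R) (@leb6 R).
Proof.
by apply: finite_boxes_prod; [exact: mbasis_space3|exact: mbasis_space3|
  exact: finite_boxes_leb3|exact: finite_boxes_leb3].
Qed.

Lemma ord3E (P : 'I_3 -> Prop) : P ord0 -> P (inord 1) -> P (inord 2) ->
  forall i, P i.
Proof.
move=> P0 P1 P2 [[|[|[|//]]] i3].
- by rewrite (_ : Ordinal _ = ord0)//; exact: val_inj.
- by rewrite (_ : Ordinal _ = inord 1)//; apply: val_inj; rewrite /= inordK.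
- by rewrite (_ : Ordinal _ = inord 2)//; apply: val_inj; rewrite /= inordK.
Qed.

Lemma sum3E (V : zmodType) (F : 'I_3 -> V) :
  \sum_i F i = F ord0 + F (inord 1) + F (inord 2).
Proof.
rewrite !big_ord_recr big_ord0/= add0r; congr (F _ + F _ + F _); apply: val_inj => //=;
  by rewrite inordK.
Qed.

Lemma coord0 (x : space3 R) : coord x ord0 = x.1.1.
Proof. by []. Qed.
Lemma coord1 (x : space3 R) : coord x (inord 1) = x.1.2.
Proof. by rewrite /coord (tnth_nth 0) /= inordK. Qed.
Lemma coord2 (x : space3 R) : coord x (inord 2) = x.2.
Proof. by rewrite /coord (tnth_nth 0) /= inordK. Qed.
Definition coordE := (coord0, coord1, coord2).

Lemma coord_vec3 c i : coord (vec3 c : space3 R) i = c i.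
Proof. by elim/ord3E: i; rewrite coordE. Qed.

Lemma dotE (x y : space3 R) : dot x y = x.1.1 * y.1.1 + x.1.2 * y.1.2 + x.2 * y.2.
Proof. by rewrite /dot sum3E !coordE. Qed.

Lemma basis3_0 : basis3 R ord0 = (1, 0, 0).
Proof.
rewrite /basis3 /vec3 eqxx; congr (_, _, _).
  by rewrite (_ : (_ == _) = false)//; apply/eqP => /(congr1 val); rewrite /= inordK.
by rewrite (_ : (_ == _) = false)//; apply/eqP => /(congr1 val); rewrite /= inordK.
Qed.
Lemma basis3_1 : basis3 R (inord 1) = (0, 1, 0).
Proof.
rewrite /basis3 /vec3 eqxx; congr (_, _, _).
  by rewrite (_ : (_ == _) = false)//; apply/eqP => /(congr1 val); rewrite /= inordK.
by rewrite (_ : (_ == _) = false)//; apply/eqP => /(congr1 val); rewrite /= !inordK.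
Qed.
Lemma basis3_2 : basis3 R (inord 2) = (0, 0, 1).
Proof.
rewrite /basis3 /vec3 eqxx; congr (_, _, _).
  by rewrite (_ : (_ == _) = false)//; apply/eqP => /(congr1 val); rewrite /= inordK.
by rewrite (_ : (_ == _) = false)//; apply/eqP => /(congr1 val); rewrite /= !inordK.
Qed.

Lemma line_null_leb3 i : @line_null R _ (space3 R) (@leb3 R) (basis3 R i).
Proof.
elim/ord3E: i; rewrite ?basis3_0 ?basis3_1 ?basis3_2.
- by do 2 apply: line_null_prod1; exact: line_null_R.
- by apply: line_null_prod1; apply: line_null_prod2; exact: line_null_R.
- rewrite -[(0, 0, 1)]/((0, 1) : ((measurableTypeR R * measurableTypeR R) * measurableTypeR R)%type).
  by apply: line_null_prod2; exact: line_null_R.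
Qed.

Lemma basis6x i : basis6 R (lshift 3 i) = (basis3 R i, 0).
Proof. by rewrite /basis6; case: split_ordP => j /eqP; rewrite (eq_lshift, eq_lrshift)// => /eqP ->. Qed.

Lemma basis6v i : basis6 R (rshift 3 i) = (0, basis3 R i).
Proof. by rewrite /basis6; case: split_ordP => j /eqP; rewrite (eq_rshift, eq_rlshift)// => /eqP ->. Qed.

Lemma line_null_leb6x i : @line_null R _ (space6 R) (@leb6 R) ((basis3 R i, 0) : space6 R).
Proof. by apply: line_null_prod1; exact: line_null_leb3. Qed.

Lemma line_null_leb6v i : @line_null R _ (space6 R) (@leb6 R) ((0, basis3 R i) : space6 R).
Proof. by apply: line_null_prod2; exact: line_null_leb3. Qed.
End Boxes.

Section NewtonKernel.
Variable R : realType.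
Local Notation leb3 := (@leb3 R).
Local Notation leb6 := (@leb6 R).
Local Notation S3 := (space3 R).
Local Notation S6 := (space6 R).

Lemma measurable_coords d (T : measurableType d) (f : T -> S3) :
  measurable_fun setT f <->
  [/\ measurable_fun setT (fun t => (f t).1.1), measurable_fun setT (fun t => (f t).1.2)
    & measurable_fun setT (fun t => (f t).2)].
Proof.
split=> [mf|[m1 m2 m3]].
  split.
  - exact: (measurableT_comp measurable_fst (measurableT_comp measurable_fst mf)).
  - exact: (measurableT_comp measurable_snd (measurableT_comp measurable_fst mf)).
  - exact: (measurableT_comp measurable_snd mf).
apply/measurable_fun_pairP; split; last exact: m3.
by apply/measurable_fun_pairP; split.
Qed.

Lemma measurable_coordP d (T : measurableType d) (f : T -> S3) :
  measurable_fun setT f <-> forall i, measurable_fun setT (fun t => coord (f t) i).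
Proof.
rewrite measurable_coords; split=> [[m1 m2 m3]|mf].
  elim/ord3E.
  - exact: m1.
  - by under eq_fun do rewrite coordE; exact: m2.
  - by under eq_fun do rewrite coordE; exact: m3.
split.
- exact: (mf ord0).
- by have := mf (inord 1); under eq_fun do rewrite coordE.
- by have := mf (inord 2); under eq_fun do rewrite coordE.
Qed.

Lemma coordB (x y : S3) i : coord (x - y) i = coord x i - coord y i.
Proof. by elim/ord3E: i; rewrite !coordE. Qed.

Lemma coordD (x y : S3) i : coord (x + y) i = coord x i + coord y i.
Proof. by elim/ord3E: i; rewrite !coordE. Qed.

Lemma coordZ (a : R) (x : S3) i : coord (a *: x) i = a * coord x i.
Proof. by elim/ord3E: i; rewrite !coordE. Qed.

Lemma coord_basis3 i j : coord (basis3 R i) j = (i == j)%:R.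
Proof. exact: coord_vec3. Qed.

Lemma measurable_sub3 d (T : measurableType d) (f g : T -> S3) :
  measurable_fun setT f -> measurable_fun setT g ->
  measurable_fun setT (fun t => f t - g t).
Proof.
move=> /measurable_coordP mf /measurable_coordP mg.
apply/measurable_coordP => i.
by under eq_fun do rewrite coordB; exact: measurable_funB.
Qed.

Lemma measurable_dot d (T : measurableType d) (f g : T -> S3) :
  measurable_fun setT f -> measurable_fun setT g ->
  measurable_fun setT (fun t => dot (f t) (g t)).
Proof.
move=> /measurable_coordP mf /measurable_coordP mg.
by apply: measurable_sum => i; exact: measurable_funM.
Qed.

(** [1/|x|^2], which dominates the components of the gradient of [1/|x|]; its value at the pole is
    [0]. *)
Definition newton2 (x : S3) : R := (dot x x)^-1.

Lemma dot_ge0 (x : S3) : 0 <= dot x x.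
Proof. by rewrite dotE !addr_ge0// -expr2 sqr_ge0. Qed.

Lemma newton2_ge0 x : 0 <= newton2 x.
Proof. by rewrite invr_ge0 dot_ge0. Qed.

Lemma newton2_sub x y : newton2 (x - y) = newton2 (y - x).
Proof. by rewrite /newton2 !dotE /=; congr (_^-1); ring. Qed.

Lemma measurable_newton2 d (T : measurableType d) (f : T -> S3) :
  measurable_fun setT f -> measurable_fun setT (fun t => newton2 (f t)).
Proof.
move=> mf; rewrite (_ : (fun t => _) = (fun t => dot (f t) (f t) `^ (-1))).
  apply: (measurableT_comp (f := (fun x : R => x `^ (-1)))).
    exact: measurable_powR.
  exact: measurable_dot.
by apply/funext => t; rewrite powR_inv1// dot_ge0.
Qed.

Lemma kappa_lb (a D : R) : a != 0 -> a ^+ 2 <= D -> D `^ (- (1 / 3)) <= kappa a.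
Proof.
move=> a0 aD; have na : 0 < `|a| by rewrite normr_gt0.
have D0 : 0 < D by apply: lt_le_trans aD; rewrite exprn_even_gt0.
rewrite /kappa !powRN lef_pV2 ?posrE ?powR_gt0//.
rewrite (_ : 2 / 3 = 2%:R * (1 / 3)); last by field.
rewrite powRrM powR_mulrn// ge0_ler_powR ?nnegrE ?sqr_ge0//.
- exact: ltW.
- by rewrite -normrX ger0_norm// sqr_ge0.
Qed.

(** With [D = |x|^2], the number [1/D] is a product of three factors [D^(-1/3)], and each coordinate
    [a] satisfies [a^2 <= D], so each factor is at most one [kappa]. *)
Lemma newton2_le (x : S3) : x.1.1 != 0 -> x.1.2 != 0 -> x.2 != 0 ->
  newton2 x <= kappa x.1.1 * kappa x.1.2 * kappa x.2.
Proof.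
move=> x1 x2 x3; set D := dot x x.
have h1 : 0 <= x.1.1 ^+ 2 by exact: sqr_ge0.
have h2 : 0 <= x.1.2 ^+ 2 by exact: sqr_ge0.
have h3 : 0 <= x.2 ^+ 2 by exact: sqr_ge0.
have DE : D = x.1.1 ^+ 2 + x.1.2 ^+ 2 + x.2 ^+ 2 by rewrite /D dotE !expr2.
have k1 : D `^ (- (1 / 3)) <= kappa x.1.1 by apply: kappa_lb => //; rewrite DE; lra.
have k2 : D `^ (- (1 / 3)) <= kappa x.1.2 by apply: kappa_lb => //; rewrite DE; lra.
have k3 : D `^ (- (1 / 3)) <= kappa x.2 by apply: kappa_lb => //; rewrite DE; lra.
have D0 : 0 <= D by exact: dot_ge0.
have -> : newton2 x = D `^ (- (1 / 3)) * D `^ (- (1 / 3)) * D `^ (- (1 / 3)).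
  rewrite -expr2 -exprSr -powR_mulrn ?powR_ge0// -powRrM.
  by rewrite (_ : _ * 3%:R = -1) ?powR_inv1//; field.
by rewrite !ler_pM ?mulr_ge0// powR_ge0.
Qed.

Lemma ae_coord_neq i (c : R) : {ae leb3, forall x : S3, coord x i != c}.
Proof.
have m1 : measurable ([set c] : set (measurableTypeR R)) by exact: measurable_set1.
have mT : measurable (setT : set (measurableTypeR R)) by exact: measurableT.
have mu1 : (@lebesgue_measure R) ([set c] : set (measurableTypeR R)) = 0%E.
  exact: lebesgue_measure_set1.
have z12 : (@leb2 R) ([set c] `*` setT) = 0%E.
  by rewrite [LHS]product_measure1E// [X in (X * _)%E]mu1 mul0e.
have z21 : (@leb2 R) (setT `*` [set c]) = 0%E.
  by rewrite [LHS]product_measure1E// [X in (_ * X)%E]mu1 mule0.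
have m12 := measurableX m1 mT; have m21 := measurableX mT m1.
elim/ord3E: i.
- exists (([set c] `*` setT) `*` setT); split.
  + exact: measurableX.
  + by rewrite [LHS](product_measure1E _ _ m12 mT) [X in (X * _)%E]z12 mul0e.
  + by move=> x /= /negP; rewrite negbK coordE => /eqP.
- exists ((setT `*` [set c]) `*` setT); split.
  + exact: measurableX.
  + by rewrite [LHS](product_measure1E _ _ m21 mT) [X in (X * _)%E]z21 mul0e.
  + by move=> x /= /negP; rewrite negbK coordE => /eqP.
- exists (setT `*` [set c]); split.
  + exact: measurableX.
  + by rewrite [LHS](product_measure1E _ _ _ m1) ?[X in (_ * X)%E]mu1 ?mule0.
  + by move=> x /= /negP; rewrite negbK coordE => /eqP.
Qed.
End NewtonKernel.

(** * Local integrability of [1/|x|^2], uniformly in the pole *)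

Section KernelIntegrals.
Variable R : realType.
Local Notation mu := (@lebesgue_measure R).
Local Notation leb2 := (@leb2 R).
Local Notation leb3 := (@leb3 R).
Local Notation leb6 := (@leb6 R).
Local Notation S3 := (space3 R).
Local Notation S6 := (space6 R).
Local Notation box3 := (@box R _ S3).
Local Notation box6 := (@box R _ S6).

Lemma box3P r (x : S3) : box3 r x <-> [/\ `|x.1.1| <= r, `|x.1.2| <= r & `|x.2| <= r].
Proof.
rewrite /box /=; case: x => -[x1 x2] x3; rewrite !pair_norm_le /=.
by split=> [/andP[/andP[-> ->] ->]//|[-> -> ->]].
Qed.

Lemma box6P r (z : S6) : box6 r z <-> box3 r z.1 /\ box3 r z.2.
Proof.
rewrite /box /=; case: z => x v; rewrite pair_norm_le /=.
by split=> [/andP[-> ->]//|[-> ->]].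
Qed.

Lemma measurable_box3 r : measurable (box3 r).
Proof. apply: measurable_box; exact: mbasis_space3. Qed.

Lemma measurable_box6 r : measurable (box6 r).
Proof. apply: measurable_box; exact: mbasis_space6. Qed.

Lemma intble_newton2_box r : 0 < r ->
  intble leb3 setT (fun x : S3 => \1_(box3 r) x * newton2 x).
Proof.
move=> r0; pose f (s : measurableTypeR R) : R := \1_(`[-r, r]) s * kappa s.
have mI : measurable (`[-r, r]%classic : set (measurableTypeR R)).
  exact: measurable_itv.
have fi : intble mu setT f by exact: ((intble_indicM _ _ mI).1 (intble_kappa r0)).
have f2i : intble leb2 setT (fun x => f x.1 * f x.2) by exact: intble_tensor.
have f3i : intble leb3 setT (fun x : S3 => (f x.1.1 * f x.1.2) * f x.2).
  exact: (@intble_tensor _ _ _ _ _ leb2 mu (fun x => f x.1 * f x.2) f).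
apply: (intble_aele _ _ _ f3i) => //.
  apply: measurable_funM; first exact: measurable_indic (measurable_box3 r).
  exact: (measurable_newton2 (f := id)).
have n0 := ae_coord_neq ord0 (0 : R).
have n1 := ae_coord_neq (inord 1) (0 : R).
have n2 := ae_coord_neq (inord 2) (0 : R).
apply: filterS2 (filterI n0 n1) n2 => x [x0 x1] x2 _.
rewrite !coordE in x0 x1 x2.
have k0 := newton2_ge0 x; have k1 := newton2_le x0 x1 x2.
rewrite ger0_norm ?mulr_ge0// /f !indicE.
case: (boolP (x \in box3 r)) => [/set_mem/box3P[b1 b2 b3]|_]; last first.
  by rewrite mul0r !mulr_ge0// ?kappa_ge0.
rewrite !mem_set ?mul1r//=; by rewrite in_itv/= -ler_norml.
Qed.

(** For [x] and [y] in the box of radius [r] the difference lies in the box of radius [2 r];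
    translation invariance then bounds every slice by one integral centred at the origin. *)
Lemma newton2_slice3 r : 0 < r -> exists2 C : R, 0 <= C & forall x, box3 r x ->
  intble leb3 setT (fun y : S3 => \1_(box3 r) y * newton2 (x - y)) /\
  \int[leb3]_y (\1_(box3 r) y * newton2 (x - y)) <= C.
Proof.
move=> r0; pose F (y : S3) : R := \1_(box3 (r + r)) y * newton2 y.
have Fi : intble leb3 setT F by apply: intble_newton2_box; rewrite addr_gt0.
have F0 y : 0 <= F y by rewrite mulr_ge0// newton2_ge0.
exists (\int[leb3]_y F y); first by apply: Rintegral_ge0 => y _.
move=> x bx.
have Fxi := intble_translation (- x) (@translation_leb3 R) Fi.
have le y : \1_(box3 r) y * newton2 (x - y) <= F (y - x).
  rewrite /F newton2_sub !indicE.
  case: (boolP (y \in box3 r)) => [/set_mem yr|_]; last first.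
    by rewrite mul0r mulr_ge0// newton2_ge0.
  rewrite mem_set ?mul1r//= /box /=.
  by rewrite (le_trans (ler_normB _ _))// lerD.
have int1 : intble leb3 setT (fun y : S3 => \1_(box3 r) y * newton2 (x - y)).
  apply: (intble_le _ _ _ Fxi) => //.
    apply: measurable_funM; first exact: measurable_indic (measurable_box3 r).
    by apply/measurable_newton2/measurable_sub3.
  by move=> y _; rewrite ger0_norm ?mulr_ge0// newton2_ge0.
split=> //; rewrite -(Rint_translation (- x) (@translation_leb3 R) Fi).
exact: Rint_le.
Qed.

Lemma newton2_slice6 r : 0 < r -> exists2 C : R, 0 <= C & forall x, box3 r x ->
  intble leb6 setT (fun z : S6 => \1_(box6 r) z * newton2 (x - z.1)) /\
  \int[leb6]_z (\1_(box6 r) z * newton2 (x - z.1)) <= C.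
Proof.
move=> r0; have [C C0 CP] := newton2_slice3 r0.
have bi : intble leb3 setT (\1_(box3 r) : S3 -> R).
  have := intble_cst 1 (measurable_box3 r) (@finite_boxes_leb3 R r).
  by move=> /(intble_indicM _ _ (measurable_box3 r)); apply: intble_ext => x; rewrite mulr1.
have b0 : 0 <= \int[leb3]_w (\1_(box3 r) w : R) by apply: Rintegral_ge0.
exists (C * \int[leb3]_w (\1_(box3 r) w : R)); first by rewrite mulr_ge0.
move=> x /CP[int1 le1].
have E (z : S6) : \1_(box6 r) z * newton2 (x - z.1) =
    (\1_(box3 r) z.1 * newton2 (x - z.1)) * \1_(box3 r) z.2.
  have -> : \1_(box6 r) z = \1_(box3 r) z.1 * \1_(box3 r) z.2 :> R.
    by rewrite box_prod !indicE in_setX; case: (_ \in _) => /=; rewrite ?mul1r ?mul0r.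
  by rewrite mulrAC.
have eqE : (fun z : S6 => \1_(box6 r) z * newton2 (x - z.1)) =
  (fun z : S6 => (\1_(box3 r) z.1 * newton2 (x - z.1)) * \1_(box3 r) z.2).
  exact/funext.
rewrite eqE; split; first exact: (intble_tensor int1 bi).
by rewrite [X in X <= _](Rint_tensor int1 bi) ler_wpM2r.
Qed.

Lemma measurable_ker2 d (T : measurableType d) (f g : T -> S6) :
  measurable_fun setT f -> measurable_fun setT g ->
  measurable_fun setT (fun p => newton2 ((f p).1 - (g p).1)).
Proof.
move=> mf mg; apply/measurable_newton2/measurable_sub3.
  exact: (measurableT_comp measurable_fst mf).
exact: (measurableT_comp measurable_fst mg).
Qed.
End KernelIntegrals.

(** * Schur's test *)

Section Schur.
Context d (T : measurableType d) (R : realType).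
Variables (mu : {sigma_finite_measure set T -> \bar R}) (k : T * T -> R).
Variables (B : set T) (C : R).
Hypotheses (mk : measurable_fun setT k) (k0 : forall p, 0 <= k p)
  (ksym : forall x y, k (x, y) = k (y, x)) (mB : measurable B) (C0 : 0 <= C)
  (kC : forall x, B x -> intble mu setT (fun y => \1_B y * k (x, y)) /\
                         \int[mu]_y (\1_B y * k (x, y)) <= C).
Local Notation mu2 := (mu \x mu)%E.

(** Integrating first over the variable that [al] does not see costs at most the slice bound [C]; by
    symmetry of [k] this works for either variable. *)
Lemma schur_half (al : T -> R) : intble mu setT al -> (forall z, 0 <= al z) ->
    (forall z, ~ B z -> al z = 0) ->
    (intble mu2 setT (fun p => al p.1 * (\1_B p.2 * k p)) /\
     \int[mu2]_p (al p.1 * (\1_B p.2 * k p)) <= C * \int[mu]_z al z) /\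
    (intble mu2 setT (fun p => al p.2 * (\1_B p.1 * k p)) /\
     \int[mu2]_p (al p.2 * (\1_B p.1 * k p)) <= C * \int[mu]_z al z).
Proof.
move=> ali al0 alr.
have mal := intble_meas ali.
have Cint := intbleZ C measurableT ali.
have g0 z z' : 0 <= al z * (\1_B z' * k (z, z')) by rewrite !mulr_ge0.
have key z : intble mu setT (fun z' => al z * (\1_B z' * k (z, z')))
    /\ \int[mu]_z' (al z * (\1_B z' * k (z, z'))) <= C * al z.
  case: (pselect (B z)) => [bz|nb]; last first.
    rewrite (alr z nb); under eq_fun do rewrite mul0r; split; first exact: intble0.
    by rewrite mulr0 Rint_eq0// => z' _; rewrite mul0r.
  have [int1 le1] := kC bz; split; first exact: (intbleZ (al z) _ int1).
  by rewrite (RintegralZl (al z) measurableT int1) mulrC ler_wpM2r.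
have key2 z : (\int[mu]_z' (al z * (\1_B z' * k (z, z')))%:E <= (C * al z)%:E)%E.
  have [i1 i2] := key z; rewrite -[leLHS]fineK ?lee_fin//.
  exact: integrable_fin_num i1.
split.
  have i66 : intble mu2 setT (fun p => al p.1 * (\1_B p.2 * k p)).
    apply: (tonelli_intble1 _ Cint).
      apply: measurable_funM; first exact: (measurableT_comp mal measurable_fst).
      apply: measurable_funM; last exact: mk.
      exact: (measurableT_comp (measurable_indic mB) measurable_snd).
    apply: aeW => z; apply: le_trans (key2 z).
    rewrite le_eqVlt; apply/orP; left; apply/eqP; apply: eq_integral => z' _.
    by rewrite ger0_norm.
  split => //; rewrite (fubiniR1 i66) -RintegralZl//.
  apply: Rint_le => //; first exact: (fubini_intble1 i66).
  by move=> z _; have [] := key z.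
have i66 : intble mu2 setT (fun p => al p.2 * (\1_B p.1 * k p)).
  apply: (tonelli_intble2 _ Cint).
    apply: measurable_funM; first exact: (measurableT_comp mal measurable_snd).
    apply: measurable_funM; last exact: mk.
    exact: (measurableT_comp (measurable_indic mB) measurable_fst).
  apply: aeW => z; apply: le_trans (key2 z).
  rewrite le_eqVlt; apply/orP; left; apply/eqP; apply: eq_integral => z' _.
  by rewrite ksym ger0_norm.
split => //; rewrite (fubiniR2 i66) -RintegralZl//.
apply: Rint_le => //; first exact: (fubini_intble2 i66).
move=> z _; have [_] := key z; apply: le_trans.
rewrite le_eqVlt; apply/orP; left; apply/eqP; apply: eq_Rintegral => z' _.
by rewrite ksym.
Qed.

Let amgm (n a b i1 i2 : R) : 0 <= n -> 0 <= i1 -> 0 <= i2 ->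
  a = 0 \/ i1 = 1 -> b = 0 \/ i2 = 1 ->
  n * (`|a| * `|b|) <= a ^+ 2 * (i2 * n) + b ^+ 2 * (i1 * n).
Proof.
move=> n0 i10 i20 a0 b0.
have g0 : 0 <= a ^+ 2 * (i2 * n) + b ^+ 2 * (i1 * n).
  by apply: addr_ge0; apply: mulr_ge0; rewrite ?sqr_ge0 ?mulr_ge0.
case: a0 => [a0|i11]; first by rewrite {1}a0 normr0 mul0r mulr0.
case: b0 => [b0|i21]; first by rewrite {1}b0 normr0 !mulr0.
rewrite i11 i21 !mul1r -mulrDl mulrC ler_wpM2r//.
rewrite -[a ^+ 2]real_normK ?num_real// -[b ^+ 2]real_normK ?num_real//.
have := sqr_ge0 (`|a| - `|b|); have := normr_ge0 a; have := normr_ge0 b.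
by move: `|a| `|b| => x y; nra.
Qed.

(** Schur's test in quadratic form: [|al be| <= al^2 + be^2] splits the integrand into two terms,
    each of which sees one function only and falls under [schur_half]. *)
Lemma schur_bound (F : T * T -> R) (al be : T -> R) (M : R) :
  measurable_fun setT F -> 0 <= M ->
  intble mu setT (fun z => al z ^+ 2) -> intble mu setT (fun z => be z ^+ 2) ->
  (forall z, ~ B z -> al z = 0) -> (forall z, ~ B z -> be z = 0) ->
  (forall p, `|F p| <= M * (k p * (`|al p.1| * `|be p.2|))) ->
  intble mu2 setT F /\
  `|\int[mu2]_p F p| <=
    C * M * (\int[mu]_z (al z ^+ 2) + \int[mu]_z (be z ^+ 2)).
Proof.
move=> mF M0 ali bei alr ber FM.
have alr2 z : ~ B z -> al z ^+ 2 = 0 by move=> /alr ->; rewrite expr0n.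
have ber2 z : ~ B z -> be z ^+ 2 = 0 by move=> /ber ->; rewrite expr0n.
have [[ia lea] _] := schur_half ali (fun z => sqr_ge0 (al z)) alr2.
have [_ [ib leb]] := schur_half bei (fun z => sqr_ge0 (be z)) ber2.
pose G p := M * (al p.1 ^+ 2 * (\1_B p.2 * k p) + be p.2 ^+ 2 * (\1_B p.1 * k p)).
have Gs := intbleD measurableT ia ib.
have Gi : intble mu2 setT G by exact: intbleZ.
have FG p : `|F p| <= G p.
  apply: le_trans (FM p) _; rewrite /G ler_wpM2l//; apply: amgm => //.
    case: (pselect (B p.1)) => [b1|nb1]; last by left; exact: alr.
    by right; rewrite indicE mem_set.
  case: (pselect (B p.2)) => [b1|nb1]; last by left; exact: ber.
  by right; rewrite indicE mem_set.
have Fi : intble mu2 setT F by apply: intble_le Gi.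
split => //; apply: le_trans (Rint_norm_le measurableT mF Gi (aeW _ _)) _ => //.
rewrite (RintegralZl M measurableT Gs) (RintegralD measurableT ia ib).
by rewrite (mulrC C) -mulrA ler_wpM2l// mulrDr lerD.
Qed.
End Schur.

(** * The Newton kernel along coordinate lines *)

Section NewtonLine.
Variable R : realType.
Local Notation S3 := (space3 R).

Lemma line_is_derive (V : normedModType R) (z e : V) (f : V -> R) l :
  is_derive z e f l <-> is_derive (0 : R) (1 : R) (fun s : R => f (z + s *: e)) l.
Proof.
have Eq : (fun h : R => h^-1 *: (f (z + (h *: (1 : R) + 0) *: e) - f (z + (0 : R) *: e)))
    = (fun h : R => h^-1 *: (f (h *: e + z) - f z)).
  apply/funext => h; rewrite scale0r [z + 0]addr0 addr0.
  by congr (_ *: (f _ - _)); rewrite addrC; congr (_ *: _ + _); exact: mulr1.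
split=> -[dx <-]; split.
- by move: dx; rewrite /derivable /= Eq.
- by rewrite /derive Eq.
- by move: dx; rewrite /derivable /= Eq.
- by rewrite /derive Eq.
Qed.

Lemma line_is_derive_at (V : normedModType R) (z e : V) (f : V -> R) (s l : R) :
  is_derive (z + s *: e) e f l ->
  is_derive s (1 : R) (fun t : R => f (z + t *: e)) l.
Proof.
have Eq : (fun h : R => h^-1 *: (f (z + (h *: (1 : R) + s) *: e) - f (z + s *: e)))
    = (fun h : R => h^-1 *: (f (h *: e + (z + s *: e)) - f (z + s *: e))).
  apply/funext => h; congr (_ *: (f _ - _)).
  by rewrite scalerDl addrCA; congr (_ *: _ + _); exact: mulr1.
move=> -[dx <-]; split; first by move: dx; rewrite /derivable /= Eq.
by rewrite /derive Eq.
Qed.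

(** Minus the [i]-th partial derivative of [1/|x|]. *)
Definition newton_grad i (x : S3) : R := coord x i / enorm3 x ^+ 3.

Lemma enorm3_ge0 (x : S3) : 0 <= enorm3 x. Proof. exact: sqrtr_ge0. Qed.

Lemma enorm3_sqr (x : S3) : enorm3 x ^+ 2 = dot x x.
Proof. by rewrite sqr_sqrtr// dot_ge0. Qed.

Lemma coord_sqr_le (x : S3) i : coord x i ^+ 2 <= dot x x.
Proof.
rewrite /dot (bigD1 i)//= -expr2 lerDl sumr_ge0// => j _.
by rewrite -expr2 sqr_ge0.
Qed.

Lemma coord_le_enorm3 (x : S3) i : `|coord x i| <= enorm3 x.
Proof. by rewrite -sqrtr_sqr ler_wsqrtr// coord_sqr_le. Qed.

Lemma newton_grad_le i (x : S3) : `|newton_grad i x| <= newton2 x.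
Proof.
rewrite /newton_grad /newton2 -enorm3_sqr.
have n0 := enorm3_ge0 x; have c0 := coord_le_enorm3 x i.
have [e0|e0] := eqVneq (enorm3 x) 0.
  by rewrite e0 !expr0n/= invr0 mulr0 normr0.
have np : 0 < enorm3 x by rewrite lt_def e0.
rewrite normrM normfV normrX [`|enorm3 x|]ger0_norm// ler_pdivrMr ?exprn_gt0//.
by rewrite (exprSr _ 2) mulrA mulVf ?mul1r// expf_neq0.
Qed.

Lemma newton_le (x : S3) : (enorm3 x)^-1 <= 1 + newton2 x.
Proof.
rewrite /newton2 -enorm3_sqr -exprVn.
have : 0 <= (enorm3 x)^-1 by rewrite invr_ge0 enorm3_ge0.
by move: (_^-1) => t t0; have := sqr_ge0 (t - 1); nra.
Qed.

Lemma newton_ge0 (x : S3) : 0 <= (enorm3 x)^-1.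
Proof. by rewrite invr_ge0 enorm3_ge0. Qed.

Lemma enorm3_sub (x y : S3) : enorm3 (x - y) = enorm3 (y - x).
Proof. by rewrite /enorm3 !dotE /=; congr Num.sqrt; ring. Qed.

Lemma newton_gradN i (x y : S3) : newton_grad i (x - y) = - newton_grad i (y - x).
Proof. by rewrite /newton_grad enorm3_sub !coordB -mulNr opprB. Qed.

(** The squared distance from [p] to the [i]-th axis. It is constant along lines parallel to that
    axis and nonzero exactly when such a line misses the origin; there [1/|x|] is smooth. *)
Definition off_axis (p : S3) i : R := dot p p - coord p i ^+ 2.

Lemma off_axisE (p : S3) i : off_axis p i = \sum_(j | j != i) coord p j ^+ 2.
Proof.
rewrite /off_axis /dot (bigD1 i)//= -expr2 addrAC subrr add0r.
by apply: eq_bigr => j _; rewrite expr2.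
Qed.

Lemma off_axis_ge0 p i : 0 <= off_axis p i.
Proof. by rewrite off_axisE sumr_ge0// => j _; rewrite sqr_ge0. Qed.

Lemma off_axis_line p i (s : R) : off_axis (p - s *: basis3 R i) i = off_axis p i.
Proof.
rewrite !off_axisE; apply: eq_bigr => j ji.
by rewrite coordB coordZ coord_basis3 eq_sym (negbTE ji) mulr0 subr0.
Qed.

Lemma enorm3_line p i (s : R) :
  enorm3 (p - s *: basis3 R i) = Num.sqrt (off_axis p i + (coord p i - s) ^+ 2).
Proof.
rewrite /enorm3 -(subrK (coord (p - s *: basis3 R i) i ^+ 2) (dot _ _)).
rewrite -/(off_axis _ _) off_axis_line coordB coordZ coord_basis3 eqxx.
by rewrite mulr1.
Qed.

Lemma is_derive_invsqrt (c a s : R) : 0 < c ->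
  is_derive s (1 : R) (fun t : R => (Num.sqrt (c + (a - t) ^+ 2))^-1)
    ((a - s) / Num.sqrt (c + (a - s) ^+ 2) ^+ 3).
Proof.
move=> c0.
have p0 (t : R) : 0 < c + (a - t) ^+ 2 by rewrite ltr_wpDr// sqr_ge0.
have d1 : is_derive s (1 : R) (fun t : R => c + (a - t) ^+ 2) (- (2 * (a - s))).
  apply: is_derive_eq.
  by rewrite /GRing.scale/=; ring.
have d2 := is_derive1_sqrt (p0 s).
have d3 : is_derive s (1 : R) (fun t : R => Num.sqrt (c + (a - t) ^+ 2))
   ((2 * Num.sqrt (c + (a - s) ^+ 2))^-1 * - (2 * (a - s))).
  exact: (@is_derive1_comp _ Num.sqrt (fun t : R => c + (a - t) ^+ 2)).
have s0 : Num.sqrt (c + (a - s) ^+ 2) != 0 by rewrite sqrtr_eq0 -ltNge.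
have d4 := @is_deriveV _ (fun t : R => Num.sqrt (c + (a - t) ^+ 2)) s _ _ s0 d3.
rewrite (_ : (a - s) / _ = - Num.sqrt (c + (a - s) ^+ 2) ^- 2 *:
  ((2 * Num.sqrt (c + (a - s) ^+ 2))^-1 * - (2 * (a - s)))); first exact: d4.
rewrite /GRing.scale/=; field.
by rewrite s0.
Qed.
End NewtonLine.

Section WeakIntegrable.
Variable R : realType.
Local Notation leb6 := (@leb6 R).
Local Notation S3 := (space3 R).
Local Notation S6 := (space6 R).
Local Notation box6 := (@box R _ S6).

(** The box of radius [r + |x|] contains the pole as well as the support, so the slice bound applies
    in it. *)
Lemma weak_intble (F : S6 -> R) (x : S3) (r M : R) : 0 < r -> 0 <= M ->
  measurable_fun setT F ->
  (forall z, `|F z| <= M * (\1_(box6 r) z * (1 + newton2 (x - z.1)))) ->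
  intble leb6 setT F.
Proof.
move=> r0 M0 mF FM; pose r' := r + `|x|.
have r'0 : 0 < r' by rewrite ltr_wpDr.
have [C C0 CP] := newton2_slice6 r'0.
have bx : @box R _ S3 r' x by rewrite /box /= lerDr ltW.
have [int1 _] := CP x bx.
have int2 : intble leb6 setT (\1_(box6 r') : S6 -> R).
  have := intble_cst 1 (measurable_box6 (R := R) r') (@finite_boxes_leb6 R r').
  move=> /(intble_indicM _ _ (measurable_box6 r')).
  by apply: intble_ext => z; rewrite mulr1.
have int3 := intbleZ M measurableT (intbleD measurableT int2 int1).
apply: (intble_le measurableT mF _ int3) => z _; apply: le_trans (FM z) _.
apply: ler_wpM2l => //; rewrite mulrDr mulr1.
have n0 := newton2_ge0 (x - z.1).
have le1 : \1_(box6 r) z <= \1_(box6 r') z :> R.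
  rewrite !indicE; case: (boolP (z \in box6 r)) => [/set_mem zr|_]; last by rewrite ler0n.
  by rewrite mem_set//= /box /=; apply: le_trans zr _; rewrite lerDl.
by apply: lerD => //; exact: ler_wpM2r.
Qed.

End WeakIntegrable.

(** * The gradient of the potential *)

Section PotentialGradient.
Variable R : realType.
Local Notation leb6 := (@leb6 R).
Local Notation S3 := (space3 R).
Local Notation S6 := (space6 R).
Local Notation box6 := (@box R _ S6).
Variables (i : 'I_3) (h h' : S6 -> R) (r C0 C1 : R).
Let e : S3 := basis3 R i.
Let ee : S6 := (e, 0).
Hypotheses (r0 : 0 < r) (ch : continuous h) (ch' : continuous h')
  (dh : forall z, is_derive z ee h (h' z))
  (hr : forall z, ~ box6 r z -> h z = 0)
  (hC : forall z, `|h z| <= C0) (h'C : forall z, `|h' z| <= C1).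

Let C00 : 0 <= C0. Proof. exact: le_trans (hC 0). Qed.
Let C10 : 0 <= C1. Proof. exact: le_trans (h'C 0). Qed.

Let mh : measurable_fun setT h.
Proof. by apply: mbasis_continuous_measurable; first exact: mbasis_space6. Qed.

Let mh' : measurable_fun setT h'.
Proof. by apply: mbasis_continuous_measurable; first exact: mbasis_space6. Qed.

Let h'r z : ~ box6 r z -> h' z = 0.
Proof.
move=> nb; have [_ <-] := dh z.
rewrite (@near_eq_derive _ _ _ h (cst 0)); first by rewrite derive_cst.
have rz : r < `|z| by rewrite ltNge; apply/negP.
near=> t; rewrite /cst; apply: hr; rewrite /box /=; apply/negP; rewrite -ltNge.
by near: t; apply: (@cvgr_norm_gt _ _ _ _ _ id z) => //; exact: cvg_id.
Unshelve. all: end_near. Qed.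

Let meas_newton (x : S3) : measurable_fun setT (fun z : S6 => (enorm3 (x - z.1))^-1).
Proof.
rewrite (_ : (fun z : S6 => _) = (fun z : S6 => newton2 (x - z.1) `^ 2^-1)); last first.
  apply/funext => z; rewrite powR12_sqrt ?newton2_ge0// /newton2 -enorm3_sqr.
  by rewrite -exprVn sqrtr_sqr ger0_norm// newton_ge0.
apply: (measurableT_comp (f := (fun x : R => x `^ 2^-1))); first exact: measurable_powR.
apply: measurable_newton2; apply: measurable_sub3 => //.
Qed.

Let meas_newton_grad (x : S3) : measurable_fun setT (fun z : S6 => newton_grad i (x - z.1)).
Proof.
apply: measurable_funM; last first.
  by under eq_fun do rewrite -exprVn; apply: measurable_funX; exact: meas_newton.
have : measurable_fun setT (fun z : S6 => x - z.1) by apply: measurable_sub3.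
by move/measurable_coordP; apply.
Qed.

Let box_newton (C : R) (g : S6 -> R) (x : S3) (z : S6) rr : 0 <= C ->
  (~ box6 rr z -> g z = 0) -> `|g z| <= C ->
  `|g z / enorm3 (x - z.1)| <= C * (\1_(box6 rr) z * (1 + newton2 (x - z.1))).
Proof.
move=> C0' gr gC; case: (pselect (box6 rr z)) => [bz|/gr ->]; last first.
  by rewrite mul0r normr0 !mulr_ge0// addr_ge0// newton2_ge0.
rewrite indicE mem_set// mul1r normrM ler_pM//.
by rewrite ger0_norm ?newton_ge0//; exact: newton_le.
Qed.

Let box_newton_grad (C : R) (g : S6 -> R) (x : S3) (z : S6) rr : 0 <= C ->
  (~ box6 rr z -> g z = 0) -> `|g z| <= C ->
  `|g z * newton_grad i (x - z.1)| <= C * (\1_(box6 rr) z * (1 + newton2 (x - z.1))).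
Proof.
move=> C0' gr gC; case: (pselect (box6 rr z)) => [bz|/gr ->]; last first.
  by rewrite mul0r normr0 !mulr_ge0// addr_ge0// newton2_ge0.
rewrite indicE mem_set// mul1r normrM ler_pM//.
by apply: le_trans (newton_grad_le _ _) _; rewrite lerDr.
Qed.

Lemma intble_newton_grad (x : S3) : intble leb6 setT (fun z => h z * newton_grad i (x - z.1)).
Proof.
apply: (weak_intble r0 C00); first by apply: measurable_funM; [exact: mh|exact: meas_newton_grad].
by move=> z; apply: box_newton_grad => //; exact: hr.
Qed.

Let intble_newton (x : S3) : intble leb6 setT (fun z => h z / enorm3 (x - z.1)).
Proof.
apply: (weak_intble r0 C00); first by apply: measurable_funM; [exact: mh|exact: meas_newton].
by move=> z; apply: box_newton => //; exact: hr.
Qed.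

Let intble_newton' (x : S3) : intble leb6 setT (fun z => h' z / enorm3 (x - z.1)).
Proof.
apply: (weak_intble r0 C10); first by apply: measurable_funM; [exact: mh'|exact: meas_newton].
by move=> z; apply: box_newton => //; exact: h'r.
Qed.
Let coord_le_norm (x : S3) j : `|coord x j| <= `|x|.
Proof.
have [h1 h2 h3] := (box3P `|x| x).1 (lexx _).
by elim/ord3E: j; rewrite coordE.
Qed.

Let lineE (x : S3) (z : S6) (s : R) : x - (z + s *: ee).1 = (x - z.1) - s *: e.
Proof. by rewrite /= opprD addrA. Qed.

(* Integration by parts along the lines parallel to [e] that miss the pole [x]; *)
(* the others form a null set, on which both functions are set to [0].          *)
Lemma newton_by_parts (x : S3) :
  \int[leb6]_z (h' z / enorm3 (x - z.1)) =
  - \int[leb6]_z (h z * newton_grad i (x - z.1)).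
Proof.
pose G : set S6 := [set z | off_axis (x - z.1) i != 0].
pose H z : R := \1_G z * (h z / enorm3 (x - z.1)).
pose H' z : R := \1_G z * (h' z / enorm3 (x - z.1) + h z * newton_grad i (x - z.1)).
have Gline z s : (\1_G (z + s *: ee) : R) = \1_G z.
  rewrite !indicE; congr (nat_of_bool _)%:R; apply/idP/idP => /set_mem Gz;
    apply/mem_set; move: Gz; rewrite /G /= lineE off_axis_line//.
have HP : line_primitive ee H H'.
  have Hl z : (fun s : R => H (z + s *: ee)) =
      (fun s => \1_G z * (h (z + s *: ee) * (enorm3 ((x - z.1) - s *: e))^-1)).
    by apply/funext => s; rewrite /H Gline lineE.
  have Hl' z : (fun s : R => H' (z + s *: ee)) =
      (fun s => \1_G z * (h' (z + s *: ee) * (enorm3 ((x - z.1) - s *: e))^-1 +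
         h (z + s *: ee) * newton_grad i ((x - z.1) - s *: e))).
    by apply/funext => s; rewrite /H' Gline lineE.
  have cline z : continuous (fun s : R => z + s *: ee).
    move=> s; apply: cvgD; first exact: cvg_cst.
    by apply: cvgZr_tmp; exact: cvg_id.
  have dN z s : G z -> is_derive s (1 : R) (fun t : R => (enorm3 ((x - z.1) - t *: e))^-1)
       (newton_grad i ((x - z.1) - s *: e)).
    move=> Gz; under eq_fun do rewrite enorm3_line.
    rewrite /newton_grad enorm3_line (coordB (x - z.1)) coordZ coord_basis3 eqxx mulr1.
    by apply: is_derive_invsqrt; rewrite lt_def Gz off_axis_ge0.
  split.
  - move=> z; apply/line_is_derive; rewrite Hl.
    case: (pselect (G z)) => Gz; last first.
      rewrite /H' indicE memNset//= mul0r.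
      under eq_fun do rewrite mul0r; exact: is_derive_cst.
    rewrite /H' indicE mem_set//= mul1r; under eq_fun do rewrite mul1r.
    have d1 := (line_is_derive z ee h _).1 (dh z).
    have d2 := dN z 0 Gz.
    apply: (is_derive_eq (is_deriveM d1 d2)); rewrite !scale0r addr0 subr0 addrC.
    by congr (_ + _); rewrite /GRing.scale /= mulrC.
  - move=> z; rewrite Hl' => s.
    case: (pselect (G z)) => Gz; last first.
      rewrite indicE memNset//=; under eq_fun do rewrite mul0r; exact: cvg_cst.
    apply: cvgM; first exact: cvg_cst.
    have cN : {for s, continuous (fun t : R => (enorm3 ((x - z.1) - t *: e))^-1)}.
      by case: (dN z s Gz) => ? _; apply/differentiable_continuous/derivable1_diffP.
    have ch1 : {for s, continuous (fun t : R => h (z + t *: ee))}.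
      by apply: continuous_comp; [exact: cline|exact: ch].
    have ch2 : {for s, continuous (fun t : R => h' (z + t *: ee))}.
      by apply: continuous_comp; [exact: cline|exact: ch'].
    apply: cvgD; first exact: cvgM.
    apply: cvgM => //; rewrite /newton_grad.
    apply: cvgM.
      under eq_fun do rewrite (coordB (x - z.1)) coordZ; rewrite (coordB (x - z.1)) coordZ.
      by apply: cvgB; [exact: cvg_cst|apply: cvgMl; exact: cvg_id].
    under eq_fun do rewrite -exprVn; rewrite -exprVn.
    by do 2?[apply: cvgM => //].
  - move=> z; exists (r + `|coord z.1 i|) => s sr.
    rewrite /H (hr (z := z + s *: ee)) ?mul0r ?mulr0// => /box6P[bz _].
    have := le_trans (coord_le_norm _ i) bz.
    rewrite coordD coordZ coord_basis3 eqxx mulr1 => zs.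
    have := ler_normB (coord z.1 i + s) (coord z.1 i).
    rewrite addrAC subrr add0r => /(le_trans)/(_ (lerD zs (lexx _))).
    by rewrite leNgt sr.
have mG : measurable G.
  have moff : measurable_fun setT (fun z : S6 => off_axis (x - z.1) i).
    have ms : measurable_fun setT (fun z : S6 => x - z.1) by apply: measurable_sub3.
    apply: measurable_funB; first exact: measurable_dot.
    by apply: measurable_funX; move/measurable_coordP: ms; apply.
  rewrite (_ : G = (fun z : S6 => off_axis (x - z.1) i) @^-1` (~` [set 0])).
    by rewrite -[X in measurable X]setTI; apply: moff => //; exact: measurableC.
  by apply/seteqP; split => z /=; [move/eqP|move=> ?; apply/eqP].
(* A line through the pole in direction [i] lies in the hyperplane where the [j]-th coordinate
   equals that of [x], for any [j] other than [i]; this hyperplane is null. *)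
have aeG : {ae leb6, forall z : S6, G z}.
  have [j ji] : exists j : 'I_3, j != i.
    by move: i; elim/ord3E; [exists (inord 1)|exists ord0|exists ord0];
      apply/eqP => /(congr1 val); rewrite /= !inordK.
  have [N [mN N0 subN]] := ae_coord_neq j (coord x j).
  have mT3 : measurable (setT : set S3) by exact: measurableT.
  exists (N `*` setT); split; first exact: measurableX.
    by rewrite [LHS](product_measure1E _ _ mN mT3) [X in (X * _)%E]N0 mul0e.
  move=> z /= nG; split => //; apply: subN => /= zj; apply: nG.
  rewrite /G /= off_axisE (bigD1 j)//= gt_eqF// ltr_pwDl//; last first.
    by rewrite sumr_ge0// => k _; rewrite sqr_ge0.
  by rewrite exprn_even_gt0//= coordB subr_eq0 eq_sym.
have Hi1 := intble_newton' x; have Hi2 := intble_newton_grad x.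
have HDi := intbleD measurableT Hi1 Hi2.
have H'i : intble leb6 setT H'.
  apply: (intble_mul_bd (C := 1) measurableT _ _ HDi).
    exact: (measurable_indic mG).
  by move=> z _; rewrite indicE; case: (_ \in _); rewrite /= ?normr1 ?normr0.
have := @line_null_leb6x R i H H' HP H'i.
have -> : \int[leb6]_z H' z =
    \int[leb6]_z (h' z / enorm3 (x - z.1) + h z * newton_grad i (x - z.1)).
  apply: (Rint_aeeq measurableT (intble_meas H'i) (intble_meas HDi)).
  by apply: filterS aeG => z Gz _; rewrite /H' indicE mem_set//= mul1r.
by rewrite (RintegralD measurableT Hi1 Hi2) => /eqP; rewrite addr_eq0 => /eqP.
Qed.
(** A translation of the integration variable moves the increment from the kernel onto [h]. The
    difference quotients are then dominated by a multiple of [1/|x - y|], so one may differentiate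
    under the integral, and [newton_by_parts] brings the derivative back onto the kernel. *)
Lemma is_derive_potential (x : S3) :
  is_derive x e (potential h) (- \int[leb6]_z (h z * newton_grad i (x - z.1))).
Proof.
apply/line_is_derive.
pose f (s : R) (z : S6) := h (z + s *: ee) / enorm3 (x - z.1).
have -> : (fun s : R => potential h (x + s *: e)) =
    (fun s : R => \int[leb6]_(z in setT) f s z).
  apply/funext => s; rewrite /potential.
  have := Rint_translation (s *: ee) (@translation_leb6 R) (intble_newton (x + s *: e)).
  move=> <-; apply: eq_Rintegral => z _; congr (_ / enorm3 _).
  by rewrite /= opprD addrACA subrr addr0.
have fi (s : R) : intble leb6 setT (f s).
  have := intble_translation (s *: ee) (@translation_leb6 R) (intble_newton (x + s *: e)).
  apply: intble_ext => z; congr (_ / enorm3 _).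
  by rewrite /= opprD addrACA subrr addr0.
have df (s : R) (z : S6) :
    is_derive s (1 : R) (f ^~ z) (h' (z + s *: ee) / enorm3 (x - z.1)).
  have d1 := line_is_derive_at (dh (z + s *: ee)).
  have d2 := is_derive_cst ((enorm3 (x - z.1))^-1 : R^o) s (1 : R).
  apply: (is_derive_eq (is_deriveM d1 d2)).
  by rewrite scaler0 add0r /GRing.scale /= mulrC.
have eN (s : R) (z : S6) : partial1of2 f s z = h' (z + s *: ee) / enorm3 (x - z.1).
  by rewrite /partial1of2 derive1E; have [_ ->] := df s z.
(* The shift has [|s| < 1], so the shifted support stays in the box of radius [r + 1]. *)
pose G (z : S6) : R := C1 * (\1_(box6 (r + 1)) z * (enorm3 (x - z.1))^-1).
have G0 z : 0 <= G z by rewrite !mulr_ge0// newton_ge0.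
have Gi : intble leb6 setT G.
  have r1 : 0 < r + 1 by rewrite addr_gt0.
  apply: (weak_intble r1 C10 (x := x)).
    apply: measurable_funM => //; apply: measurable_funM; last exact: meas_newton.
    exact: measurable_indic (measurable_box6 _).
  move=> z; rewrite ger0_norm// ler_wpM2l// ler_wpM2l//; exact: newton_le.
have fG (s : R) (z : S6) : `](-1 : R), 1[%classic s -> setT z -> `|partial1of2 f s z| <= G z.
  rewrite /= in_itv/= => s1 _; rewrite eN /G.
  have n0 := newton_ge0 (x - z.1).
  case: (pselect (box6 (r + 1) z)) => bz.
    rewrite indicE mem_set//= mul1r normrM (ger0_norm n0) ler_wpM2r//.
  rewrite h'r ?mul0r ?normr0; first by rewrite indicE memNset//= mul0r mulr0.
  move=> bz'; apply: bz; rewrite /box /=.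
  have -> : z = (z + s *: ee) - s *: ee by rewrite addrK.
  apply: le_trans (ler_normB _ _) _; apply: lerD => //.
  rewrite normrZ ltW// (le_lt_trans (ler_wpM2l (normr_ge0 s) (_ : `|ee| <= 1)))//.
    rewrite /ee /e pair_norm_le normr0 ler01 andbT.
    apply: ((box3P 1 (basis3 R i)).2); rewrite -coord0 -coord1 -coord2 !coord_basis3.
    by split; case: eqP => _; rewrite /= ?normr1 ?normr0.
  by rewrite mulr1 ltr_norml; case/andP: s1 => -> ->.
have I0 : `](-1 : R), 1[%classic 0 by rewrite /= in_itv/= ltrN10 ltr01.
have derf (s : R) (z : S6) : `](-1 : R), 1[%classic s -> setT z -> derivable (f ^~ z) s 1.
  by move=> _ _; case: (df s z).
have D1 := derivable_under_integral measurableT I0 (fun s _ => fi s) derf G0 Gi fG.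
have D2 := differentiation_under_integral measurableT I0 (fun s _ => fi s) derf G0 Gi fG.
split; first exact: D1.
rewrite -derive1E [LHS]D2 -newton_by_parts; apply: eq_Rintegral => z _.
by rewrite eN scale0r addr0.
Qed.

End PotentialGradient.

(** * The transport operator *)

Section SmoothSupported.
Variable R : realType.
Local Notation leb3 := (@leb3 R).
Local Notation leb6 := (@leb6 R).
Local Notation S3 := (space3 R).
Local Notation S6 := (space6 R).
Local Notation box3 := (@box R _ S3).
Local Notation box6 := (@box R _ S6).
Definition pd i (h : S6 -> R) (z : S6) : R := 'D_(basis6 R i) h z.

(** What is used of a state or costate at one time. A single constant bounds the function and its
    partial derivatives, so the remainder estimates below can name it, and the class is stable under
    differences and products. *)
Record c1_supported (r C : R) (h : S6 -> R) : Prop := C1Supported {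
  c1s_cont : continuous h;
  c1s_der : forall i z, derivable h z (basis6 R i);
  c1s_dcont : forall i, continuous (pd i h);
  c1s_supp : forall z, ~ box6 r z -> h z = 0;
  c1s_bd : forall z, `|h z| <= C;
  c1s_dbd : forall i z, `|pd i h z| <= C }.

Arguments c1s_cont {r C h} _ x.
Arguments c1s_der {r C h} _ i z.
Arguments c1s_dcont {r C h} _ i x.
Arguments c1s_supp {r C h} _ z _.
Arguments c1s_bd {r C h} _ z.
Arguments c1s_dbd {r C h} _ i z.

Lemma c1s_C0 r C h : c1_supported r C h -> 0 <= C.
Proof. by move=> H; exact: le_trans (c1s_bd H 0). Qed.

Lemma c1s_meas r C h : c1_supported r C h -> measurable_fun setT h.
Proof.
move=> H; apply: mbasis_continuous_measurable; first exact: mbasis_space6.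
exact: c1s_cont H.
Qed.

Lemma c1s_dmeas r C h i : c1_supported r C h -> measurable_fun setT (pd i h).
Proof.
move=> H; apply: mbasis_continuous_measurable; first exact: mbasis_space6.
exact: c1s_dcont H i.
Qed.

Lemma c1s_is_derive r C h i z : c1_supported r C h ->
  is_derive z (basis6 R i) h (pd i h z).
Proof. by move=> H; apply: DeriveDef => //; exact: c1s_der H i z. Qed.

Lemma c1s_dsupp r C h i z : c1_supported r C h -> ~ box6 r z -> pd i h z = 0.
Proof.
move=> H nb; rewrite /pd (@near_eq_derive _ _ _ h (cst 0)); first by rewrite derive_cst.
have rz : r < `|z| by rewrite ltNge; apply/negP.
near=> t; rewrite /cst; apply: (c1s_supp H); rewrite /box /=; apply/negP; rewrite -ltNge.
by near: t; apply: (@cvgr_norm_gt _ _ _ _ _ id z) => //; exact: cvg_id.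
Unshelve. all: end_near. Qed.

Lemma c1_supportedB r C C' h g : c1_supported r C h -> c1_supported r C' g ->
  c1_supported r (C + C') (fun z => h z - g z).
Proof.
move=> H G.
have dB i z : pd i (fun z => h z - g z) z = pd i h z - pd i g z.
  by rewrite /pd (deriveB (c1s_der H i z) (c1s_der G i z)).
split.
- by move=> z; apply: cvgB; [exact: c1s_cont H z|exact: c1s_cont G z].
- by move=> i z; exact: derivableB (c1s_der H i z) (c1s_der G i z).
- move=> i; rewrite (funext (dB i)) => z.
  by apply: cvgB; [exact: c1s_dcont H i z|exact: c1s_dcont G i z].
- by move=> z nb; rewrite (c1s_supp H z nb) (c1s_supp G z nb) subr0.
- move=> z; apply: le_trans (ler_normB _ _) _.
  by apply: lerD; [exact: c1s_bd H z|exact: c1s_bd G z].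
- move=> i z; rewrite dB; apply: le_trans (ler_normB _ _) _.
  by apply: lerD; [exact: c1s_dbd H i z|exact: c1s_dbd G i z].
Qed.

Lemma c1s_deriveB r C r' C' h g i z : c1_supported r C h -> c1_supported r' C' g ->
  pd i (fun z => h z - g z) z = pd i h z - pd i g z.
Proof. by move=> H G; rewrite /pd (deriveB (c1s_der H i z) (c1s_der G i z)). Qed.

Lemma c1s_deriveM r C r' C' h g i z : c1_supported r C h -> c1_supported r' C' g ->
  pd i (fun z => h z * g z) z = h z * pd i g z + g z * pd i h z.
Proof. by move=> H G; rewrite /pd (deriveM (c1s_der H i z) (c1s_der G i z)). Qed.

Lemma c1_supportedM r r' C C' h g : c1_supported r C h -> c1_supported r' C' g ->
  c1_supported r (C * C' + C * C') (fun z => h z * g z).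
Proof.
move=> H G; have C0 := c1s_C0 H; have C'0 := c1s_C0 G.
have dM i z := c1s_deriveM i z H G.
have CC0 : 0 <= C * C' by rewrite mulr_ge0.
split.
- by move=> z; apply: cvgM; [exact: c1s_cont H z|exact: c1s_cont G z].
- by move=> i z; exact: derivableM (c1s_der H i z) (c1s_der G i z).
- move=> i; rewrite (funext (dM i)) => z; apply: cvgD.
    by apply: cvgM; [exact: c1s_cont H z|exact: c1s_dcont G i z].
  by apply: cvgM; [exact: c1s_cont G z|exact: c1s_dcont H i z].
- by move=> z nb; rewrite (c1s_supp H z nb) mul0r.
- move=> z; rewrite normrM; apply: le_trans (_ : C * C' <= _); last by rewrite lerDl.
  by apply: ler_pM => //; [exact: c1s_bd H z|exact: c1s_bd G z].
- move=> i z; rewrite dM; apply: le_trans (ler_normD _ _) _; rewrite !normrM.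
  apply: lerD; first by apply: ler_pM => //; [exact: c1s_bd H z|exact: c1s_dbd G i z].
  by rewrite mulrC; apply: ler_pM => //; [exact: c1s_dbd H i z|exact: c1s_bd G z].
Qed.

Lemma intble_supported r (C : R) (h : S6 -> R) : measurable_fun setT h ->
  (forall z, ~ box6 r z -> h z = 0) -> (forall z, `|h z| <= C) ->
  intble leb6 setT h.
Proof.
move=> mh hr hC.
have bi := intble_cst C (measurable_box6 (R := R) r) (@finite_boxes_leb6 R r).
apply: (intble_supp (measurable_box6 r) hr).
apply: (intble_le (measurable_box6 r) _ _ bi); first exact: measurable_funTS.
by move=> z _; exact: hC.
Qed.

Lemma c1s_intble r C h : c1_supported r C h -> intble leb6 setT h.
Proof.
move=> H; apply: (intble_supported (c1s_meas H) (c1s_supp H)); exact: c1s_bd H.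
Qed.

Definition loc_intble3 (c : S3 -> R) :=
  measurable_fun setT c /\ forall r, intble leb3 setT (fun x => \1_(box3 r) x * c x).

Lemma loc_intble3D c c' : loc_intble3 c -> loc_intble3 c' ->
  loc_intble3 (fun x => c x + c' x).
Proof.
move=> [m i] [m' i']; split; first exact: measurable_funD.
move=> r; apply: intble_ext (intbleD measurableT (i r) (i' r)) => x.
by rewrite mulrDr.
Qed.

Lemma loc_intble3Z a c : loc_intble3 c -> loc_intble3 (fun x => a * c x).
Proof.
move=> [m i]; split; first exact: measurable_funM.
move=> r; apply: intble_ext (intbleZ a measurableT (i r)) => x.
by rewrite mulrCA.
Qed.

Lemma loc_intble3_sum (I : Type) (s : seq I) (c : I -> S3 -> R) :
  (forall i, loc_intble3 (c i)) -> loc_intble3 (fun x => \sum_(i <- s) c i x).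
Proof.
move=> H; elim: s => [|i s IH].
  under eq_fun do rewrite big_nil; split; first exact: measurable_cst.
  by move=> r; under eq_fun do rewrite mulr0; exact: intble0.
under eq_fun do rewrite big_cons; exact: loc_intble3D.
Qed.

Lemma loc_intble3_bd (c : S3 -> R) : measurable_fun setT c ->
  (forall r : R, exists D : R, forall x, box3 r x -> `|c x| <= D) -> loc_intble3 c.
Proof.
move=> mc H; split => // r; have [D HD] := H r.
have bi := intble_cst D (measurable_box3 (R := R) r) (@finite_boxes_leb3 R r).
apply/(intble_indicM _ _ (measurable_box3 r)).
apply: (intble_le (measurable_box3 r) _ _ bi); first exact: measurable_funTS.
by move=> z bz; exact: HD.
Qed.

Lemma indic_box6 r (z : S6) : \1_(box6 r) z = \1_(box3 r) z.1 * \1_(box3 r) z.2 :> R.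
Proof.
by rewrite box_prod !indicE in_setX; case: (_ \in _) => /=; rewrite ?mul1r ?mul0r.
Qed.

Lemma loc_intble3_lift c r : loc_intble3 c ->
  intble leb6 setT (fun z : S6 => \1_(box6 r) z * c z.1).
Proof.
move=> [mc ci].
have bi : intble leb3 setT (\1_(box3 r) : S3 -> R).
  have := intble_cst 1 (measurable_box3 r) (@finite_boxes_leb3 R r).
  by move=> /(intble_indicM _ _ (measurable_box3 r)); apply: intble_ext => x; rewrite mulr1.
apply: intble_ext (intble_tensor (ci r) bi) => z.
by rewrite indic_box6 mulrAC.
Qed.
End SmoothSupported.

(** * Divergence-free transport *)

Section Transport.
Variable R : realType.
Local Notation leb3 := (@leb3 R).
Local Notation leb6 := (@leb6 R).
Local Notation S3 := (space3 R).
Local Notation S6 := (space6 R).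
Local Notation box3 := (@box R _ S3).
Local Notation box6 := (@box R _ S6).
Local Notation pd := (@pd R).

Lemma line_null_leb6 i : @line_null R _ S6 leb6 (basis6 R i).
Proof.
case: (split_ordP i) => j ->; first by rewrite basis6x; exact: line_null_leb6x.
by rewrite basis6v; exact: line_null_leb6v.
Qed.

Lemma coord_le_norm (x : S3) j : `|coord x j| <= `|x|.
Proof.
have [h1 h2 h3] := (box3P `|x| x).1 (lexx _).
by elim/ord3E: j; rewrite coordE.
Qed.

Lemma basis6_norm_ge1 i : 1 <= `|basis6 R i|.
Proof.
have b3 j : 1 <= `|basis3 R j|.
  by have := coord_le_norm (basis3 R j) j; rewrite coord_basis3 eqxx normr1.
have bx x v : @box R _ S6 `|((x, v) : S6)| (x, v) by rewrite /box /=.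
case: (split_ordP i) => j ->; [rewrite basis6x|rewrite basis6v].
  by apply: le_trans (b3 j) _; have [+ _] := (box6P _ _).1 (bx (basis3 R j) 0).
by apply: le_trans (b3 j) _; have [_ +] := (box6P _ _).1 (bx 0 (basis3 R j)).
Qed.

(** A coefficient that is constant in the direction of differentiation can be moved under the
    derivative, whose integral over each line vanishes because [h] has bounded support. *)
Lemma int_coef_pd r C h i (c : S6 -> R) : c1_supported r C h ->
  measurable_fun setT c -> (forall z (s : R), c (z + s *: basis6 R i) = c z) ->
  intble leb6 setT (fun z => \1_(box6 r) z * c z) ->
  intble leb6 setT (fun z => c z * pd i h z) /\
  \int[leb6]_z (c z * pd i h z) = 0.
Proof.
move=> H mc cinv ci.
have int1 : intble leb6 setT (fun z => c z * pd i h z).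
  have := intble_mul_bd measurableT (c1s_dmeas i H) (fun z _ => c1s_dbd H i z) ci.
  apply: intble_ext => z; rewrite mulrCA.
  case: (pselect (box6 r z)) => bz; first by rewrite indicE mem_set//= mul1r mulrC.
  by rewrite (c1s_dsupp i H bz) mul0r !mulr0.
split => //; apply: (@line_null_leb6 i (fun z => c z * h z)) => //.
have cline z : continuous (fun s : R => z + s *: basis6 R i).
  move=> s; apply: cvgD; first exact: cvg_cst.
  by apply: cvgZr_tmp; exact: cvg_id.
split.
- move=> z; apply/line_is_derive; under eq_fun do rewrite cinv.
  have d1 := (line_is_derive z _ h _).1 (c1s_is_derive i z H).
  exact: (is_deriveZ (c z) d1).
- move=> z; under eq_fun do rewrite cinv.
  move=> s; apply: cvgM; first exact: cvg_cst.
  by apply: continuous_comp; [exact: cline|exact: c1s_dcont H i _].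
- move=> z; exists (r + `|z|) => s sr.
  rewrite (c1s_supp H) ?mulr0// /box /=; apply/negP; rewrite -ltNge.
  have h1 : `|s| <= `|s *: basis6 R i|.
    by rewrite normrZ ler_peMr// basis6_norm_ge1.
  have h2 := ler_normB (z + s *: basis6 R i) z.
  rewrite addrAC subrr add0r in h2.
  by move: (lt_le_trans sr (le_trans h1 h2)); rewrite ltrD2r.
Qed.

(** The Vlasov operator without its time derivative, with [A] in place of the gradient of the
    potential; see [vlasovE]. *)
Definition transport (A B : S3 -> S3) (h : S6 -> R) (z : S6) : R :=
  dot z.2 (gradx h z) - dot (A z.1) (gradv h z) + dot (cross z.2 (B z.1)) (gradv h z).

Lemma dot_gradx (a : S3) h z :
  dot a (gradx h z) = \sum_i coord a i * pd (lshift 3 i) h z.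
Proof. by apply: eq_bigr => i _; rewrite coord_vec3. Qed.

Lemma dot_gradv (a : S3) h z :
  dot a (gradv h z) = \sum_i coord a i * pd (rshift 3 i) h z.
Proof. by apply: eq_bigr => i _; rewrite coord_vec3. Qed.

Lemma dot_gradxM r C r' C' h g (a : S3) z : c1_supported r C h -> c1_supported r' C' g ->
  dot a (gradx (fun z => h z * g z) z) = h z * dot a (gradx g z) + g z * dot a (gradx h z).
Proof.
move=> H G; rewrite !dot_gradx !mulr_sumr -big_split; apply: eq_bigr => i _ /=.
by rewrite (c1s_deriveM _ _ H G); ring.
Qed.

Lemma dot_gradvM r C r' C' h g (a : S3) z : c1_supported r C h -> c1_supported r' C' g ->
  dot a (gradv (fun z => h z * g z) z) = h z * dot a (gradv g z) + g z * dot a (gradv h z).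
Proof.
move=> H G; rewrite !dot_gradv !mulr_sumr -big_split; apply: eq_bigr => i _ /=.
by rewrite (c1s_deriveM _ _ H G); ring.
Qed.

Lemma dot_gradvB r C r' C' h g (a : S3) z : c1_supported r C h -> c1_supported r' C' g ->
  dot a (gradv (fun z => h z - g z) z) = dot a (gradv h z) - dot a (gradv g z).
Proof.
move=> H G; rewrite !dot_gradv -sumrB; apply: eq_bigr => i _ /=.
by rewrite (c1s_deriveB _ _ H G) mulrBr.
Qed.

Lemma dot_gradxB r C r' C' h g (a : S3) z : c1_supported r C h -> c1_supported r' C' g ->
  dot a (gradx (fun z => h z - g z) z) = dot a (gradx h z) - dot a (gradx g z).
Proof.
move=> H G; rewrite !dot_gradx -sumrB; apply: eq_bigr => i _ /=.
by rewrite (c1s_deriveB _ _ H G) mulrBr.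
Qed.

Let ringM (h g a b c a' b' c' : R) : h * a + g * a' - (h * b + g * b') + (h * c + g * c') =
  h * (a - b + c) + g * (a' - b' + c').
Proof. by ring. Qed.

Let ringB (a b c a' b' c' : R) : (a - a') - (b - b') + (c - c') =
  (a - b + c) - (a' - b' + c').
Proof. by ring. Qed.

Lemma transportM r C r' C' A B h g z : c1_supported r C h -> c1_supported r' C' g ->
  transport A B (fun z => h z * g z) z = h z * transport A B g z + g z * transport A B h z.
Proof.
move=> H G; rewrite /transport (dot_gradxM z.2 z H G) (dot_gradvM (A z.1) z H G).
rewrite (dot_gradvM (cross z.2 (B z.1)) z H G); exact: ringM.
Qed.

Lemma transportB r C r' C' A B h g z : c1_supported r C h -> c1_supported r' C' g ->
  transport A B (fun z => h z - g z) z = transport A B h z - transport A B g z.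
Proof.
move=> H G; rewrite /transport (dot_gradxB z.2 z H G) (dot_gradvB (A z.1) z H G).
rewrite (dot_gradvB (cross z.2 (B z.1)) z H G); exact: ringB.
Qed.

Lemma box6_coord r (z : S6) i : box6 r z -> `|coord z.1 i| <= r /\ `|coord z.2 i| <= r.
Proof.
move=> /box6P[b1 b2]; split.
  exact: le_trans (coord_le_norm _ _) b1.
exact: le_trans (coord_le_norm _ _) b2.
Qed.

Lemma coord_cross0 (x y : S3) : coord (cross x y) ord0 =
  coord x (inord 1) * coord y (inord 2) - coord x (inord 2) * coord y (inord 1).
Proof. by rewrite !coordE. Qed.
Lemma coord_cross1 (x y : S3) : coord (cross x y) (inord 1) =
  coord x (inord 2) * coord y ord0 - coord x ord0 * coord y (inord 2).
Proof. by rewrite !coordE. Qed.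
Lemma coord_cross2 (x y : S3) : coord (cross x y) (inord 2) =
  coord x ord0 * coord y (inord 1) - coord x (inord 1) * coord y ord0.
Proof. by rewrite !coordE. Qed.
Definition coord_crossE := (coord_cross0, coord_cross1, coord_cross2).

Lemma ord3_neq : [/\ (ord0 == inord 1 :> 'I_3) = false, (ord0 == inord 2 :> 'I_3) = false
  & (inord 1 == inord 2 :> 'I_3) = false].
Proof. by split; apply/eqP => /(congr1 val); rewrite /= !inordK. Qed.

(** The [i]-th component of [x] cross [y] does not involve the [i]-th coordinate of [x]: the Lorentz
    force is divergence-free in the velocity. *)
Lemma cross_shift (x y : S3) (s : R) i :
  coord (cross (x + s *: basis3 R i) y) i = coord (cross x y) i.
Proof.
have [h1 h2 h3] := ord3_neq.
have [[h1' h2'] h3'] := (h1, h2, h3); rewrite eq_sym in h1'; rewrite eq_sym in h2'.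
rewrite eq_sym in h3'.
by elim/ord3E: i; rewrite !coord_crossE !coordD !coordZ !coord_basis3 ?h1 ?h2 ?h3
  ?h1' ?h2' ?h3' !mulr0 !addr0.
Qed.

Definition loc_intble_field (B : S3 -> S3) := forall i, loc_intble3 (fun x => coord (B x) i).

Lemma measurable_loc_field B : loc_intble_field B -> measurable_fun setT B.
Proof. by move=> H; apply/measurable_coordP => i; have [] := H i. Qed.

Lemma measurable_vel (i : 'I_3) : measurable_fun setT (fun z : S6 => coord z.2 i).
Proof.
have : measurable_fun setT (fun z : S6 => z.2) by exact: measurable_snd.
by move/measurable_coordP; apply.
Qed.

Lemma measurable_lift (B : S3 -> S3) i : measurable_fun setT B ->
  measurable_fun setT (fun z : S6 => coord (B z.1) i).
Proof.
move=> mB; have : measurable_fun setT (fun z : S6 => B z.1).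
  exact: (measurableT_comp mB measurable_fst).
by move/measurable_coordP; apply.
Qed.

Lemma intble_vel_field r (B : S3 -> S3) i j : loc_intble_field B ->
  intble leb6 setT (fun z : S6 => \1_(box6 r) z * (coord z.2 i * coord (B z.1) j)).
Proof.
move=> H; have Bi := loc_intble3_lift r (H j).
have mv := measurable_vel i.
have mi : measurable_fun setT (fun z : S6 => \1_(box6 r) z * coord z.2 i : R).
  apply: measurable_funM => //; exact: measurable_indic (measurable_box6 r).
have bd (z : S6) : setT z -> `|\1_(box6 r) z * coord z.2 i| <= Num.max r 0.
  move=> _; rewrite indicE; case: (boolP (z \in box6 r)) => [/set_mem bz|_].
    by rewrite mul1r le_max; have [_ ->] := box6_coord i bz.
  by rewrite mul0r normr0 le_max lexx orbT.
apply: intble_ext (intble_mul_bd measurableT mi bd Bi) => z.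
rewrite indicE; case: (_ \in _); rewrite /= ?mul1r// ?mul0r//.
Qed.

Lemma intble_cross r (B : S3 -> S3) i : loc_intble_field B ->
  intble leb6 setT (fun z : S6 => \1_(box6 r) z * coord (cross z.2 (B z.1)) i).
Proof.
move=> H; have HH a b := intble_vel_field r a b H.
elim/ord3E: i.
- apply: intble_ext (intbleB measurableT (HH (inord 1) (inord 2)) (HH (inord 2) (inord 1))) => z.
  by rewrite coord_crossE mulrBr.
- apply: intble_ext (intbleB measurableT (HH (inord 2) ord0) (HH ord0 (inord 2))) => z.
  by rewrite coord_crossE mulrBr.
- apply: intble_ext (intbleB measurableT (HH ord0 (inord 1)) (HH (inord 1) ord0)) => z.
  by rewrite coord_crossE mulrBr.
Qed.

Lemma measurable_cross (B : S3 -> S3) i : measurable_fun setT B ->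
  measurable_fun setT (fun z : S6 => coord (cross z.2 (B z.1)) i).
Proof.
move=> mB; have m a b : measurable_fun setT (fun z : S6 => coord z.2 a * coord (B z.1) b).
  by apply: measurable_funM; [exact: measurable_vel|exact: measurable_lift].
have mE a b a' b' (F : S6 -> R) :
    (forall z, F z = coord z.2 a * coord (B z.1) b - coord z.2 a' * coord (B z.1) b') ->
    measurable_fun setT F.
  by move/funext ->; apply: measurable_funB.
elim/ord3E: i.
- by apply: (mE (inord 1) (inord 2) (inord 2) (inord 1)) => z; rewrite coord_crossE.
- by apply: (mE (inord 2) ord0 ord0 (inord 2)) => z; rewrite coord_crossE.
- by apply: (mE ord0 (inord 1) (inord 1) ord0) => z; rewrite coord_crossE.
Qed.

(** No coefficient depends on the variable it is differentiated against: [v_i] is free of [x_i], [A]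
    is free of [v], and [cross_shift] settles the magnetic term. So [int_coef_pd] applies to each
    summand. *)
Lemma transport_null r C h A B : c1_supported r C h ->
  loc_intble_field A -> loc_intble_field B ->
  intble leb6 setT (transport A B h) /\ \int[leb6]_z transport A B h z = 0.
Proof.
move=> H lA lB.
have mA := measurable_loc_field lA; have mB := measurable_loc_field lB.
have X i : intble leb6 setT (fun z => coord z.2 i * pd (lshift 3 i) h z) /\
    \int[leb6]_z (coord z.2 i * pd (lshift 3 i) h z) = 0.
  apply: (int_coef_pd H); first exact: measurable_vel.
    by move=> z s; rewrite basis6x /= scaler0 addr0.
  apply: (intble_supported (r := r) (C := Num.max r 0)).
  - apply: measurable_funM; last exact: measurable_vel.
    exact: measurable_indic (measurable_box6 r).
  - by move=> z nb; rewrite indicE memNset//= mul0r.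
  - move=> z; rewrite indicE; case: (boolP (z \in box6 r)) => [/set_mem bz|_].
      by rewrite mul1r le_max; have [_ ->] := box6_coord i bz.
    by rewrite mul0r normr0 le_max lexx orbT.
have Y i : intble leb6 setT (fun z => coord (A z.1) i * pd (rshift 3 i) h z) /\
    \int[leb6]_z (coord (A z.1) i * pd (rshift 3 i) h z) = 0.
  apply: (int_coef_pd H); first exact: measurable_lift.
    by move=> z s; rewrite basis6v /= scaler0 addr0.
  exact: loc_intble3_lift (lA i).
have Z i : intble leb6 setT (fun z => coord (cross z.2 (B z.1)) i * pd (rshift 3 i) h z) /\
    \int[leb6]_z (coord (cross z.2 (B z.1)) i * pd (rshift 3 i) h z) = 0.
  apply: (int_coef_pd H); first exact: measurable_cross.
    move=> z s; rewrite basis6v /= scaler0 addr0.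
    exact: cross_shift.
  exact: intble_cross.
have iX := intble_sum (index_enum _) measurableT (fun i => (X i).1).
have iY := intble_sum (index_enum _) measurableT (fun i => (Y i).1).
have iZ := intble_sum (index_enum _) measurableT (fun i => (Z i).1).
have E z : transport A B h z = \sum_i coord z.2 i * pd (lshift 3 i) h z
    - \sum_i coord (A z.1) i * pd (rshift 3 i) h z
    + \sum_i coord (cross z.2 (B z.1)) i * pd (rshift 3 i) h z.
  by rewrite /transport dot_gradx !dot_gradv.
have iXY := intbleB measurableT iX iY.
rewrite (funext E); split; first exact: (intbleD measurableT iXY iZ).
rewrite (RintegralD measurableT iXY iZ) (RintegralB measurableT iX iY).
have S0 (F : 'I_3 -> S6 -> R) : (forall i, intble leb6 setT (F i) /\
    \int[leb6]_z F i z = 0) -> \int[leb6]_z (\sum_i F i z) = 0.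
  move=> FP; rewrite (Rint_sum (index_enum _) measurableT (fun i => (FP i).1)).
  by apply: big1 => k _; have [] := FP k.
have z0 (a b c : R) : a = 0 -> b = 0 -> c = 0 -> a - b + c = 0.
  by move=> -> -> ->; rewrite subr0 addr0.
have X0 := S0 (fun i z => coord z.2 i * pd (lshift 3 i) h z) X.
have Y0 := S0 (fun i z => coord (A z.1) i * pd (rshift 3 i) h z) Y.
have Z0 := S0 (fun i z => coord (cross z.2 (B z.1)) i * pd (rshift 3 i) h z) Z.
exact: z0 X0 Y0 Z0.
Qed.
End Transport.

(** * The self-consistent force *)

Section SelfConsistentField.
Variable R : realType.
Local Notation leb3 := (@leb3 R).
Local Notation leb6 := (@leb6 R).
Local Notation S3 := (space3 R).
Local Notation S6 := (space6 R).
Local Notation box3 := (@box R _ S3).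
Local Notation box6 := (@box R _ S6).
Local Notation leb66 := (leb6 \x leb6)%E.

Lemma coord_grad_potential r C h (x : S3) i : 0 < r -> c1_supported r C h ->
  coord (grad (potential h) x) i = - \int[leb6]_z (h z * newton_grad i (x - z.1)).
Proof.
move=> r0 H; rewrite coord_vec3.
have dh z : is_derive z ((basis3 R i, 0) : S6) h (pd (lshift 3 i) h z).
  by rewrite -basis6x; exact: c1s_is_derive H.
have ch : continuous h by exact: c1s_cont H.
have cd : continuous (pd (lshift 3 i) h) by exact: c1s_dcont H _.
have hs := c1s_supp H; have hb := c1s_bd H; have hd := c1s_dbd H (lshift 3 i).
by have [_ ->] := is_derive_potential r0 ch cd dh hs hb hd x.
Qed.

Lemma measurable_newton_grad d (T : measurableType d) (f : T -> S3) i :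
  measurable_fun setT f -> measurable_fun setT (fun t => newton_grad i (f t)).
Proof.
move=> mf; apply: measurable_funM; first by move/measurable_coordP: mf; apply.
under eq_fun do rewrite -exprVn; apply: measurable_funX.
rewrite (_ : (fun t => _) = (fun t => newton2 (f t) `^ 2^-1)); last first.
  apply/funext => t; rewrite powR12_sqrt ?newton2_ge0// /newton2 -enorm3_sqr.
  by rewrite -exprVn sqrtr_sqr ger0_norm// newton_ge0.
apply: (measurableT_comp (f := (fun x : R => x `^ 2^-1))); first exact: measurable_powR.
exact: measurable_newton2.
Qed.

(** The class of the factors in a pairing: it contains the first derivatives of [c1_supported]
    functions and their products. *)
Definition bd_supported (r : R) (al : S6 -> R) := [/\ measurable_fun setT al,
  forall z, ~ box6 r z -> al z = 0 & exists C, forall z, `|al z| <= C].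

Lemma bd_supported_intble r al : bd_supported r al -> intble leb6 setT al.
Proof. by move=> [m s [C b]]; exact: intble_supported m s b. Qed.

Lemma bd_supportedM r al be : bd_supported r al -> bd_supported r be ->
  bd_supported r (fun z => al z * be z).
Proof.
move=> [m s [C b]] [m' s' [C' b']]; split; first exact: measurable_funM.
  by move=> z nb; rewrite (s z nb) mul0r.
by exists (C * C') => z; rewrite normrM ler_pM.
Qed.

Lemma c1s_bd_supported r C h : c1_supported r C h -> bd_supported r h.
Proof.
by move=> H; split; [exact: c1s_meas H|exact: c1s_supp H|exists C; exact: c1s_bd H].
Qed.

Lemma c1s_pd_bd_supported r C h i : c1_supported r C h -> bd_supported r (pd i h).
Proof.
move=> H; split; first exact: c1s_dmeas H.
  by move=> z; exact: c1s_dsupp H.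
by exists C; exact: c1s_dbd H i.
Qed.

Lemma bd_supported_sqr r al : bd_supported r al -> intble leb6 setT (fun z => al z ^+ 2).
Proof.
move=> H; apply: intble_ext (bd_supported_intble (bd_supportedM H H)) => z.
by rewrite expr2.
Qed.

Lemma bd_supported_slice r al i (x : S3) : 0 < r -> bd_supported r al ->
  intble leb6 setT (fun z => al z * newton_grad i (x - z.1)).
Proof.
move=> r0 [m s [C b]]; have C0 := le_trans (normr_ge0 _) (b 0).
have mk : measurable_fun setT (fun z : S6 => newton_grad i (x - z.1)).
  by apply: measurable_newton_grad; apply: measurable_sub3.
apply: (weak_intble r0 C0 (x := x)); first by apply: measurable_funM.
move=> z; case: (pselect (box6 r z)) => bz; last first.
  rewrite (s z bz) mul0r normr0 mulr_ge0// mulr_ge0// addr_ge0//; exact: newton2_ge0.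
rewrite indicE mem_set//= mul1r normrM; apply: ler_pM => //.
by apply: le_trans (newton_grad_le _ _) _; rewrite lerDr.
Qed.

(** Integrated over the second point it yields minus [al] times the [i]-th component of the gradient
    of the potential of [be]; integrated over the first point it yields a summand of [be] times
    [Phi]. Adjointness is Fubini for this function. *)
Definition newton_pairing i (al be : S6 -> R) (p : S6 * S6) : R :=
  al p.1 * (be p.2 * newton_grad i (p.1.1 - p.2.1)).

Lemma newton_pairing_bound r : 0 < r -> exists2 K : R, 0 <= K &
  forall i al be, bd_supported r al -> bd_supported r be ->
    intble leb66 setT (newton_pairing i al be) /\
    `|\int[leb66]_p newton_pairing i al be p| <=
      K * (\int[leb6]_z (al z ^+ 2) + \int[leb6]_z (be z ^+ 2)).
Proof.
move=> r0; have [K K0 KP] := newton2_slice6 r0; exists K => //.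
move=> i al be Ha Hb; have [ma sa _] := Ha; have [mb sb _] := Hb.
have mk : measurable_fun setT (fun p : S6 * S6 => newton2 (p.1.1 - p.2.1)).
  exact: (measurable_ker2 measurable_fst measurable_snd).
have mg : measurable_fun setT (fun p : S6 * S6 => newton_grad i (p.1.1 - p.2.1)).
  have ms : measurable_fun setT (fun p : S6 * S6 => p.1.1 - p.2.1).
    apply: measurable_sub3.
      exact: (measurableT_comp measurable_fst measurable_fst).
    exact: (measurableT_comp measurable_fst measurable_snd).
  exact: measurable_newton_grad.
have mF : measurable_fun setT (newton_pairing i al be).
  apply: measurable_funM; first exact: (measurableT_comp ma measurable_fst).
  by apply: measurable_funM; first exact: (measurableT_comp mb measurable_snd).
have k0 (p : S6 * S6) : 0 <= newton2 (p.1.1 - p.2.1) by exact: newton2_ge0.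
have kC x : box6 r x ->
    intble leb6 setT (fun y : S6 => \1_(box6 r) y * newton2 (x.1 - y.1)) /\
    \int[leb6]_y (\1_(box6 r) y * newton2 (x.1 - y.1)) <= K.
  by move=> /box6P[bx _]; exact: KP.
have FM p : `|newton_pairing i al be p| <=
    1 * (newton2 (p.1.1 - p.2.1) * (`|al p.1| * `|be p.2|)).
  rewrite mul1r /newton_pairing mulrA normrM normrM mulrC.
  by apply: ler_wpM2r; [exact: mulr_ge0|exact: newton_grad_le].
have a2 := bd_supported_sqr Ha; have b2 := bd_supported_sqr Hb.
have [F1 F2] := @schur_bound _ _ _ leb6 (fun p : S6 * S6 => newton2 (p.1.1 - p.2.1))
  (box6 r) K mk k0 (fun x y => newton2_sub _ _) (measurable_box6 r) kC
  (newton_pairing i al be) al be 1 mF ler01 a2 b2 sa sb FM.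
by split; [exact: F1|move: F2; rewrite mulr1].
Qed.

Lemma coord_grad_potential_pairing r C d (al : S6 -> R) i (z : S6) : 0 < r ->
  c1_supported r C d ->
  al z * coord (grad (potential d) z.1) i = - \int[leb6]_z' newton_pairing i al d (z, z').
Proof.
move=> r0 H; rewrite (coord_grad_potential _ _ r0 H) mulrN; congr (- _).
have := RintegralZl (al z) measurableT (bd_supported_slice i z.1 r0 (c1s_bd_supported H)).
by move=> <-.
Qed.

Lemma intble_grad_potential r C d (al : S6 -> R) i : 0 < r -> c1_supported r C d ->
  bd_supported r al ->
  intble leb6 setT (fun z => al z * coord (grad (potential d) z.1) i) /\
  \int[leb6]_z (al z * coord (grad (potential d) z.1) i) =
    - \int[leb66]_p newton_pairing i al d p.
Proof.
move=> r0 H Ha; have [K K0 KP] := newton_pairing_bound r0.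
have [Fi _] := KP i al d Ha (c1s_bd_supported H).
have Gi := fubini_intble1 Fi.
have E z := coord_grad_potential_pairing al i z r0 H.
split; first by apply: intble_ext (intbleN measurableT Gi) => z; rewrite E.
rewrite (fubiniR1 Fi) -(RintN measurableT Gi).
by apply: eq_Rintegral => z _; exact: E.
Qed.

(** The force is even bounded on every box, by the slice bound of [1/|x|^2] and the bound of [d]; it
    is measurable as an integral depending on a parameter. *)
Lemma loc_intble_field_grad_potential r C d : 0 < r -> c1_supported r C d ->
  @loc_intble_field R (grad (potential d)).
Proof.
move=> r0 H i; have dS := c1s_bd_supported H.
have E (x : S3) := coord_grad_potential x i r0 H.
apply: loc_intble3_bd.
  rewrite (funext E); apply: (measurableT_comp (@oppr_measurable R setT)).
  have mF : measurable_fun setT (fun p : S3 * S6 => d p.2 * newton_grad i (p.1 - p.2.1)).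
    apply: measurable_funM; first exact: (measurableT_comp (c1s_meas H) measurable_snd).
    apply: measurable_newton_grad; apply: measurable_sub3; first exact: measurable_fst.
    exact: (measurableT_comp measurable_fst measurable_snd).
  exact: (@meas_fubini1 _ _ _ _ R leb6 _ mF).
(* One box for both the support of [d] and the point [x]. *)
move=> r'; pose r1 := Num.max r r'.
have r10 : 0 < r1 by rewrite lt_max r0.
have [K K0 KP] := newton2_slice6 r10; exists (C * K) => x bx.
have bx1 : box3 r1 x by rewrite /box /= (le_trans bx)// le_max lexx orbT.
have [ki kb] := KP x bx1; rewrite E normrN.
have sl := bd_supported_slice i x r0 dS.
apply: le_trans (Rint_norm_le measurableT (intble_meas sl) (intbleZ C measurableT ki) _) _.
  apply: aeW => z _; rewrite normrM.
  have C0 := c1s_C0 H; have n0 := newton2_ge0 (x - z.1).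
  case: (pselect (box6 r z)) => bz; last first.
    by rewrite (c1s_supp H bz) normr0 mul0r !mulr_ge0.
  rewrite indicE mem_set ?mul1r; last first.
    by rewrite /box /= (le_trans bz)// le_max lexx.
  by apply: ler_pM => //; [exact: c1s_bd H z|exact: newton_grad_le].
by rewrite (RintegralZl C measurableT ki) ler_wpM2l// (c1s_C0 H).
Qed.

(* The costate's source term [Phi f g] is the adjoint of [d |-> grad (potential d)]. *)
Lemma grad_potential_adjoint r C Cf Cg d f g : 0 < r -> c1_supported r C d ->
  c1_supported r Cf f -> c1_supported r Cg g ->
  [/\ intble leb6 setT (fun z => dot (grad (potential d) z.1) (gradv f z) * g z),
    intble leb6 setT (fun z => d z * Phi f g z.1) &
  \int[leb6]_z (dot (grad (potential d) z.1) (gradv f z) * g z) =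
    - \int[leb6]_z (d z * Phi f g z.1)].
Proof.
move=> r0 H F G; have [K K0 KP] := newton_pairing_bound r0.
pose al i z := g z * pd (rshift 3 i) f z.
have Ha i : bd_supported r (al i).
  by apply: bd_supportedM; [exact: c1s_bd_supported G|exact: c1s_pd_bd_supported F].
have dS := c1s_bd_supported H.
have Fi i := (KP i (al i) d (Ha i) dS).1.
have I1 i := intble_grad_potential i r0 H (Ha i).
have E1 z : dot (grad (potential d) z.1) (gradv f z) * g z =
    \sum_i al i z * coord (grad (potential d) z.1) i.
  rewrite dot_gradv mulr_suml; apply: eq_bigr => i _.
  by rewrite /al -mulrA [RHS]mulrC; congr (_ * _); rewrite mulrC.
have E2 z : d z * Phi f g z.1 = \sum_i \int[leb6]_z' newton_pairing i (al i) d (z', z).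
  have S i := bd_supported_slice i z.1 r0 (Ha i).
  rewrite /Phi mulrN -mulNr -RintegralZl; last 2 first.
  - exact: measurableT.
  - apply: intble_ext (intble_sum (index_enum _) measurableT S) => z'.
    rewrite dot_gradv /newton_grad !mulr_suml; apply: eq_bigr => i _.
    by rewrite /al; ring.
  rewrite -Rint_sum; last 2 first.
  - exact: measurableT.
  - move=> i; apply: intble_ext (intbleZ (- d z) measurableT (S i)) => z'.
    by rewrite /newton_pairing /= newton_gradN; ring.
  apply: eq_Rintegral => z' _; rewrite dot_gradv !mulr_suml mulr_sumr.
  apply: eq_bigr => i _; rewrite /newton_pairing /= newton_gradN /newton_grad /al; ring.
have I2 i := fubini_intble2 (Fi i).
rewrite (funext E1) (funext E2); split.
- exact: (intble_sum (index_enum _) measurableT (fun i => (I1 i).1)).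
- exact: (intble_sum (index_enum _) measurableT I2).
- rewrite (Rint_sum (index_enum _) measurableT (fun i => (I1 i).1)).
  rewrite (Rint_sum (index_enum _) measurableT I2) -sumrN.
  by apply: eq_bigr => i _; rewrite (I1 i).2 (fubiniR2 (Fi i)).
Qed.

(** [d] enters twice, directly and through its potential, so the pairing bound with [al = d] times a
    velocity derivative of [eta] is quadratic in [d]. The factor [3] in the constant counts the
    coordinates. *)
Lemma grad_potential_remainder r : 0 < r -> exists2 K : R, 0 <= K &
  forall C Ce d eta, c1_supported r C d -> c1_supported r Ce eta ->
  intble leb6 setT (fun z => d z * dot (grad (potential d) z.1) (gradv eta z)) /\
  `|\int[leb6]_z (d z * dot (grad (potential d) z.1) (gradv eta z))| <=
    K * (1 + Ce ^+ 2) * \int[leb6]_z (d z ^+ 2).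
Proof.
move=> r0; have [K K0 KP] := newton_pairing_bound r0.
exists (3 * K); first by rewrite mulr_ge0.
move=> C Ce d eta H F.
pose al i z := d z * pd (rshift 3 i) eta z.
have dS := c1s_bd_supported H.
have Ha i : bd_supported r (al i).
  by apply: bd_supportedM => //; exact: c1s_pd_bd_supported F.
have I1 i := intble_grad_potential i r0 H (Ha i).
have E1 z : d z * dot (grad (potential d) z.1) (gradv eta z) =
    \sum_i al i z * coord (grad (potential d) z.1) i.
  rewrite dot_gradv mulr_sumr; apply: eq_bigr => i _.
  by rewrite /al -mulrA; congr (_ * _); rewrite mulrC.
rewrite (funext E1); split.
  exact: (intble_sum (index_enum _) measurableT (fun i => (I1 i).1)).
rewrite (Rint_sum (index_enum _) measurableT (fun i => (I1 i).1)).
have d2 := bd_supported_sqr dS.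
have B i : `|\int[leb6]_z (al i z * coord (grad (potential d) z.1) i)| <=
    K * (1 + Ce ^+ 2) * \int[leb6]_z (d z ^+ 2).
  rewrite (I1 i).2 normrN; apply: le_trans (KP i (al i) d (Ha i) dS).2 _.
  rewrite -mulrA ler_wpM2l// mulrDl mul1r addrC lerD2l.
  rewrite -RintegralZl//; apply: Rint_le => //.
  - exact: bd_supported_sqr (Ha i).
  - exact: intbleZ.
  - move=> z _; rewrite /al exprMn mulrC ler_wpM2r ?sqr_ge0//.
    rewrite -[leLHS]real_normK ?num_real// ler_sqr ?nnegrE ?(c1s_C0 F)//.
    exact: c1s_dbd F _ z.
rewrite sum3E; apply: le_trans (ler_normD _ _) _.
apply: le_trans (lerD (ler_normD _ _) (lexx _)) _.
apply: le_trans (lerD (lerD (B ord0) (B (inord 1))) (B (inord 2))) _.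
rewrite le_eqVlt; apply/orP; left; apply/eqP.
by move: (\int[_]_z _) => I; ring.
Qed.
End SelfConsistentField.

(** * The magnetic term of a control increment *)

Section ControlField.
Variables (R : realType) (N : nat) (m : 'I_N -> space3 R -> space3 R).
Local Notation leb3 := (@leb3 R).
Local Notation leb6 := (@leb6 R).
Local Notation S3 := (space3 R).
Local Notation S6 := (space6 R).
Local Notation box3 := (@box R _ S3).
Local Notation box6 := (@box R _ S6).
Hypotheses (m1 : forall k, loc_intble_field (m k))
  (m2 : forall k i, loc_intble3 (fun x => coord (m k x) i ^+ 2)).

(** The control field frozen at one time, with [c k] standing for [u k t]. *)
Definition combine (c : 'I_N -> R) (x : S3) : S3 :=
  vec3 (fun j => \sum_k c k * coord (m k x) j).

Lemma loc_intble_combine c : loc_intble_field (combine c).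
Proof.
move=> i; rewrite (_ : (fun x => _) = (fun x => \sum_k c k * coord (m k x) i)).
  by apply: loc_intble3_sum => k; apply: loc_intble3Z; exact: m1.
by apply/funext => x; exact: coord_vec3.
Qed.

(** Multiplied by the costate, with the state for [eta], this is the integrand of [p_k]. *)
Definition cross_der (eta : S6 -> R) k z := dot (cross z.2 (m k z.1)) (gradv eta z).

Lemma dot_cross_combine (c : 'I_N -> R) eta z :
  dot (cross z.2 (combine c z.1)) (gradv eta z) = \sum_k c k * cross_der eta k z.
Proof.
rewrite dot_gradv; under [RHS]eq_bigr do rewrite /cross_der dot_gradv mulr_sumr.
rewrite exchange_big /=; apply: eq_bigr => i _.
under [RHS]eq_bigr do rewrite mulrA; rewrite -mulr_suml; congr (_ * _).
have E j : coord (combine c z.1) j = \sum_k c k * coord (m k z.1) j by exact: coord_vec3.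
elim/ord3E: i; rewrite coord_crossE !E !mulr_sumr -sumrB; apply: eq_bigr => k _;
  by rewrite coord_crossE; ring.
Qed.

Let sqr_cross_bound (r a b x y s : R) : `|a| <= r -> `|b| <= r ->
  x ^+ 2 + y ^+ 2 <= s -> (a * x - b * y) ^+ 2 <= 2 * r ^+ 2 * s.
Proof.
move=> ar br xys.
have a2 : a ^+ 2 <= r ^+ 2.
  rewrite -[a ^+ 2]real_normK ?num_real// ler_sqr ?nnegrE//.
  exact: le_trans (normr_ge0 _) ar.
have b2 : b ^+ 2 <= r ^+ 2.
  rewrite -[b ^+ 2]real_normK ?num_real// ler_sqr ?nnegrE//.
  exact: le_trans (normr_ge0 _) br.
have h1 : a ^+ 2 * x ^+ 2 <= r ^+ 2 * x ^+ 2 by rewrite ler_wpM2r// sqr_ge0.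
have h2 : b ^+ 2 * y ^+ 2 <= r ^+ 2 * y ^+ 2 by rewrite ler_wpM2r// sqr_ge0.
have h3 : r ^+ 2 * (x ^+ 2 + y ^+ 2) <= r ^+ 2 * s by rewrite ler_wpM2l// sqr_ge0.
by have := sqr_ge0 (a * x + b * y); nra.
Qed.

Lemma intble_cross_sqr r k i :
  intble leb6 setT (fun z : S6 => \1_(box6 r) z * coord (cross z.2 (m k z.1)) i ^+ 2).
Proof.
have mm := measurable_loc_field (m1 k).
have ms : measurable_fun setT (fun z : S6 => \1_(box6 r) z * coord (cross z.2 (m k z.1)) i ^+ 2 : R).
  apply: measurable_funM; first exact: measurable_indic (measurable_box6 r).
  by apply: measurable_funX; exact: measurable_cross.
have L j := loc_intble3_lift r (m2 k j).
have L2 := intble_sum (index_enum _) measurableT L.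
apply: (intble_le measurableT ms _ (intbleZ (2 * r ^+ 2) measurableT L2)) => z _.
rewrite ger0_norm; last by rewrite mulr_ge0// sqr_ge0.
rewrite -mulr_sumr [leRHS]mulrCA indicE.
case: (boolP (z \in box6 r)) => [/set_mem bz|_]; last by rewrite !mul0r.
rewrite !mul1r sum3E.
have V j : `|coord z.2 j| <= r by have [] := box6_coord j bz.
have s0 j : 0 <= coord (m k z.1) j ^+ 2 by exact: sqr_ge0.
move: {ms mm L L2} (s0 ord0) (s0 (inord 1)) (s0 (inord 2)) => s00 s01 s02.
by elim/ord3E: i; rewrite coord_crossE; apply: sqr_cross_bound => //; lra.
Qed.

Let cross_pointwise (s C d w a0 a1 a2 q0 q1 q2 : R) :
  (s = 0 /\ d = 0) \/ s = 1 -> `|q0| <= C -> `|q1| <= C -> `|q2| <= C ->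
  `|d * (w * (a0 * q0 + a1 * q1 + a2 * q2))| <=
  d ^+ 2 + w ^+ 2 * (3 * C ^+ 2 * (s * a0 ^+ 2 + s * a1 ^+ 2 + s * a2 ^+ 2)).
Proof.
move=> [[-> ->]|->] h0 h1 h2; first by rewrite !mul0r normr0 expr0n/= !addr0 !mulr0.
have key (q : R) : `|q| <= C -> q ^+ 2 <= C ^+ 2.
  move=> qC; rewrite -[q ^+ 2]real_normK ?num_real// ler_sqr ?nnegrE//.
  exact: le_trans (normr_ge0 _) qC.
have k0 := key _ h0; have k1 := key _ h1; have k2 := key _ h2.
have g0 : a0 ^+ 2 * q0 ^+ 2 <= a0 ^+ 2 * C ^+ 2 by rewrite ler_wpM2l// sqr_ge0.
have g1 : a1 ^+ 2 * q1 ^+ 2 <= a1 ^+ 2 * C ^+ 2 by rewrite ler_wpM2l// sqr_ge0.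
have g2 : a2 ^+ 2 * q2 ^+ 2 <= a2 ^+ 2 * C ^+ 2 by rewrite ler_wpM2l// sqr_ge0.
rewrite !mul1r; set Q := _ + a1 * q1 + _.
have Q2 : Q ^+ 2 <= 3 * C ^+ 2 * (a0 ^+ 2 + a1 ^+ 2 + a2 ^+ 2).
  have e1 := sqr_ge0 (a0 * q0 - a1 * q1); have e2 := sqr_ge0 (a0 * q0 - a2 * q2).
  have e3 := sqr_ge0 (a1 * q1 - a2 * q2); rewrite /Q; nra.
have h : w ^+ 2 * Q ^+ 2 <= w ^+ 2 * (3 * C ^+ 2 * (a0 ^+ 2 + a1 ^+ 2 + a2 ^+ 2)).
  by rewrite ler_wpM2l// sqr_ge0.
apply: le_trans (lerD (lexx (d ^+ 2)) h).
rewrite ler_norml -exprMn; move: (w * Q) => t.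
by have := sqr_ge0 (d - t); have := sqr_ge0 (d + t); have := sqr_ge0 d; have := sqr_ge0 t;
  move=> *; apply/andP; split; nra.
Qed.

Let final_bound (n a b c I : R) : 0 <= n -> 0 <= a -> 0 <= b -> 0 <= c -> 0 <= I ->
  n * I + 3 * c * a * b <= (n + 3 * a) * (1 + c) * (b + I).
Proof.
move=> n0 a0 b0 c0 I0.
have p1 := mulr_ge0 n0 I0; have p2 := mulr_ge0 n0 b0; have p3 := mulr_ge0 a0 I0.
have p4 := mulr_ge0 a0 b0; have p5 := mulr_ge0 c0 p1; have p6 := mulr_ge0 c0 p2.
have p7 := mulr_ge0 c0 p3; have p8 := mulr_ge0 c0 p4.
have -> : (n + 3 * a) * (1 + c) * (b + I) = n * I + n * b + 3 * (a * I) + 3 * (a * b) +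
  c * (n * I) + c * (n * b) + 3 * (c * (a * I)) + 3 * (c * (a * b)) by ring.
have -> : 3 * c * a * b = 3 * (c * (a * b)) by ring.
lra.
Qed.

(** Young's inequality splits each term [d (e_k Q_k)] into [d^2] and [e_k^2 Q_k^2], where [Q_k] is
    at most the bound of [eta] times the components of [v] cross [m_k]. Their squares are integrable
    over the box because those of [m_k] are. *)
Lemma cross_remainder r : exists2 K : R, 0 <= K &
  forall C Ce d eta (e : 'I_N -> R), c1_supported r C d -> c1_supported r Ce eta ->
  intble leb6 setT (fun z => d z * dot (cross z.2 (combine e z.1)) (gradv eta z)) /\
  `|\int[leb6]_z (d z * dot (cross z.2 (combine e z.1)) (gradv eta z))| <=
    K * (1 + Ce ^+ 2) * (\sum_k e k ^+ 2 + \int[leb6]_z (d z ^+ 2)).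
Proof.
pose M k : R := \int[leb6]_z (\1_(box6 r) z * coord (cross z.2 (m k z.1)) ord0 ^+ 2 +
  \1_(box6 r) z * coord (cross z.2 (m k z.1)) (inord 1) ^+ 2 +
  \1_(box6 r) z * coord (cross z.2 (m k z.1)) (inord 2) ^+ 2).
have S k := intbleD measurableT (intbleD measurableT (intble_cross_sqr r k ord0)
  (intble_cross_sqr r k (inord 1))) (intble_cross_sqr r k (inord 2)).
have M0 k : 0 <= M k.
  by apply: Rintegral_ge0 => z _; rewrite !addr_ge0// mulr_ge0// sqr_ge0.
(* [N] counts the copies of [int d^2], one per field, and [3] comes from the square of a sum of
   three terms. *)
exists (N%:R + 3 * \sum_k M k); first by rewrite addr_ge0// mulr_ge0// sumr_ge0.
move=> C Ce d eta e H E.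
have md := c1s_meas H.
have d2 := bd_supported_sqr (c1s_bd_supported H).
have mcd k : measurable_fun setT (cross_der eta k).
  have -> : cross_der eta k = (fun z => \sum_i coord (cross z.2 (m k z.1)) i * pd (rshift 3 i) eta z).
    by apply/funext => z; exact: dot_gradv.
  apply: measurable_sum => i; apply: measurable_funM; last exact: c1s_dmeas E.
  exact: measurable_cross (measurable_loc_field (m1 k)).
have mf : measurable_fun setT (fun z => d z * dot (cross z.2 (combine e z.1)) (gradv eta z)).
  under eq_fun do rewrite dot_cross_combine.
  apply: measurable_funM => //; apply: measurable_sum => k.
  by apply: measurable_funM => //; exact: mcd.
pose G k z := d z ^+ 2 + e k ^+ 2 * (3 * Ce ^+ 2 *
  (\1_(box6 r) z * coord (cross z.2 (m k z.1)) ord0 ^+ 2 +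
   \1_(box6 r) z * coord (cross z.2 (m k z.1)) (inord 1) ^+ 2 +
   \1_(box6 r) z * coord (cross z.2 (m k z.1)) (inord 2) ^+ 2)).
have S3k k := intbleZ (3 * Ce ^+ 2) measurableT (S k).
have Sek k := intbleZ (e k ^+ 2) measurableT (S3k k).
have Gi k : intble leb6 setT (G k) by exact: intbleD measurableT d2 (Sek k).
have Gs := intble_sum (index_enum _) measurableT Gi.
have le (z : S6) : `|d z * dot (cross z.2 (combine e z.1)) (gradv eta z)| <= \sum_k G k z.
  rewrite dot_cross_combine mulr_sumr; apply: le_trans (ler_norm_sum _ _ _) _.
  apply: ler_sum => k _; rewrite /cross_der dot_gradv sum3E.
  apply: cross_pointwise; [|exact: c1s_dbd E _ z|exact: c1s_dbd E _ z|exact: c1s_dbd E _ z].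
  rewrite indicE; case: (boolP (z \in box6 r)) => bz; first by right.
  by left; split => //; apply: (c1s_supp H) => b'; move: bz; rewrite mem_set.
have Fi := intble_le measurableT mf (fun z _ => le z) Gs; split => //.
apply: le_trans (Rint_norm_le measurableT mf Gs (aeW _ (fun z _ => le z))) _.
rewrite (Rint_sum (index_enum _) measurableT Gi).
have GE k : \int[leb6]_z G k z = \int[leb6]_z (d z ^+ 2) + e k ^+ 2 * (3 * Ce ^+ 2 * M k).
  rewrite (RintegralD measurableT d2 (Sek k)) (RintegralZl _ measurableT (S3k k)).
  by rewrite (RintegralZl _ measurableT (S k)).
under eq_bigr do rewrite GE; rewrite big_split /= sumr_const card_ord.
have I0 : 0 <= \int[leb6]_z (d z ^+ 2) by apply: Rintegral_ge0 => z _; rewrite sqr_ge0.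
move: (\int[leb6]_z (d z ^+ 2)) I0 => I I0.
have SM0 : 0 <= \sum_k M k by rewrite sumr_ge0.
have Se0 : 0 <= \sum_k e k ^+ 2 by rewrite sumr_ge0// => k _; rewrite sqr_ge0.
have C20 : 0 <= Ce ^+ 2 by rewrite sqr_ge0.
have le2 : \sum_k e k ^+ 2 * (3 * Ce ^+ 2 * M k) <= 3 * Ce ^+ 2 * (\sum_k M k) * \sum_k e k ^+ 2.
  rewrite mulr_sumr; apply: ler_sum => k _; rewrite mulrC ler_wpM2r ?sqr_ge0//.
  apply: ler_wpM2l; first by rewrite mulr_ge0.
  by rewrite (bigD1 k)//= lerDl sumr_ge0.
apply: le_trans (lerD (lexx _) le2) _.
rewrite -(mulr_natl I); have N0 : 0 <= (N%:R : R) by [].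
exact: final_bound.
Qed.
End ControlField.

(** * The energy and duality estimates at a fixed time *)

Section EnergyStep.
Variables (R : realType) (N : nat) (m : 'I_N -> space3 R -> space3 R).
Local Notation leb3 := (@leb3 R).
Local Notation leb6 := (@leb6 R).
Local Notation S3 := (space3 R).
Local Notation S6 := (space6 R).
Local Notation box3 := (@box R _ S3).
Local Notation box6 := (@box R _ S6).
Hypotheses (m1 : forall k, loc_intble_field (m k))
  (m2 : forall k i, loc_intble3 (fun x => coord (m k x) i ^+ 2)).
Local Notation combine := (combine m).
Local Notation cross_der := (cross_der m).

Lemma grad_potentialB r Cf Ch f fh (x : S3) i : 0 < r -> c1_supported r Cf f ->
  c1_supported r Ch fh -> coord (grad (potential fh) x) i =
  coord (grad (potential f) x) i + coord (grad (potential (fun z => fh z - f z)) x) i.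
Proof.
move=> r0 F Fh.
apply: etrans (coord_grad_potential x i r0 Fh) _; apply/esym.
rewrite [X in X + _](coord_grad_potential x i r0 F).
rewrite [X in _ + X](coord_grad_potential x i r0 (c1_supportedB Fh F)) -opprD.
congr (- _).
have If := bd_supported_slice i x r0 (c1s_bd_supported F).
have Ih := bd_supported_slice i x r0 (c1s_bd_supported Fh).
have Id := bd_supported_slice i x r0 (c1s_bd_supported (c1_supportedB Fh F)).
rewrite -(RintegralD measurableT If Id); apply: eq_Rintegral => z _; ring.
Qed.

Lemma combineD c e x i :
  coord (combine (fun k => c k + e k) x) i = coord (combine c x) i + coord (combine e x) i.
Proof.
by rewrite !coord_vec3 -big_split; apply: eq_bigr => k _ /=; rewrite mulrDl.
Qed.

(** The operator is affine in the two fields, so their increments appear as separate source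
    terms. *)
Lemma transport_perturb (A A' D B B' W : S3 -> S3) h z :
  (forall x i, coord (A' x) i = coord (A x) i + coord (D x) i) ->
  (forall x i, coord (B' x) i = coord (B x) i + coord (W x) i) ->
  transport A' B' h z = transport A B h z - dot (D z.1) (gradv h z)
    + dot (cross z.2 (W z.1)) (gradv h z).
Proof.
move=> AD BW; rewrite /transport.
have -> : dot (A' z.1) (gradv h z) = dot (A z.1) (gradv h z) + dot (D z.1) (gradv h z).
  by rewrite /dot -big_split; apply: eq_bigr => i _ /=; rewrite AD mulrDl.
have -> : dot (cross z.2 (B' z.1)) (gradv h z) =
    dot (cross z.2 (B z.1)) (gradv h z) + dot (cross z.2 (W z.1)) (gradv h z).
  rewrite /dot -big_split; apply: eq_bigr => i _ /=; rewrite -mulrDl; congr (_ * _).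
  by elim/ord3E: i; rewrite !coord_crossE !BW; ring.
by move: (dot _ _) (dot _ _) (dot _ _) (dot _ _) (dot _ _) => *; ring.
Qed.

Lemma intble_cross_der r C f be k : c1_supported r C f -> bd_supported r be ->
  intble leb6 setT (fun z => cross_der f k z * be z).
Proof.
move=> F B.
have H i : intble leb6 setT (fun z => (pd (rshift 3 i) f z * be z) *
    (\1_(box6 r) z * coord (cross z.2 (m k z.1)) i)).
  have [mp _ [C' bp]] := bd_supportedM (c1s_pd_bd_supported (rshift 3 i) F) B.
  exact: (intble_mul_bd measurableT mp (fun z _ => bp z) (intble_cross r i (m1 k))).
apply: intble_ext (intble_sum (index_enum _) measurableT H) => z.
rewrite /cross_der dot_gradv mulr_suml; apply: eq_bigr => i _.
case: (pselect (box6 r z)) => bz; first by rewrite indicE mem_set//= mul1r mulrC mulrA.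
have [_ sb _] := B; by rewrite (sb z bz) !mulr0 mul0r.
Qed.

Lemma vlasovE (psi : S3 -> R) (Bf : S3 -> S3) (h ht : S6 -> R) z :
  vlasov psi Bf h ht z = ht z + transport (grad psi) Bf h z.
Proof. by rewrite /vlasov /transport !addrA. Qed.

Let alg_dt (a b x y p q t t' : R) : a + x = 0 -> b + y = 0 -> t = y - t' ->
  t' = x - p + q -> b - a = - t + p - q.
Proof. by move=> *; lra. Qed.

Let alg_gt (a x p q s t : R) : a + x = s -> t = x - p + q -> a = - t - p + q + s.
Proof. by move=> *; lra. Qed.

Let alg_sqr (d x p q s t : R) : s = - x + p - q -> t = d * x + d * x ->
  d * s = - 2^-1 * t + d * p - d * q.
Proof. by move=> -> ->; field. Qed.

Let alg_prod (x y p q g d u v w s s' t q' w' : R) :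
  s = - x + p - q -> s' = - y - u + v + w' -> t = d * y + g * x -> q' = q * g ->
  d * w' = d * w ->
  s * g + d * s' = p * g + d * w - t - q' - d * u + d * v.
Proof. by move=> -> -> -> -> dw; rewrite [d * (_ + w')]mulrDr dw; ring. Qed.

Let remainders (K1 K2 C E I : R) : 0 <= K1 -> 0 <= K2 -> 0 <= E -> 0 <= I ->
  K1 * (1 + C ^+ 2) * I + K2 * (1 + C ^+ 2) * (E + I) <=
  (K1 + K2) * (1 + C ^+ 2) * (E + I).
Proof.
move=> k1 k2 E0 I0; have c0 := sqr_ge0 C.
rewrite [in leRHS]mulrDl [in leRHS]mulrDl lerD2r ler_wpM2l ?lerDr//.
by rewrite mulr_ge0// addr_ge0.
Qed.

(* The terms in [dpsi_d . dv f] cancel against the costate's source term up to a    *)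
(* quadratic remainder, which leaves the pairing of the control increment with [p]. *)
Lemma energy_step r : 0 < r -> exists2 K : R, 0 <= K &
  forall Cf Ch Cg f fh g ft fht gt (chi : S6 -> R) c e,
  c1_supported r Cf f -> c1_supported r Ch fh -> c1_supported r Cg g ->
  (forall z, chi z = 1 \/ (f z = 0 /\ fh z = 0)) ->
  measurable_fun setT ft -> measurable_fun setT fht -> measurable_fun setT gt ->
  {ae leb6, forall z, vlasov (potential f) (combine c) f ft z = 0} ->
  {ae leb6, forall z, vlasov (potential fh) (combine (fun k => c k + e k)) fh fht z = 0} ->
  {ae leb6, forall z, vlasov (potential f) (combine c) g gt z = Phi f g z.1 * chi z} ->
  let d z := fh z - f z in
  `|\int[leb6]_z (d z * (fht z - ft z))| <=
     K * (1 + Cf ^+ 2) * (\sum_k e k ^+ 2 + \int[leb6]_z (d z ^+ 2)) /\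
  `|\int[leb6]_z ((fht z - ft z) * g z + d z * gt z) +
      \sum_k e k * \int[leb6]_z (cross_der f k z * g z)| <=
     K * (1 + Cg ^+ 2) * (\sum_k e k ^+ 2 + \int[leb6]_z (d z ^+ 2)).
Proof.
move=> r0; have [K1 K10 P1] := grad_potential_remainder r0 (R := R).
have [K2 K20 P2] := cross_remainder m1 m2 r.
exists (K1 + K2); first exact: addr_ge0.
move=> Cf Ch Cg f fh g ft fht gt chi c e F Fh G chi1 mft mfht mgt eqf eqh eqg d.
have D : c1_supported r (Ch + Cf) d by exact: c1_supportedB.
pose A := grad (potential f); pose A' := grad (potential fh); pose Ad := grad (potential d).
pose B := combine c; pose B' := combine (fun k => c k + e k); pose W := combine e.
have lA' : loc_intble_field A' by exact: loc_intble_field_grad_potential r0 Fh.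
have lB' : loc_intble_field B' by exact: (loc_intble_combine m1).
have AA x i : coord (A' x) i = coord (A x) i + coord (Ad x) i.
  exact: grad_potentialB r0 F Fh.
have BB x i : coord (B' x) i = coord (B x) i + coord (W x) i by exact: combineD.
have TP h z : transport A' B' h z = transport A B h z - dot (Ad z.1) (gradv h z)
    + dot (cross z.2 (W z.1)) (gradv h z) by exact: transport_perturb.
(* The two state equations are subtracted so that the perturbed operator acts on [d], and the
   increments of the fields act on the unperturbed [f]. *)
have dt : {ae leb6, forall z, fht z - ft z = - transport A' B' d z +
    dot (Ad z.1) (gradv f z) - dot (cross z.2 (W z.1)) (gradv f z)}.
  apply: filterS2 eqf eqh => z ef eh.
  exact: (alg_dt (etrans (esym (vlasovE _ _ _ _ _)) ef)
    (etrans (esym (vlasovE _ _ _ _ _)) eh) (transportB A' B' z Fh F) (TP f z)).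
(* The costate is rewritten with the same perturbed operator, so that the product rule applies to
   [d g]. The new terms contain the increments of the fields and are multiplied by [d] below, hence
   quadratic. *)
have gte : {ae leb6, forall z, gt z = - transport A' B' g z - dot (Ad z.1) (gradv g z)
    + dot (cross z.2 (W z.1)) (gradv g z) + Phi f g z.1 * chi z}.
  apply: filterS eqg => z eg.
  exact: (alg_gt (etrans (esym (vlasovE _ _ _ _ _)) eg) (TP g z)).
(* No transport term survives integration, neither for [d^2] nor for [d g]. *)
have [iTdd Tdd] := transport_null (c1_supportedM D D) lA' lB'.
have [iTdg Tdg] := transport_null (c1_supportedM D G) lA' lB'.
have [i1f b1f] := P1 _ _ _ _ D F; have [i1g b1g] := P1 _ _ _ _ D G.
have [i2f b2f] := P2 _ _ _ _ e D F; have [i2g b2g] := P2 _ _ _ _ e D G.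
have md := c1s_meas D; have mg := c1s_meas G.
have I0 : 0 <= \int[leb6]_z (d z ^+ 2) by apply: Rintegral_ge0 => z _; rewrite sqr_ge0.
have E0 : 0 <= \sum_k e k ^+ 2 by rewrite sumr_ge0// => k _; rewrite sqr_ge0.
have mdt : measurable_fun setT (fun z => fht z - ft z) by exact: measurable_funB.
split.
- have iT := intbleZ (- 2^-1) measurableT iTdd.
  have i12 := intbleB measurableT (intbleD measurableT iT i1f) i2f.
  have -> : \int[leb6]_z (d z * (fht z - ft z)) =
      \int[leb6]_z (- 2^-1 * transport A' B' (fun z => d z * d z) z +
        d z * dot (Ad z.1) (gradv f z) - d z * dot (cross z.2 (W z.1)) (gradv f z)).
    apply: (Rint_aeeq measurableT _ (intble_meas i12)); first exact: measurable_funM.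
    apply: filterS dt => z dtz _.
    exact: (alg_sqr dtz (transportM A' B' z D D)).
  rewrite (RintegralB measurableT (intbleD measurableT iT i1f) i2f).
  rewrite (RintegralD measurableT iT i1f) (RintegralZl _ measurableT iTdd).
  rewrite [X in _ * X]Tdd mulr0 add0r; apply: le_trans (ler_normB _ _) _.
  by apply: le_trans (lerD b1f b2f) _; exact: remainders.
- have [ia iP adj] := grad_potential_adjoint r0 D F G.
  have ik k := intble_cross_der k F (c1s_bd_supported G).
  have iek k := intbleZ (e k) measurableT (ik k).
  have ie := intble_sum (index_enum _) measurableT iek.
  have iaP := intbleD measurableT ia iP.
  have i1 := intbleB measurableT iaP iTdg.
  have i2 := intbleB measurableT i1 ie.
  have i3 := intbleB measurableT i2 i1g.
  have i4 := intbleD measurableT i3 i2g.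
  have -> : \int[leb6]_z ((fht z - ft z) * g z + d z * gt z) =
    \int[leb6]_z (dot (Ad z.1) (gradv f z) * g z + d z * Phi f g z.1 -
      transport A' B' (fun z => d z * g z) z -
      \sum_k e k * (cross_der f k z * g z) -
      d z * dot (Ad z.1) (gradv g z) + d z * dot (cross z.2 (W z.1)) (gradv g z)).
    apply: (Rint_aeeq measurableT _ (intble_meas i4)).
      exact: (measurable_funD (measurable_funM mdt mg) (measurable_funM md mgt)).
    apply: filterS2 dt gte => z dtz gtz _.
    (* The cut-off equals [1] wherever [d] is nonzero, so it disappears from the pairing. *)
    have chid : d z * (Phi f g z.1 * chi z) = d z * Phi f g z.1.
      by case: (chi1 z) => [->|[fz hz]]; rewrite ?mulr1// /d fz hz subrr !mul0r.
    have qE : \sum_k e k * (cross_der f k z * g z) =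
        dot (cross z.2 (W z.1)) (gradv f z) * g z.
      rewrite [X in X * _]dot_cross_combine mulr_suml.
      by apply: eq_bigr => k _; rewrite mulrA.
    exact: (alg_prod dtz gtz (transportM A' B' z D G) qE chid).
  rewrite (RintegralD measurableT i3 i2g) (RintegralB measurableT i2 i1g).
  rewrite (RintegralB measurableT i1 ie) (RintegralB measurableT iaP iTdg).
  rewrite (RintegralD measurableT ia iP).
  have Se : \int[leb6]_z (\sum_k e k * (cross_der f k z * g z)) =
      \sum_k e k * \int[leb6]_z (cross_der f k z * g z).
    rewrite (Rint_sum (index_enum _) measurableT iek); apply: eq_bigr => k _.
    exact: RintegralZl _ measurableT (ik k).
  (* [a = - p] is the adjointness of the potential term and [t = 0] the vanishing transport term;
     only the two remainders [r1] and [r2] are left. *)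
  have fin (a p t s r1 r2 : R) : a = - p -> t = 0 ->
      a + p - t - s - r1 + r2 + s = r2 - r1 by move=> -> ->; ring.
  rewrite [X in `|X|](_ : _ = \int[leb6]_z (d z * dot (cross z.2 (W z.1)) (gradv g z)) -
      \int[leb6]_z (d z * dot (Ad z.1) (gradv g z))); last first.
    by rewrite -Se; exact: fin adj Tdg.
  apply: le_trans (ler_normB _ _) _; rewrite addrC.
  by apply: le_trans (lerD b1g b2g) _; exact: remainders.
Qed.
End EnergyStep.

(** * Test functions on the line *)

Section SmoothFunctions.
Variable R : realType.
Implicit Types (P : {poly R}) (f g : R -> R).

(* The functions [P(1/x) e^(-1/x)], extended by [0], are stable under derivation. *)
Definition flat P (x : R) : R := if 0 < x then P.[x^-1] * expR (- x^-1) else 0.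

(** With [x = t / (n+1)], the inequality [x <= e^x] is raised to the power [n + 1]. *)
Lemma exp_mono_bound n (t : R) : 0 < t -> t ^+ n * expR (- t) <= n.+1%:R ^+ n.+1 / t.
Proof.
move=> t0; rewrite expRN ler_pdivlMr// mulrAC -exprSr ler_pdivrMr ?expR_gt0//.
have -> : t = n.+1%:R * (t / n.+1%:R) by rewrite mulrC divfK.
rewrite exprMn expRM_natl ler_wpM2l ?exprn_ge0// lerXn2r ?nnegrE ?expR_ge0//.
  by rewrite divr_ge0// ltW.
by apply: le_trans (expR_ge1Dx _); rewrite lerDr.
Qed.

Lemma flat_bound P : exists2 C : R, 0 <= C & forall x, 0 < x -> `|flat P x| <= C * x.
Proof.
exists (\sum_(i < size P) `|P`_i| * i.+1%:R ^+ i.+1).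
  by rewrite sumr_ge0// => i _; rewrite mulr_ge0// exprn_ge0.
move=> x x0; rewrite /flat x0 horner_coef mulr_suml mulr_suml.
apply: le_trans (ler_norm_sum _ _ _) _; apply: ler_sum => i _.
rewrite !normrM -!mulrA ler_wpM2l// [`|expR _|]ger0_norm ?expR_ge0//.
rewrite ger0_norm; last by rewrite exprn_ge0// invr_ge0 ltW.
have ix0 : 0 < x^-1 by rewrite invr_gt0.
by have := exp_mono_bound i ix0; rewrite invrK.
Qed.

(** Multiplying the polynomial by [X] trades a factor [1/x] for a factor [x] in front, which
    improves the linear bound to a quadratic one. *)
Lemma flat_bound2 P : exists2 C : R, 0 <= C & forall x, 0 < x -> `|flat P x| <= C * x ^+ 2.
Proof.
have [C C0 CP] := flat_bound (P * 'X); exists C => // x x0.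
have -> : flat P x = flat (P * 'X) x * x.
  by rewrite /flat x0 hornerMX mulrAC divfK// gt_eqF.
by rewrite normrM expr2 mulrA (gtr0_norm x0) (ler_wpM2r (ltW x0))// CP.
Qed.

(** [P(1/x) e^(-1/x)] has derivative [x^(-2) (P(1/x) - P'(1/x)) e^(-1/x)], again of the same
    form. *)
Definition flat_der P : {poly R} := 'X ^+ 2 * (P - P^`()).

Lemma flat_is_derive P (x : R) : is_derive x (1 : R) (flat P) (flat (flat_der P) x).
Proof.
have [x0|x0|->] := ltgtP x 0.
- rewrite /flat [0 < x]ltNge (ltW x0) /=.
  apply: (near_eq_is_derive (f := fun=> 0) _ (is_derive_cst (0 : R) x 1)).
  near=> t; rewrite ltNge ltW//; near: t.
  by apply: (@cvgr_lt _ _ _ _ id x) => //; exact: cvg_id.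
- have xn : x != 0 by rewrite gt_eqF.
  have d1 : is_derive x (1 : R) (fun t : R => t^-1) (- x ^- 2).
    apply: (is_derive_eq (@is_deriveV _ id x _ _ xn (is_derive_id x 1))).
    by rewrite /GRing.scale/= mulr1.
  have d2 : is_derive x (1 : R) (fun t : R => P.[t^-1]) (P^`().[x^-1] * (- x ^- 2)).
    apply: (@is_derive1_comp _ (fun y => P.[y]) (fun t : R => t^-1)).
    by apply: DeriveDef; [exact: derivable_horner|rewrite -derive1E -derivE].
  have d3 : is_derive x (1 : R) (fun t : R => - t^-1) (x ^- 2).
    by have := is_deriveN d1; rewrite opprK.
  have d4 : is_derive x (1 : R) (fun t : R => expR (- t^-1)) (expR (- x^-1) * x ^- 2).
    exact: (@is_derive1_comp _ (@expR R) (fun t : R => - t^-1)).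
  have d5 : is_derive x (1 : R) (fun t : R => P.[t^-1] * expR (- t^-1)) (flat (flat_der P) x).
    apply: (is_derive_eq (is_deriveM d2 d4)).
    by rewrite /flat x0 /flat_der !hornerE /GRing.scale /= -exprVn; ring.
  apply: (near_eq_is_derive _ d5).
  near=> t; rewrite /flat; case: ifPn => //; rewrite -leNgt leNgt => /negP[].
  by near: t; apply: (@cvgr_gt _ _ _ _ id x) => //; exact: cvg_id.
(* At the origin the quadratic bound makes the difference quotients tend to [0]. *)
- have [C C0 CP] := flat_bound2 P.
  rewrite {2}/flat ltxx.
  have f0 : flat P 0 = 0 by rewrite /flat ltxx.
  have C10 : 0 < C + 1 by rewrite ltr_wpDl.
  have H : h^-1 *: ((flat P \o shift 0) (h *: (1 : R)) - flat P 0) @[h --> 0^'] --> (0 : R).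
    rewrite f0; apply/cvgr0Pnorm_le => e e0; near=> h.
    rewrite /= addr0 subr0 [h *: _]mulr1 /GRing.scale /= normrM normfV.
    have h0 : h != 0 by near: h; exact: nbhs_dnbhs_neq.
    have hC : `|h| <= e / (C + 1).
      near: h; apply: dnbhs0_le; exact: divr_gt0.
    have bd : `|flat P h| <= C * h ^+ 2.
      have [hp|hp] := ltP 0 h; first exact: CP.
      by rewrite /flat ltNge hp normr0 mulr_ge0// sqr_ge0.
    rewrite ler_pdivrMl ?normr_gt0//; apply: le_trans bd _.
    rewrite -[h ^+ 2]real_normK ?num_real// expr2 mulrCA ler_wpM2l//.
    apply: le_trans (ler_wpM2l C0 hC) _.
    by rewrite mulrA (ler_pdivrMr _ _ C10) mulrC (ler_wpM2l (ltW e0))// lerDl.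
  split; first by apply/cvg_ex; exists 0.
  exact/cvg_lim.
Unshelve. all: end_near. Qed.

(** A syntactic class closed under derivation: smoothness of every order is obtained by induction on
    the expression, with no formula for the higher derivatives. *)
Inductive smooth_alg : (R -> R) -> Prop :=
| smooth_flat P s a : smooth_alg (fun x => flat P (s * x + a))
| smooth_cst c : smooth_alg (fun=> c)
| smooth_add f g : smooth_alg f -> smooth_alg g -> smooth_alg (fun x => f x + g x)
| smooth_mul f g : smooth_alg f -> smooth_alg g -> smooth_alg (fun x => f x * g x)
| smooth_inv f : smooth_alg f -> (forall x, f x != 0) -> smooth_alg (fun x => (f x)^-1).

Lemma smooth_alg_derive f : smooth_alg f ->
  exists2 f', smooth_alg f' & forall x : R, is_derive x (1 : R) f (f' x).
Proof.
elim=> {f} [P s a|c|f g sf [f' sf' df] sg [g' sg' dg]|f g sf [f' sf' df] sg [g' sg' dg]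
  |f sf [f' sf' df] f0].
- exists (fun x => flat (flat_der P) (s * x + a) * s).
    by apply: smooth_mul; [exact: smooth_flat|exact: smooth_cst].
  move=> x; have d1 : is_derive x (1 : R) (fun x : R => s * x + a) s.
    by apply: is_derive_eq; rewrite addr0 /GRing.scale /= mulr1.
  exact: (@is_derive1_comp _ (flat P) (fun x : R => s * x + a) x _ _ (flat_is_derive _ _) d1).
- by exists (fun=> 0); [exact: smooth_cst|move=> x; exact: is_derive_cst].
- by exists (fun x => f' x + g' x); [exact: smooth_add|move=> x; exact: is_deriveD].
- exists (fun x => f x * g' x + g x * f' x).
    by apply: smooth_add; apply: smooth_mul.
  by move=> x; exact: is_deriveM.
- exists (fun x => -1 * ((f x)^-1 * (f x)^-1) * f' x).
    apply: smooth_mul => //; apply: smooth_mul; first exact: smooth_cst.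
    by apply: smooth_mul; exact: smooth_inv.
  move=> x; apply: (is_derive_eq (is_deriveV (f0 x) (df x))).
  by rewrite /GRing.scale /= mulN1r expr2 invfM.
Qed.

(** [F n] is the [n]-th derivative of [F 0], so iterated partial derivatives can be read off the
    sequence. *)
Definition smooth_seq (F : nat -> R -> R) :=
  forall n (x : R), is_derive x (1 : R) (F n) (F n.+1 x).

Lemma smooth_alg_seq f : smooth_alg f -> exists2 F, F 0%N = f & smooth_seq F.
Proof.
move=> sf.
have /choice[D DP] : forall f : {f | smooth_alg f}, exists g : {f | smooth_alg f},
    forall x : R, is_derive x (1 : R) (sval f) (sval g x).
  by move=> [g sg]; have [g' sg' dg] := smooth_alg_derive sg; exists (exist _ g' sg').
exists (fun n => sval (iter n D (exist _ f sf))) => // n x.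
Qed.
End SmoothFunctions.

(** * Dominated convergence for real-valued integrals *)

Section DominatedConvergence.
Context d (T : measurableType d) (R : realType) (mu : {measure set T -> \bar R}).

Lemma Rint_dominated D (h : nat -> T -> R) (f g : T -> R) : measurable D ->
  (forall n, measurable_fun D (h n)) -> (forall x, D x -> h n x @[n --> \oo] --> f x) ->
  intble mu D g -> (forall n x, D x -> `|h n x| <= g x) ->
  \int[mu]_(x in D) h n x @[n --> \oo] --> \int[mu]_(x in D) f x.
Proof.
move=> mD mh hf gi hg.
have fi : intble mu D f.
  apply: (intble_le mD (measurable_fun_cvg mh hf) _ gi) => x Dx.
  by apply: (cvgr_to_le (cvg_norm (hf _ Dx))); apply: nearW => n; exact: hg.
have : (\int[mu]_(x in D) (h n x)%:E)%E @[n --> \oo] --> (\int[mu]_(x in D) (f x)%:E)%E.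
  apply: (@dominated_cvg _ _ _ mu D mD (fun n x => (h n x)%:E) _ (fun x => (g x)%:E)) => //.
  - by move=> n; exact/measurable_EFinP.
  - by move=> x Dx; apply: cvg_EFin; [exact: nearW|exact: hf].
rewrite /Rintegral -[X in _ --> X -> _]fineK; last exact: (integrable_fin_num mD fi).
by move/fine_cvg.
Qed.
End DominatedConvergence.

(** * A smooth step function *)

Section SmoothStep.
Variable R : realType.
Implicit Types (f g : R -> R).
Local Notation mu := (@lebesgue_measure R).

Lemma smooth_alg_affine f c a : smooth_alg f -> smooth_alg (fun x => f (c * x + a)).
Proof.
elim=> {f} [P s b|k|f g _ sf _ sg|f g _ sf _ sg|f _ sf f0].
- rewrite (_ : (fun _ => _) = fun x => flat P ((s * c) * x + (s * a + b))).
    exact: smooth_flat.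
  by apply/funext => x; rewrite mulrDr mulrA addrA.
- exact: smooth_cst.
- exact: smooth_add.
- exact: smooth_mul.
- exact: smooth_inv.
Qed.

Lemma smooth_seq_continuous F n : smooth_seq F -> continuous (F n : R -> R).
Proof.
by move=> sF x; apply/differentiable_continuous/derivable1_diffP; case: (sF n x).
Qed.

Lemma Rint_derive f f' (a b : R) : (forall x : R, is_derive x (1 : R) f (f' x)) ->
  continuous f' -> a < b -> \int[mu]_(x in `[a, b]) f' x = f b - f a.
Proof.
move=> df cf' ab.
have cf : continuous f.
  by move=> x; apply/differentiable_continuous/derivable1_diffP; case: (df x).
rewrite /Rintegral (@continuous_FTC2 _ _ f)//.
- exact: continuous_subspaceT.
- split; first by move=> x _; case: (df x).
  + exact/cvg_at_right_filter/cf.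
  + exact/cvg_at_left_filter/cf.
- by move=> x _; rewrite derive1E; have [_ ->] := df x.
Qed.

Lemma partial_smooth F s : smooth_seq F -> partial (@basis1 R) s (F 0%N) = F (size s).
Proof.
move=> sF; elim: s => //= i s IH; rewrite -/(partial _ s _) IH.
by apply/funext => x; have [_ <-] := sF (size s) x.
Qed.

Lemma smooth_alg_test f (Om A : set (measurableTypeR R)) : smooth_alg f -> compact A ->
  A `<=` Om -> (forall x, ~ A x -> f x = 0) -> test_function (@basis1 R) Om f.
Proof.
move=> /smooth_alg_seq[F <- sF] cA AOm f0.
have fA : tsupport (F 0%N : measurableTypeR R -> R) `<=` A.
  rewrite /tsupport [X in _ `<=` X](closure_id A).1; last first.
    exact: (compact_closed (@Rhausdorff R) cA).
  by apply: closure_subset => x /= /eqP; apply: contra_notP => /f0.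
split.
- move=> k; split=> [s i x _|s _].
    by rewrite partial_smooth//; case: (sF (size s) x).
  by rewrite partial_smooth// => x; exact: (@smooth_seq_continuous F (size s) sF).
- by apply: (subclosed_compact _ cA fA); exact: closed_closure.
- exact: subset_trans AOm.
Qed.

(** The usual smooth transition from [0] on the negative half-line to [1] on [[1, +oo[]; the
    denominator never vanishes, as [y] or [1 - y] is positive. *)
Definition step (y : R) := flat 1 y * (flat 1 y + flat 1 (1 - y))^-1.

Let flat_ge0 (y : R) : 0 <= flat 1 y.
Proof. by rewrite /flat; case: ifP => // y0; rewrite hornerC mul1r expR_ge0. Qed.

Let flat_gt0 (y : R) : 0 < y -> 0 < flat 1 y.
Proof. by move=> y0; rewrite /flat y0 hornerC mul1r expR_gt0. Qed.

Let flat_le0 (y : R) : y <= 0 -> flat 1 y = 0.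
Proof. by move=> y0; rewrite /flat ltNge y0. Qed.

Let den_gt0 (y : R) : 0 < flat 1 y + flat 1 (1 - y).
Proof.
have [y0|y0] := ltP 0 y; first by rewrite ltr_pwDl// flat_gt0.
by rewrite ltr_wpDl// flat_gt0// subr_gt0 (le_lt_trans y0).
Qed.

Lemma step_smooth : smooth_alg step.
Proof.
have fE : flat 1 = (fun y : R => flat 1 (1 * y + 0)).
  by apply/funext => y; rewrite mul1r addr0.
have sf : smooth_alg (fun y : R => flat 1 y) by rewrite fE; exact: smooth_flat.
apply: smooth_mul => //; apply: smooth_inv => [|x]; last by rewrite gt_eqF.
apply: smooth_add => //; rewrite (_ : (fun _ => _) = fun x : R => flat 1 (-1 * x + 1)).
  exact: smooth_flat.
by apply/funext => x; rewrite mulN1r addrC.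
Qed.

Lemma step_le0 (y : R) : y <= 0 -> step y = 0.
Proof. by move=> y0; rewrite /step flat_le0// mul0r. Qed.

Lemma step_ge1 (y : R) : 1 <= y -> step y = 1.
Proof.
move=> y1; rewrite /step (@flat_le0 (1 - y)) ?subr_le0// addr0 divff// gt_eqF//.
by rewrite flat_gt0// (lt_le_trans ltr01).
Qed.

Lemma step_01 (y : R) : 0 <= step y <= 1.
Proof.
rewrite /step divr_ge0//=; last exact: ltW.
by rewrite ler_pdivrMr// mul1r lerDl.
Qed.
End SmoothStep.

(** * Weak derivatives in time *)

Section DeltaSequence.
Variable R : realType.
Implicit Types (F G : R -> R).
Local Notation mu := (@lebesgue_measure R).

Lemma meas_itv (i : interval R) : measurable ([set` i] : set (measurableTypeR R)).
Proof. exact: measurable_itv. Qed.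

Lemma cont_meas1 (f : R -> R) : continuous f ->
  measurable_fun setT (f : measurableTypeR R -> R).
Proof. exact: continuous_measurable_fun. Qed.

Lemma mu_itv_cc (a b : R) : a <= b -> mu `[a, b]%classic = (b - a)%:E.
Proof. by move=> ab; rewrite lebesgue_measure_itv/= lte_fin; case: ltgtP ab => // -> _; rewrite subrr. Qed.

Lemma mu_oo_lty (a b : R) : (mu `]a, b[%classic < +oo)%E.
Proof. by rewrite lebesgue_measure_itv/= ; case: ifP => _; rewrite ?ltry// -EFinB ltry. Qed.

Lemma mu_cc_lty (a b : R) : (mu `[a, b]%classic < +oo)%E.
Proof. by rewrite lebesgue_measure_itv/= ; case: ifP => _; rewrite ?ltry// -EFinB ltry. Qed.

Let scale_eq (e C k : R) : k != 0 -> 2 * C + 1 != 0 ->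
  e / (2 * C + 1) * (C * k) * (2 * k^-1) = e * (2 * C / (2 * C + 1)).
Proof. by move=> k0 C0; field; rewrite k0 C0. Qed.

(** [D n] lives within [1/(n+1)] of [s] and is at most [C (n+1)], so its absolute integral is at
    most [2 C]; continuity of [F] at [s] allows [F] to be replaced there by its value [F s]. *)
Lemma delta_seq (T s C c : R) F (D : nat -> R -> R) : 0 < s < T -> 0 <= C ->
  intble mu `]0, T[%classic F -> {for s, continuous F} ->
  (forall n, measurable_fun setT (D n : measurableTypeR R -> R)) ->
  (forall n x, `|D n x| <= C * n.+1%:R) ->
  (forall n x, n.+1%:R^-1 < `|x - s| -> D n x = 0) ->
  (\forall n \near \oo, \int[mu]_(x in `]0, T[) D n x = c) ->
  \int[mu]_(x in `]0, T[) (F x * D n x) @[n --> \oo] --> F s * c.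
Proof.
move=> /andP[s0 sT] C0 Fi cF mD DC D0 Dc.
have Di n : intble mu `]0, T[%classic (D n).
  apply: (intble_le (meas_itv _) _ _ (@intble_cst _ _ _ mu _ (C * n.+1%:R) (meas_itv _) _)) => //.
  - exact: measurable_funS (mD n).
  - exact: mu_oo_lty.
have FDi n : intble mu `]0, T[%classic (fun x => F x * D n x).
  apply: intble_ext (intble_mul_bd (meas_itv _) _ (fun x _ => DC n x) Fi) => [x|].
    by rewrite mulrC.
  exact: measurable_funS (mD n).
apply/cvgrPdist_le => e e0.
(* The division by [2 C + 1] absorbs the bound [2 C] of the absolute integrals; the [+ 1] avoids
   division by zero. *)
pose e' := e / (2 * C + 1).
have C1 : 0 < 2 * C + 1 by rewrite ltr_wpDl// mulr_ge0.
have e'0 : 0 < e' by rewrite divr_gt0.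
have [d d0 dP] : exists2 d : R, 0 < d & forall x, `|x - s| < d -> `|F s - F x| <= e'.
  have /cvgrPdist_le/(_ _ e'0)/nbhs_ballP[d /= d0 dP] := cF.
  by exists d => // y ys; apply: dP; rewrite /ball /= distrC.
have sT' : 0 < T - s by rewrite subr_gt0.
near=> n.
have nc : \int[mu]_(x in `]0, T[) D n x = c by near: n.
have kd : n.+1%:R^-1 < d by near: n; exact: (near_infty_natSinv_lt (PosNum d0)).
have ks : n.+1%:R^-1 < s by near: n; exact: (near_infty_natSinv_lt (PosNum s0)).
have kT : n.+1%:R^-1 < T - s.
  by near: n; exact: (near_infty_natSinv_lt (PosNum sT')).
pose k : R := n.+1%:R^-1; have k0 : 0 < k by rewrite invr_gt0.
have {}ks : k < s by []; have {}kT : k < T - s by [].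
have Fe x : `|x - s| <= k -> `|F s - F x| <= e' by move=> /le_lt_trans/(_ kd)/dP.
have -> : F s * c - \int[mu]_(x in `]0, T[) (F x * D n x) =
    \int[mu]_(x in `]0, T[) ((F s - F x) * D n x).
  rewrite -nc -(RintegralZl _ (meas_itv _) (Di n)) -RintegralB//.
  - by apply: eq_Rintegral => x _; rewrite mulrBl.
  - exact: intbleZ.
  - exact: FDi.
pose J : set (measurableTypeR R) := [set` `[s - k, s + k]].
have Jx x : x \in J = (`|x - s| <= k).
  by rewrite /J mem_setE in_itv/= ler_distl; congr (_ && _).
have Ji : intble mu `]0, T[%classic (fun x => \1_J x * (e' * (C * n.+1%:R))).
  apply: (intble_sub (measurableT) (meas_itv _) _) => //.
  have mJ : measurable J by exact: meas_itv.
  apply: (@intble_indicM _ _ _ mu J (fun=> e' * (C * n.+1%:R)) mJ).1.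
  by apply: (intble_cst _ mJ); exact: mu_cc_lty.
apply: le_trans (Rint_norm_le (meas_itv _) _ Ji _) _.
- apply: intble_meas.
  apply: intble_ext (intbleB (meas_itv _) (intbleZ (F s) (meas_itv _) (Di n)) (FDi n)) => x.
  by rewrite mulrBl.
- apply: aeW => x _; rewrite indicE Jx normrM.
  have [xk|kx] := leP `|(x : R) - s| k; last by rewrite D0// normr0 mulr0 mul0r.
  by rewrite mul1r ler_pM// Fe.
rewrite Rint_supp; last first.
  move=> x nx; rewrite indicE Jx; case: (leP `|(x : R) - s| k) => [|_]; last by rewrite mul0r.
  by rewrite ler_distl => /andP[xl xr]; exfalso; apply: nx; rewrite /= in_itv/=; lra.
rewrite -Rint_indicM Rintegral_cst//; last exact: meas_itv.
have ss : s - k <= s + k by lra.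
rewrite (_ : fine _ = 2 * k); last first.
  by apply: (etrans (congr1 fine (mu_itv_cc ss))) => /=; ring.
rewrite (scale_eq e (C := C) (k := n.+1%:R))// ?gt_eqF//.
rewrite -[leRHS]mulr1 (ler_wpM2l (ltW e0))// ler_pdivrMr// mul1r lerDl//.
Unshelve. all: end_near. Qed.
Lemma Rint_oo_cc (a b : R) F : intble mu `[a, b]%classic F ->
  \int[mu]_(x in `]a, b[) F x = \int[mu]_(x in `[a, b]) F x.
Proof.
move=> Fi; rewrite Rintegral_itv_obnd_cbnd.
  apply: Rintegral_itv_bndo_bndc.
  apply: (intble_sub (meas_itv _) (meas_itv _) _ Fi) => x.
  by rewrite /= !in_itv/= => /andP[-> /ltW].
apply: (intble_sub (meas_itv _) (meas_itv _) _ Fi) => x.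
by rewrite /= !in_itv/= => /andP[/ltW-> /ltW].
Qed.

Lemma intble_cont (a b : R) F : continuous F -> intble mu `[a, b]%classic F.
Proof.
move=> cF; apply: continuous_compact_integrable; first exact: segment_compact.
exact: continuous_subspaceT.
Qed.

Lemma step_derivative : exists F1 : R -> R, exists C : R,
  [/\ forall y : R, is_derive y (1 : R) (@step R) (F1 y), continuous F1,
    0 <= C, forall y, `|F1 y| <= C & forall y, 1 < `|y| -> F1 y = 0].
Proof.
have [F F0 sF] := smooth_alg_seq (@step_smooth R).
have dF y : is_derive y (1 : R) (@step R) (F 1%N y) by rewrite -F0; exact: sF.
have cF : continuous (F 1%N) := @smooth_seq_continuous R F 1%N sF.
have F10 y : 1 < `|y| -> F 1%N y = 0.
  move=> y1; have [_ <-] := dF y.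
  have [y0|y0] := leP y 0.
    rewrite ler0_norm// in y1.
    rewrite (@near_eq_derive _ _ _ _ (cst (0 : R))) ?derive_cst//.
    near=> z; rewrite /cst step_le0//; apply: ltW; near: z.
    apply: (@cvgr_lt _ _ _ _ id y); [exact: cvg_id|lra].
  rewrite gtr0_norm// in y1.
  rewrite (@near_eq_derive _ _ _ _ (cst (1 : R))) ?derive_cst//.
  near=> z; rewrite /cst step_ge1//; apply: ltW; near: z.
  by apply: (@cvgr_gt _ _ _ _ id y) => //; exact: cvg_id.
have [c _ cP] := @EVT_max R (fun y => `|F 1%N y|) (-1) 1 (ltW (gtrN ltr01))
  (continuous_subspaceT (fun y => continuous_comp (cF y) (@norm_continuous _ _ _))).
exists (F 1%N), `|F 1%N c|; split=> // y.
have [y1|y1] := leP `|y| 1; last by rewrite F10// normr0.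
by apply: cP; rewrite in_itv/= -ler_norml.
Unshelve. all: end_near. Qed.

End DeltaSequence.

Section WeakDerivative.
Variable R : realType.
Implicit Types (F G : R -> R).
Local Notation mu := (@lebesgue_measure R).

Let two_steps (p q : R) : 0 <= p <= 1 -> 0 <= q <= 1 -> `|p + q + - 1| <= 1.
Proof. by move=> /andP[? ?] /andP[? ?]; rewrite ler_norml; apply/andP; split; lra. Qed.

(* The test functions [step (n (x - s)) + step (n (t - x)) - 1] tend to the *)
(* indicator of [s, t], while the two terms of their derivatives form delta *)
(* sequences at [s] and [t].                                                *)
Lemma weak_derivative_increment (T s t : R) F G : 0 < s -> s < t -> t < T ->
  weak_partial mu (@basis1 R) `]0, T[%classic [:: ord0] F G ->
  intble mu `]0, T[%classic F -> intble mu `]0, T[%classic G ->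
  {for s, continuous F} -> {for t, continuous F} ->
  F t - F s = \int[mu]_(x in `[s, t]) G x.
Proof.
move=> s0 st tT [_ _ wFG] Fi Gi cs ct.
have [F1 [C [dF1 cF1 C0 F1C F10]]] := step_derivative R.
pose f1 n x : R := step (n.+1%:R * x + - (n.+1%:R * s)).
pose f2 n x : R := step (- n.+1%:R * x + n.+1%:R * t).
pose D1 n x : R := n.+1%:R * F1 (n.+1%:R * x + - (n.+1%:R * s)).
pose D2 n x : R := - n.+1%:R * F1 (- n.+1%:R * x + n.+1%:R * t).
have daff (c a x : R) : is_derive x (1 : R) (fun x : R => step (c * x + a)) (c * F1 (c * x + a)).
  have d1 : is_derive x (1 : R) (fun x : R => c * x + a) c.
    by apply: is_derive_eq; rewrite addr0 /GRing.scale /= mulr1.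
  rewrite mulrC.
  exact: (@is_derive1_comp _ (@step R) (fun x : R => c * x + a) x _ _ (dF1 _) d1).
have caff (c a : R) : continuous (fun x : R => c * F1 (c * x + a)).
  move=> x; apply: cvgM; first exact: cvg_cst.
  apply: (continuous_comp (f := fun x => c * x + a)); last exact: cF1.
  by apply: cvgD; [apply: cvgM; [exact: cvg_cst|exact: cvg_id]|exact: cvg_cst].
have d1 n x : is_derive x (1 : R) (f1 n) (D1 n x) by exact: daff.
have d2 n x : is_derive x (1 : R) (f2 n) (D2 n x) by exact: daff.
have c1 n : continuous (D1 n) by exact: caff.
have c2 n : continuous (D2 n) by exact: caff.
have nn (n : nat) : 0 < n.+1%:R :> R by [].
have big (e : R) : 0 < e -> \forall n \near \oo, 1 < n.+1%:R * e.
  move=> e0; near=> n; rewrite mulrC -ltr_pdivrMr// div1r.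
  by near: n; exact: (near_infty_natSinv_lt (PosNum e0)).
have sT : 0 < T - s by rewrite subr_gt0 (lt_trans st tT).
have st' : 0 < t - s by rewrite subr_gt0.
have T0 : 0 < T by exact: lt_trans s0 (lt_trans st tT).
have E2 (n : nat) (x : R) : - n.+1%:R * x + n.+1%:R * t = n.+1%:R * (t - x).
  by rewrite mulNr addrC -mulrBr.
have int1 : \forall n \near \oo, \int[mu]_(x in `]0, T[) D1 n x = 1.
  near=> n.
  have a1 : 1 < n.+1%:R * (T - s) by near: n; exact: big.
  rewrite (Rint_oo_cc (intble_cont _ _ (c1 n))) (Rint_derive (d1 n) (c1 n) T0).
  rewrite /f1 step_ge1 -?mulrBr ?(ltW a1)// step_le0 ?subr0//.
  by rewrite sub0r mulrN oppr_le0 mulr_ge0// ltW.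
have int2 : \forall n \near \oo, \int[mu]_(x in `]0, T[) D2 n x = -1.
  have t0 : 0 < t by exact: lt_trans s0 st.
  near=> n.
  have a1 : 1 < n.+1%:R * t by near: n; exact: big.
  rewrite (Rint_oo_cc (intble_cont _ _ (c2 n))) (Rint_derive (d2 n) (c2 n) T0).
  rewrite /f2 mulr0 add0r (step_ge1 (ltW a1)) step_le0 ?sub0r//.
  by rewrite mulNr addrC -mulrBr mulr_ge0_le0// subr_le0 ltW.
have C0' n x : `|D1 n x| <= C * n.+1%:R.
  by rewrite normrM mulrC (ger0_norm (ltW (nn n))) ler_wpM2r.
have C0'' n x : `|D2 n x| <= C * n.+1%:R.
  by rewrite normrM mulrC normrN (ger0_norm (ltW (nn n))) ler_wpM2r.
have out (n : nat) (x y : R) : n.+1%:R^-1 < `|x - y| -> 1 < `|n.+1%:R * (x - y)|.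
  by move=> xy; rewrite normrM ger0_norm// mulrC -ltr_pdivrMr// div1r.
have lim1 : \int[mu]_(x in `]0, T[) (F x * D1 n x) @[n --> \oo] --> F s * 1.
  apply: (delta_seq _ C0 Fi cs _ C0' _ int1); first by rewrite s0 (lt_trans st tT).
    by move=> n; exact: cont_meas1.
  by move=> n x xs; rewrite /D1 -mulrBr F10 ?mulr0// out.
have lim2 : \int[mu]_(x in `]0, T[) (F x * D2 n x) @[n --> \oo] --> F t * -1.
  apply: (delta_seq _ C0 Fi ct _ C0'' _ int2); first by rewrite (lt_trans s0 st).
    by move=> n; exact: cont_meas1.
  by move=> n x xs; rewrite /D2 E2 F10 ?mulr0// out// distrC.
pose phi n x := f1 n x + f2 n x + - 1.
have phi_test n : 1 < n.+1%:R * (t - s) ->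
    test_function (@basis1 R) `]0, T[%classic (phi n).
  move=> nts; apply: (@smooth_alg_test R (phi n) _ `[s, t]%classic).
  - apply: smooth_add; last exact: smooth_cst.
    by apply: smooth_add; apply: smooth_alg_affine; exact: step_smooth.
  - exact: segment_compact.
  - by move=> x; rewrite /= !in_itv/= => /andP[sx xt]; rewrite (lt_le_trans s0 sx) (le_lt_trans xt tT).
  - move=> x /= /negP; rewrite in_itv/= negb_and -!ltNge => xst.
    rewrite /phi /f1 /f2 E2 -mulrBr.
    case/orP: xst => xst.
      rewrite step_le0 ?(@step_ge1 _ (_ * (t - x))) ?add0r ?subrr//.
        by apply: le_trans (ltW nts) _; rewrite ler_pM2l// lerD2l lerN2 ltW.
      by rewrite mulr_ge0_le0// subr_le0 ltW.
    rewrite (@step_ge1 _ (_ * (x - s))) ?step_le0 ?addr0 ?subrr//.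
      by rewrite mulr_ge0_le0// subr_le0 ltW.
    by apply: le_trans (ltW nts) _; rewrite ler_pM2l// lerD2r ltW.
have phi_der n x : partial (@basis1 R) [:: ord0] (phi n) x = D1 n x + D2 n x.
  have d3 : is_derive x (1 : R) (phi n) (D1 n x + D2 n x).
    by have := is_deriveD (is_deriveD (d1 n x) (d2 n x)) (is_derive_cst (-1 : R) x 1); rewrite addr0.
  by have [_ <-] := d3.
have ibd (D : nat -> R -> R) n : continuous (D n) -> (forall x, `|D n x| <= C * n.+1%:R) ->
    intble mu `]0, T[%classic (fun x => F x * D n x).
  move=> cD DC; apply: intble_ext (intble_mul_bd (meas_itv _) _ (fun x _ => DC x) Fi) => [x|].
    by rewrite mulrC.
  exact: measurable_funS (cont_meas1 cD).
have eqn : \forall n \near \oo, \int[mu]_(x in `]0, T[) (F x * D1 n x) +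
    \int[mu]_(x in `]0, T[) (F x * D2 n x) = - \int[mu]_(x in `]0, T[) (G x * phi n x).
  near=> n.
  have nts : 1 < n.+1%:R * (t - s) by near: n; exact: big.
  have := wFG _ (phi_test n nts); rewrite expr1 mulN1r => <-.
  rewrite -(RintegralD (meas_itv _) (ibd _ n (c1 n) (C0' n)) (ibd _ n (c2 n) (C0'' n))).
  by apply: eq_Rintegral => x _; rewrite phi_der mulrDr.
have cf n : continuous (phi n).
  move=> x; apply: cvgD; last exact: cvg_cst.
  by apply: cvgD; apply/differentiable_continuous/derivable1_diffP; [case: (d1 n x)|case: (d2 n x)].
(* At every single point the test functions are eventually equal to the indicator, and they stay
   bounded by [1]; dominated convergence applies. *)
have lim3 : \int[mu]_(x in `]0, T[) (G x * phi n x) @[n --> \oo] -->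
    \int[mu]_(x in `]0, T[) (G x * \1_(`]s, t[%classic) x).
  apply: (Rint_dominated (meas_itv _) _ _ (intble_norm Gi)).
  - move=> n; apply: measurable_funM; first exact: intble_meas Gi.
    exact: measurable_funS (cont_meas1 (cf n)).
  - move=> x _; apply: cvgM; first exact: cvg_cst.
    apply: cvg_near_cst; rewrite indicE mem_setE in_itv/=.
    have [sx|xs] := ltP s x; have [xt|tx] := ltP x t => /=.
    + have sx' : 0 < x - s by rewrite subr_gt0.
      have xt' : 0 < t - x by rewrite subr_gt0.
      by near=> n; rewrite /phi /f1 /f2 E2 -mulrBr !step_ge1 ?addrK//; apply: ltW; near: n; exact: big.
    + have sx' : 0 < x - s by rewrite subr_gt0.
      near=> n; rewrite /phi /f1 /f2 E2 -mulrBr step_ge1 ?step_le0 ?addr0 ?subrr//.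
        by rewrite mulr_ge0_le0// subr_le0.
      by apply: ltW; near: n; exact: big.
    + have sx' : 0 < t - x by rewrite subr_gt0.
      near=> n; rewrite /phi /f1 /f2 E2 -mulrBr step_le0 ?step_ge1 ?add0r ?subrr//.
        by apply: ltW; near: n; exact: big.
      by rewrite mulr_ge0_le0// subr_le0.
    + by have := lt_le_trans st (le_trans tx xs); rewrite ltxx.
  - move=> n x _; rewrite normrM -[leRHS]mulr1 ler_wpM2l//.
    by apply: two_steps; exact: step_01.
have E : F s * 1 + F t * -1 = - \int[mu]_(x in `]0, T[) (G x * \1_(`]s, t[%classic) x).
  apply: (@cvg_unique _ (@Rhausdorff R) _ _ _ _ (cvgD lim1 lim2)).
  apply: (cvg_trans _ (cvgN lim3)); apply: near_eq_cvg.
  by apply: filterS eqn => n e; exact/esym.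
rewrite [F s * 1]mulr1 mulrN1 in E.
rewrite -opprB E opprK Rint_supp; last first.
  move=> x /negP; rewrite in_itv/= negb_and -!leNgt indicE mem_setE in_itv/= => xT.
  case: andP; rewrite ?mulr0// => -[sx xt]; case/orP: xT => xT.
    by have := lt_trans s0 sx; rewrite ltNge xT.
  by have := lt_trans xt tT; rewrite ltNge xT.
under eq_Rintegral do rewrite mulrC.
rewrite -Rint_indicM Rint_oo_cc//.
apply: (intble_sub (meas_itv _) (meas_itv _) _ Gi) => x.
by rewrite /= !in_itv/= => /andP[sx xt]; rewrite (lt_le_trans s0 sx) (le_lt_trans xt tT).
Unshelve. all: end_near. Qed.
End WeakDerivative.

(** * Primitives of integrable functions *)

Section AbsolutelyContinuous.
Variable R : realType.
Implicit Types (F G f g : R -> R).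
Local Notation mu := (@lebesgue_measure R).

(** By the increment formula, [F] minus the primitive of [G] is constant on the open interval; both
    are continuous up to the ends, so the constant is the same there. *)
Lemma weak_derivative_primitive (T : R) F G : 0 < T ->
  weak_partial mu (@basis1 R) `]0, T[%classic [:: ord0] F G ->
  {within `[0, T], continuous F} -> intble mu `[0, T]%classic G ->
  forall t, 0 <= t <= T -> F t = F 0 + \int[mu]_(x in `[0, t]) G x.
Proof.
move=> T0 wFG cF Gi.
pose I t := \int[mu]_(x in `[0, t]) G x.
have cI : {within `[0, T], continuous I} by apply: parameterized_integral_continuous (ltW T0) Gi.
pose H t := F t - I t.
have Fi : intble mu `[0, T]%classic F.
  by apply: continuous_compact_integrable => //; exact: segment_compact.
have oocc : `]0, T[%classic `<=` (`[0, T]%classic : set R).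
  by move=> x; rewrite /= !in_itv/= => /andP[/ltW -> /ltW ->].
have /(continuous_within_itvP _ T0)[cFo cF0 cFT] := cF.
have /(continuous_within_itvP _ T0)[_ cI0 cIT] := cI.
have I0 : I 0 = 0 by rewrite /I set_itv1 Rintegral_set1.
have Hst s t : 0 < s -> s < t -> t < T -> H s = H t.
  move=> s0 st tT.
  have := @weak_derivative_increment R T s t F G s0 st tT wFG
    (intble_sub (meas_itv _) (meas_itv _) oocc Fi) (intble_sub (meas_itv _) (meas_itv _) oocc Gi)
    (cFo s _) (cFo t _).
  rewrite !in_itv/= s0 tT (lt_trans s0 st) (lt_trans st tT) => /(_ isT isT) Fst.
  have : I t - I s = \int[mu]_(x in `]s, t]) G x.
    apply: Rintegral_itvB; rewrite ?bnd_simp ?ltW//.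
    apply: (intble_sub (meas_itv _) (meas_itv _) _ Gi) => x.
    by rewrite /= !in_itv/= => /andP[-> /le_trans->//]; rewrite ltW.
  rewrite Rintegral_itv_obnd_cbnd; last first.
    apply: (intble_sub (meas_itv _) (meas_itv _) _ Gi) => x.
    by rewrite /= !in_itv/= => /andP[sx xt]; apply/andP; split; lra.
  by rewrite -Fst /H; lra.
pose c := H (T / 2).
have Hc t : 0 < t -> t < T -> H t = c.
  move=> t0 tT; have [tT2|Tt|->//] := ltgtP t (T / 2).
    by apply: Hst => //; lra.
  by apply/esym/Hst => //; lra.
have H0 : H 0 = c.
  apply: (@cvg_unique _ (@Rhausdorff R) _ _ _ _ (cvgB cF0 cI0)).
  apply: cvg_near_cst; near=> t; apply: Hc.
    by near: t; exact: nbhs_right_gt.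
  by near: t; exact: nbhs_right_lt.
have HT : H T = c.
  apply: (@cvg_unique _ (@Rhausdorff R) _ _ _ _ (cvgB cFT cIT)).
  apply: cvg_near_cst; near=> t; apply: Hc.
    by near: t; exact: nbhs_left_gt.
  by near: t; exact: nbhs_left_lt.
move=> t /andP[t0 tT].
suff : H t = H 0 by rewrite /H I0 subr0 => /eqP; rewrite subr_eq => /eqP.
rewrite H0; move: t0 tT; rewrite le_eqVlt => /predU1P[<-//|t0].
by rewrite le_eqVlt => /predU1P[->//|tT]; exact: Hc.
Unshelve. all: end_near. Qed.

(** The plane is cut into [r <= s] and [s < r], and the product [f(s) g(r)] is integrated over each
    part by Fubini. The open rays met in the second part are closed afterwards, at the cost of one
    null point each. *)
Lemma Rint_triangle f g : intble mu setT f -> intble mu setT g ->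
  [/\ intble mu setT (fun s => f s * \int[mu]_(r in `]-oo, s]) g r),
    intble mu setT (fun r => g r * \int[mu]_(s in `]-oo, r]) f s) &
  \int[mu]_s (f s * \int[mu]_(r in `]-oo, s]) g r) +
  \int[mu]_r (g r * \int[mu]_(s in `]-oo, r]) f s) = (\int[mu]_s f s) * \int[mu]_r g r].
Proof.
move=> fi gi.
have mle : measurable [set p : measurableTypeR R * measurableTypeR R | p.2 <= p.1].
  rewrite (_ : [set _ | _] = (fun p : measurableTypeR R * measurableTypeR R => p.2 <= p.1) @^-1` [set true]).
    by rewrite -[X in measurable X]setTI; apply: measurable_fun_ler => //; exact: measurableT.
  by apply/seteqP; split=> p /=.
pose L := [set p : measurableTypeR R * measurableTypeR R | p.2 <= p.1].
pose K1 p := \1_L p * (f p.1 * g p.2).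
pose K2 p := (1 - \1_L p) * (f p.1 * g p.2).
have Ki := intble_tensor fi gi.
have mI : measurable_fun setT (\1_L : measurableTypeR R * measurableTypeR R -> R).
  exact: measurable_indic.
have K1i : intble (mu \x mu)%E setT K1.
  apply: (intble_mul_bd (C := 1) measurableT mI _ Ki) => p _.
  by rewrite indicE; case: (_ \in _); rewrite ?normr1 ?normr0.
have K2i : intble (mu \x mu)%E setT K2.
  apply: (intble_mul_bd (C := 1) measurableT _ _ Ki) => [|p _].
    by apply: measurable_funB => //; exact: measurable_cst.
  by rewrite indicE; case: (_ \in _); rewrite ?subrr ?subr0 ?normr1 ?normr0.
have LE s r : \1_L (s, r) = \1_(`]-oo, s]%classic : set R) r :> R.
  by rewrite !indicE; congr (_%:R); apply/idP/idP; rewrite !inE /= in_itv.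
have E1 s : \int[mu]_r K1 (s, r) = f s * \int[mu]_(r in `]-oo, s]) g r.
  have gs : intble mu `]-oo, s]%classic g by apply: (intble_sub measurableT (meas_itv _) _ gi).
  rewrite [in RHS]Rint_indicM -RintegralZl//.
    by apply: eq_Rintegral => r _; rewrite /K1 LE mulrCA.
  exact: ((intble_indicM _ _ (meas_itv _)).1 gs).
have E2 r : \int[mu]_s K2 (s, r) = g r * \int[mu]_(s in `]-oo, r]) f s.
  have fr : intble mu `]-oo, r[%classic f by apply: (intble_sub measurableT (meas_itv _) _ fi).
  rewrite -Rintegral_itv_bndo_bndc// [in RHS]Rint_indicM -RintegralZl//.
    apply: eq_Rintegral => s _; rewrite /K2 LE !indicE !mem_setE !in_itv/=.
    by rewrite -[(s < r)]negbK -leNgt; case: (r <= s); rewrite /= ?subrr ?subr0; ring.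
  exact: ((intble_indicM _ _ (meas_itv _)).1 fr).
split; [exact: intble_ext E1 (fubini_intble1 K1i)|exact: intble_ext E2 (fubini_intble2 K2i)|].
rewrite -(eq_Rintegral _ (fun s _ => E1 s)) -(eq_Rintegral _ (fun s _ => E2 s)).
rewrite -(fubiniR1 K1i) -(fubiniR2 K2i) -(RintegralD measurableT K1i K2i) -Rint_tensor//.
by apply: eq_Rintegral => p _; rewrite /K1 /K2 -mulrDl addrC subrK mul1r.
Qed.

(* Fubini on the two triangles of the square replaces the product rule, which is not *)
(* available for primitives of merely integrable functions.                          *)
Lemma primitive_mul (t : R) F G f g : 0 <= t ->
  intble mu `[0, t]%classic f -> intble mu `[0, t]%classic g ->
  (forall s, 0 <= s <= t -> F s = F 0 + \int[mu]_(x in `[0, s]) f x) ->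
  (forall s, 0 <= s <= t -> G s = G 0 + \int[mu]_(x in `[0, s]) g x) ->
  F t * G t - F 0 * G 0 = \int[mu]_(s in `[0, t]) (f s * G s + F s * g s).
Proof.
move=> t0 fi gi FE GE.
pose J : set (measurableTypeR R) := `[0, t]%classic.
have mJ : measurable J by exact: meas_itv.
pose f' s := \1_J s * f s; pose g' s := \1_J s * g s.
have f'i : intble mu setT f' by exact: ((intble_indicM _ _ mJ).1 fi).
have g'i : intble mu setT g' by exact: ((intble_indicM _ _ mJ).1 gi).
have Jt s : s \in J = (0 <= s <= t) by rewrite mem_setE in_itv.
have restr (h : R -> R) s : s \in J ->
    \int[mu]_(x in `]-oo, s]) (\1_J x * h x) = \int[mu]_(x in `[0, s]) h x.
  rewrite Jt => /andP[s0 st]; rewrite Rint_indicM [RHS]Rint_indicM.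
  apply: eq_Rintegral => x _; rewrite mulrA; congr (_ * _).
  rewrite !indicE Jt !mem_setE !in_itv/=.
  have [xs|sx] := leP x s; last by rewrite andbF mul0r.
  by rewrite (le_trans xs st) mul1r.
have whole (h : R -> R) : \int[mu]_x (\1_J x * h x) = \int[mu]_(x in `[0, t]) h x.
  by rewrite -Rint_indicM.
have [i1 i2] := Rint_triangle f'i g'i.
rewrite !whole => E.
have cut (h k : R -> R) s : \1_J s * h s * \int[mu]_(r in `]-oo, s]) (\1_J r * k r) =
    \1_J s * (h s * \int[mu]_(r in `[0, s]) k r).
  by rewrite !indicE; case: (boolP (s \in J)) => sJ; rewrite ?mul0r// restr// !mul1r.
have j1 : intble mu J (fun s => f s * \int[mu]_(r in `[0, s]) g r).
  by apply: (intble_indicM _ _ mJ).2; apply: intble_ext i1 => s; exact: cut.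
have j2 : intble mu J (fun s => g s * \int[mu]_(r in `[0, s]) f r).
  by apply: (intble_indicM _ _ mJ).2; apply: intble_ext i2 => s; exact: cut.
have fGi := intbleZ (G 0) mJ fi; have gFi := intbleZ (F 0) mJ gi.
have -> : \int[mu]_(s in `[0, t]) (f s * G s + F s * g s) =
    \int[mu]_(s in J) ((G 0 * f s + f s * \int[mu]_(r in `[0, s]) g r) +
      (F 0 * g s + g s * \int[mu]_(r in `[0, s]) f r)).
  apply: eq_Rintegral => s; rewrite -/J Jt => st.
  by rewrite (FE _ st) (GE _ st); ring.
rewrite (RintegralD mJ (intbleD mJ fGi j1) (intbleD mJ gFi j2)).
rewrite (RintegralD mJ fGi j1) (RintegralD mJ gFi j2) !RintegralZl//.
have E' : \int[mu]_(s in J) (f s * \int[mu]_(r in `[0, s]) g r) +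
    \int[mu]_(s in J) (g s * \int[mu]_(r in `[0, s]) f r) =
    (\int[mu]_(s in J) f s) * \int[mu]_(s in J) g s.
  rewrite -E; congr (_ + _); rewrite Rint_indicM; apply: eq_Rintegral => s _.
    by rewrite -cut.
  by rewrite -cut.
have t1 : 0 <= t <= t by rewrite t0 lexx.
rewrite (FE _ t1) (GE _ t1) -/J.
move: E'; move: (\int[mu]_(s in J) (_ * _)) (\int[mu]_(s in J) (_ * _)) (F 0) (G 0).
move: (\int[mu]_(s in J) f s) (\int[mu]_(s in J) g s) => p q a b F0 G0; lra.
Qed.
End AbsolutelyContinuous.

(** * The fundamental lemma of the calculus of variations *)

Section DynkinIntegral.
Variable R : realType.

(** The sets [A] for which the integral vanishes form a Dynkin system: the total integral is zero,
    and countable disjoint unions pass to the limit with [|h|] as dominating function. *)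
Lemma dynkin_Rint_eq0 d d' (T : measurableType d) (T' : measurableType d')
    (mu : {measure set T -> \bar R}) (h : T -> R) (f : T -> T') (G : set (set T')) :
  measurable_fun setT f -> intble mu setT h -> @measurable _ T' = <<s G >> ->
  setI_closed G -> \int[mu]_x h x = 0 ->
  (forall A, G A -> \int[mu]_x (\1_A (f x) * h x) = 0) ->
  forall A, measurable A -> \int[mu]_x (\1_A (f x) * h x) = 0.
Proof.
move=> mf hi mG GI h0 GA A; rewrite mG; move: A.
have mI A : measurable A -> measurable_fun setT (fun x => \1_A (f x) : R).
  by move=> mA; apply: measurableT_comp mf; exact: measurable_indic.
have bI (A : set T') y : `|\1_A y : R| <= 1.
  by rewrite indicE; case: (_ \in _); rewrite ?normr1 ?normr0.
have Ii A : measurable A -> intble mu setT (fun x => \1_A (f x) * h x).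
  by move=> mA; apply: (intble_mul_bd measurableT (mI A mA) (fun x _ => bI A (f x))).
apply: (dynkin_induction mG GI) => //.
- by rewrite -h0; apply: eq_Rintegral => x _; rewrite indicT mul1r.
- move=> S mS S0; rewrite -h0 -[LHS]addr0 -S0 -(RintegralD measurableT (Ii _ (measurableC mS)) (Ii _ mS)).
  apply: eq_Rintegral => x _; rewrite -mulrDl indicC indicE/=.
  by case: (_ \in _); rewrite ?subrr ?add0r ?subr0 ?addr0 ?mul1r.
- move=> F mF tF F0.
  have S0 n : \int[mu]_x (\1_(\big[setU/set0]_(i < n) F i) (f x) * h x) = 0.
    elim: n => [|n IH].
      by rewrite big_ord0; apply: Rint_eq0 => x _; rewrite indic0 mul0r.
    have mB := bigsetU_measurable (index_enum 'I_n) (fun i _ => mF (nat_of_ord i)).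
    rewrite big_ord_recr/= -[RHS]addr0 -{1}IH -{1}(F0 n) -RintegralD//; [|exact: Ii..].
    apply: eq_Rintegral => x _; rewrite -mulrDl; congr (_ * _).
    rewrite !indicE in_setU.
    have [/set_mem|_] := boolP (f x \in \big[setU/set0]_(i < n) F i); last by rewrite add0r.
    rewrite -bigcup_mkord => -[k /= kn Fk]; rewrite memNset ?addr0// => Fx.
    by move: kn; rewrite (tF k n I I (ex_intro _ (f x) (conj Fk Fx))) ltnn.
  have : \int[mu]_x (\1_(\big[setU/set0]_(i < n) F i) (f x) * h x) @[n --> \oo] -->
      \int[mu]_x (\1_(\bigcup_k F k) (f x) * h x).
    apply: (Rint_dominated measurableT _ _ (intble_norm hi)).
    + move=> n; apply: intble_meas; apply: Ii.
      exact: bigsetU_measurable.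
    + move=> x _; apply: cvgM; last exact: cvg_cst.
      apply: cvg_near_cst; rewrite indicE; have [/set_mem[k _ Fk]|nF] := boolP (f x \in _).
        near=> n; rewrite indicE mem_set// -bigcup_mkord; exists k => //=.
        by near: n; exists k.+1.
      near=> n; rewrite indicE memNset// -bigcup_mkord => -[k _ Fk].
      by move/negP: nF; apply; rewrite inE; exists k.
    + move=> n x _; rewrite normrM -[leRHS]mul1r ler_wpM2r//; exact: bI.
  under eq_cvg do rewrite S0.
  by move=> c; apply/esym/(@cvg_unique _ (@Rhausdorff R) _ _ _ _ (cvg_cst 0) c).
Unshelve. all: end_near. Qed.
End DynkinIntegral.

(** * Test functions of product form *)

Section TensorTests.
Variable R : realType.
Local Notation mu := (@lebesgue_measure R).
Local Notation leb3 := (@leb3 R).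
Local Notation S3 := (space3 R).

(** Products of one-variable functions keep their form under partial derivatives, so their
    smoothness reduces to the line; they suffice to separate integrable functions. *)
Definition tensor3 (p q r : R -> R) (x : S3) : R := p x.1.1 * q x.1.2 * r x.2.

Let is_derive_shift (f : R -> R) (x l k : R) : is_derive x (1 : R) f l ->
  is_derive (0 : R) (1 : R) (fun s : R => f (x + s%:A) * k) (l * k).
Proof.
move=> /line_is_derive df; have := is_deriveM df (is_derive_cst k (0 : R) (1 : R)).
move=> /is_derive_eq; apply; rewrite scaler0 add0r mulrC.
by [].
Qed.

Lemma tensor3_derive P Q S a b c i : smooth_seq P -> smooth_seq Q -> smooth_seq S ->
  exists a' b' c', forall x : S3,
    is_derive x (@basis3 R i) (tensor3 (P a) (Q b) (S c)) (tensor3 (P a') (Q b') (S c') x).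
Proof.
move=> sP sQ sS; elim/ord3E: i.
- exists a.+1, b, c => x; apply/line_is_derive; rewrite /tensor3 basis3_0 /=.
  rewrite -mulrA; under eq_fun do rewrite !scaler0 !addr0 -mulrA.
  exact: is_derive_shift.
- exists a, b.+1, c => x; apply/line_is_derive; rewrite /tensor3 basis3_1 /=.
  rewrite [P a _ * _]mulrC -mulrA; under eq_fun do rewrite !scaler0 !addr0 [P a _ * _]mulrC -mulrA.
  exact: is_derive_shift.
- exists a, b, c.+1 => x; apply/line_is_derive; rewrite /tensor3 basis3_2 /=.
  rewrite mulrC; under eq_fun do rewrite !scaler0 !addr0 mulrC.
  exact: is_derive_shift.
Qed.

Lemma partial_tensor3 P Q S s : smooth_seq P -> smooth_seq Q -> smooth_seq S ->
  exists a b c, partial (@basis3 R) s (tensor3 (P 0%N) (Q 0%N) (S 0%N)) =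
    tensor3 (P a) (Q b) (S c).
Proof.
move=> sP sQ sS; elim: s => [|i s [a [b [c IH]]]]; first by exists 0%N, 0%N, 0%N.
have [a' [b' [c' d]]] := tensor3_derive a b c i sP sQ sS.
exists a', b', c'; rewrite /= -/(partial _ s _) IH.
by apply/funext => x; have [_ <-] := d x.
Qed.

Lemma continuous_tensor3 (p q r : R -> R) : continuous p -> continuous q -> continuous r ->
  continuous (tensor3 p q r).
Proof.
move=> cp cq cr x; rewrite /tensor3.
have c1 : {for x, continuous (fun x : S3 => x.1)} by exact: cvg_fst.
have c11 : {for x, continuous (fun x : S3 => x.1.1)}.
  exact: (continuous_comp c1 (@cvg_fst _ _ _ _ _)).
have c12 : {for x, continuous (fun x : S3 => x.1.2)}.
  exact: (continuous_comp c1 (@cvg_snd _ _ _ _ _)).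
have c2 : {for x, continuous (fun x : S3 => x.2)} by exact: cvg_snd.
apply: cvgM; first apply: cvgM.
- exact: (continuous_comp c11 (@cp _)).
- exact: (continuous_comp c12 (@cq _)).
- exact: (continuous_comp c2 (@cr _)).
Qed.

Lemma tensor3_test (p q r : R -> R) (A B C : set (measurableTypeR R)) :
  smooth_alg p -> smooth_alg q -> smooth_alg r ->
  compact A -> compact B -> compact C ->
  (forall x, ~ A x -> p x = 0) -> (forall x, ~ B x -> q x = 0) ->
  (forall x, ~ C x -> r x = 0) -> test_function (@basis3 R) setT (tensor3 p q r).
Proof.
move=> /smooth_alg_seq[P <- sP] /smooth_alg_seq[Q <- sQ] /smooth_alg_seq[S <- sS] cA cB cC pA qB rC.
have cABC : compact (A `*` B `*` C : set S3) by apply: compact_setX => //; exact: compact_setX.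
have sub : tsupport (tensor3 (P 0%N) (Q 0%N) (S 0%N)) `<=` (A `*` B `*` C : set S3).
  rewrite /tsupport [X in _ `<=` X](closure_id _).1; last first.
    by apply: compact_closed cABC; exact: norm_hausdorff.
  apply: closure_subset => x /=; rewrite /tensor3 !mulf_eq0 !negb_or => /andP[/andP[a b] c].
  by split; [split|]; [move: a|move: b|move: c]; move/eqP; apply: contra_notP; [exact: pA|exact: qB|exact: rC].
split=> //; last by apply: (subclosed_compact _ cABC sub); exact: closed_closure.
move=> k; split=> [s i x _|s _].
  have [a [b [c ->]]] := partial_tensor3 s sP sQ sS.
  by have [a' [b' [c' d]]] := tensor3_derive a b c i sP sQ sS; case: (d x).
have [a [b [c ->]]] := partial_tensor3 s sP sQ sS.
apply: continuous_tensor3.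
- exact: (@smooth_seq_continuous R P).
- exact: (@smooth_seq_continuous R Q).
- exact: (@smooth_seq_continuous R S).
Qed.

(** A smooth function supported in [[a, b]] that increases, as [n] grows, to the indicator of the
    open interval; only the pointwise limit and the values in [[0, 1]] are used. *)
Definition window (a b : R) n (y : R) : R :=
  step (n.+1%:R * (y - a)) * step (n.+1%:R * (b - y)).

Lemma window_smooth a b n : smooth_alg (window a b n).
Proof.
have -> : window a b n = fun y => step (n.+1%:R * y + - (n.+1%:R * a)) *
    step (- n.+1%:R * y + n.+1%:R * b).
  by apply/funext => y; rewrite /window mulNr [- _ + _]addrC -!mulrBr.
by apply: smooth_mul; apply: smooth_alg_affine; exact: step_smooth.
Qed.

Lemma window_out a b n y : ~ (`[a, b]%classic : set R) y -> window a b n y = 0.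
Proof.
move=> /negP; rewrite in_itv/= negb_and -!ltNge /window => /orP[ya|by_].
  by rewrite step_le0 ?mul0r// mulr_ge0_le0// subr_le0 ltW.
by rewrite [X in _ * X]step_le0 ?mulr0// mulr_ge0_le0// subr_le0 ltW.
Qed.

Lemma window_01 a b n y : 0 <= window a b n y <= 1.
Proof.
have /andP[a0 a1] := step_01 (n.+1%:R * (y - a)).
have /andP[b0 b1] := step_01 (n.+1%:R * (b - y)).
by rewrite /window mulr_ge0//= mulr_ile1.
Qed.

Lemma window_cvg a b y : window a b n y @[n --> \oo] --> (\1_(`]a, b[%classic) y : R).
Proof.
apply: cvg_near_cst; rewrite indicE mem_setE in_itv/=.
have big (e : R) : 0 < e -> \forall n \near \oo, 1 < n.+1%:R * e.
  move=> e0; near=> n; rewrite mulrC -ltr_pdivrMr// div1r.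
  by near: n; exact: (near_infty_natSinv_lt (PosNum e0)).
have [ay|ya] := ltP a y; last first.
  by apply: nearW => n; rewrite /window step_le0 ?mul0r// mulr_ge0_le0// subr_le0.
have [yb|by_] := ltP y b; last first.
  by apply: nearW => n; rewrite /window [X in _ * X]step_le0 ?mulr0// mulr_ge0_le0// subr_le0.
have a0 : 0 < y - a by rewrite subr_gt0.
have b0 : 0 < b - y by rewrite subr_gt0.
near=> n; rewrite /window !step_ge1 ?mulr1//.
  by apply: ltW; near: n; exact: big.
by apply: ltW; near: n; exact: big.
Unshelve. all: end_near. Qed.
End TensorTests.

Section SeparatingTensors.
Variable R : realType.
Local Notation mu := (@lebesgue_measure R).
Local Notation leb3 := (@leb3 R).
Local Notation S3 := (space3 R).
Implicit Types (h : S3 -> R) (A B C : set (measurableTypeR R)).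

Let m11 : measurable_fun setT (fun x : S3 => x.1.1).
Proof. by have [] := (measurable_coords (fun x : S3 => x)).1 (@measurable_id _ _ _). Qed.
Let m12 : measurable_fun setT (fun x : S3 => x.1.2).
Proof. by have [] := (measurable_coords (fun x : S3 => x)).1 (@measurable_id _ _ _). Qed.
Let m2 : measurable_fun setT (fun x : S3 => x.2).
Proof. by have [] := (measurable_coords (fun x : S3 => x)).1 (@measurable_id _ _ _). Qed.

Let ind_le1 T (A : set T) y : `|\1_A y : R| <= 1.
Proof. by rewrite indicE; case: (_ \in _); rewrite ?normr1 ?normr0. Qed.

Let intble_ind A (f : S3 -> measurableTypeR R) h : measurable A -> measurable_fun setT f ->
  intble leb3 setT h -> intble leb3 setT (fun x => \1_A (f x) * h x).
Proof.
move=> mA mf; apply: (intble_mul_bd (C := 1) measurableT) => //.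
by apply: measurableT_comp mf; exact: measurable_indic.
Qed.

Let ind_prod T T' (A : set T) (B : set T') x :
  \1_(A `*` B) x = \1_A x.1 * \1_B x.2 :> R.
Proof.
have E : (x \in A `*` B) = (x.1 \in A) && (x.2 \in B).
  by apply/idP/andP; rewrite !inE => -[].
by rewrite !indicE -natrM mulnb E.
Qed.

Let setI_rect d1 d2 (T1 : measurableType d1) (T2 : measurableType d2) :
  setI_closed [set A `*` B | A in @measurable _ T1 & B in @measurable _ T2].
Proof.
move=> _ _ [A1 mA1 [B1 mB1 <-]] [A2 mA2 [B2 mB2 <-]].
exists (A1 `&` A2); first exact: measurableI.
by exists (B1 `&` B2); [exact: measurableI|rewrite setXI].
Qed.

Let mray (x : R) : measurable (`]x, +oo[%classic : set (measurableTypeR R)).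
Proof. exact: measurable_itv. Qed.

(** Rays []a, +oo[] are stable under intersection and generate the Borel sets. As [h] vanishes where
    [f <= k], the ray from [k] already carries the whole integral, which starts the Dynkin
    argument. *)
Lemma ray_extension (f : S3 -> measurableTypeR R) h k : measurable_fun setT f ->
  intble leb3 setT h -> (forall x, (f x : R) <= k -> h x = 0) ->
  (forall a : R, \int[leb3]_x (\1_(`]a, +oo[%classic) (f x) * h x) = 0) ->
  forall A, measurable A -> \int[leb3]_x (\1_A (f x) * h x) = 0.
Proof.
move=> mf hi hk hray.
apply: (@dynkin_Rint_eq0 R _ _ S3 (measurableTypeR R) leb3 h f (@RGenOInfty.G R)) => //.
- exact: RGenOInfty.measurableE.
- move=> _ _ [a ->] [b ->]; exists (Num.max a b); apply/seteqP; split=> x /=;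
    rewrite !in_itv/= !andbT gt_max; first by case=> -> ->.
  by move=> /andP[].
- rewrite -(hray k); apply: eq_Rintegral => x _; rewrite indicE mem_setE in_itv/= andbT.
  by case: ltP => [|/hk ->]; rewrite ?mul1r// mulr0.
- by move=> _ [a ->]; exact: hray.
Qed.

(** Rays are replaced by arbitrary measurable sets one coordinate at a time; two more Dynkin
    arguments go from rectangles to measurable sets of the plane and then of the space. *)
Lemma tensor3_separating h k : intble leb3 setT h ->
  (forall x : S3, [\/ x.1.1 <= k, x.1.2 <= k | x.2 <= k] -> h x = 0) ->
  (forall a b c : R, \int[leb3]_x (tensor3 \1_(`]a, +oo[%classic)
     \1_(`]b, +oo[%classic) \1_(`]c, +oo[%classic) x * h x) = 0) ->
  forall A : set S3, measurable A -> \int[leb3]_x (\1_A x * h x) = 0.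
Proof.
move=> hi hk h0.
have s1 A b c : measurable A -> \int[leb3]_x (tensor3 \1_A
     \1_(`]b, +oo[%classic) \1_(`]c, +oo[%classic) x * h x) = 0.
  move=> mA; rewrite -[RHS](@ray_extension _ (fun x => \1_(`]b, +oo[%classic) (x.1.2 : R) *
    (\1_(`]c, +oo[%classic) (x.2 : R) * h x)) k m11 _ _ _ A mA).
  - by apply: eq_Rintegral => x _; rewrite /tensor3 -!mulrA.
  - by do 2 apply: intble_ind => //.
  - by move=> x xk; rewrite hk ?mulr0//; constructor 1.
  - by move=> a; rewrite -[RHS](h0 a b c); apply: eq_Rintegral => x _; rewrite /tensor3 -!mulrA.
have s2 A B c : measurable A -> measurable B -> \int[leb3]_x (tensor3 \1_A
     \1_B \1_(`]c, +oo[%classic) x * h x) = 0.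
  move=> mA mB; rewrite -[RHS](@ray_extension _ (fun x => \1_A (x.1.1) *
    (\1_(`]c, +oo[%classic) (x.2 : R) * h x)) k m12 _ _ _ B mB).
  - by apply: eq_Rintegral => x _; rewrite /tensor3 [_ * \1_B _]mulrC -!mulrA.
  - by do 2 apply: intble_ind => //.
  - by move=> x xk; rewrite hk ?mulr0//; constructor 2.
  - move=> b; rewrite -[RHS](s1 A b c mA); apply: eq_Rintegral => x _.
    by rewrite /tensor3 -!mulrA mulrCA.
have s3 A B C : measurable A -> measurable B -> measurable C ->
    \int[leb3]_x (tensor3 \1_A \1_B \1_C x * h x) = 0.
  move=> mA mB mC; rewrite -[RHS](@ray_extension _ (fun x => \1_A (x.1.1) *
    (\1_B x.1.2 * h x)) k m2 _ _ _ C mC).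
  - by apply: eq_Rintegral => x _; rewrite /tensor3 mulrC -!mulrA; ring.
  - by do 2 apply: intble_ind => //.
  - by move=> x xk; rewrite hk ?mulr0//; constructor 3.
  - move=> c; rewrite -[RHS](s2 A B c mA mB); apply: eq_Rintegral => x _.
    by rewrite /tensor3; ring.
have mT : measurable (setT : set (measurableTypeR R)) := measurableT.
have s4 (D : set (measurableTypeR R * measurableTypeR R)) C : measurable D -> measurable C ->
    \int[leb3]_x (\1_D x.1 * (\1_C x.2 * h x)) = 0.
  move=> mD mC; move: D mD.
  apply: (@dynkin_Rint_eq0 R _ _ S3 _ leb3 (fun x => \1_C x.2 * h x) (fun x => x.1) _
    measurable_fst (intble_ind mC m2 hi) (measurable_prod_measurableType _ _) (@setI_rect _ _ _ _)).
    rewrite -[RHS](s3 setT setT C mT mT mC); apply: eq_Rintegral => x _.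
    by rewrite /tensor3 !indicT !mul1r.
  move=> _ [A mA [B mB <-]]; rewrite -[RHS](s3 A B C mA mB mC); apply: eq_Rintegral => x _.
  by rewrite /tensor3 ind_prod !mulrA.
apply: (@dynkin_Rint_eq0 R _ _ S3 _ leb3 h id _ (@measurable_id _ _ _) hi
  (measurable_prod_measurableType _ _) (@setI_rect _ _ _ _)).
  rewrite -[RHS](s3 setT setT setT mT mT mT); apply: eq_Rintegral => x _.
  by rewrite /tensor3 !indicT !mul1r.
move=> _ [D mD [B mB <-]]; rewrite -[RHS](s4 D B mD mB); apply: eq_Rintegral => x _.
by rewrite ind_prod mulrA.
Qed.
End SeparatingTensors.

Section FundamentalLemma.
Variable R : realType.
Local Notation mu := (@lebesgue_measure R).
Local Notation leb3 := (@leb3 R).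
Local Notation S3 := (space3 R).
Local Notation box3 := (@box R _ S3).
Implicit Types (h f w : S3 -> R).

Lemma compact_box3 (r : R) : compact (box3 r).
Proof.
have c1 : compact (@box R _ (measurableTypeR R) r).
  rewrite (_ : box _ = (`[-r, r]%classic : set (measurableTypeR R))); first exact: segment_compact.
  by apply/seteqP; split => z; rewrite /box /= in_itv/= -ler_norml.
by rewrite box_prod box_prod; apply: compact_setX => //; exact: compact_setX.
Qed.

Lemma loc_integrable_intble3 f : @loc_integrable _ R S3 leb3 setT f -> loc_intble3 f.
Proof.
move=> fi; have fb r : intble leb3 (box3 r) f by apply: fi => //; exact: compact_box3.
split=> [|r]; last exact: ((intble_indicM _ _ (measurable_box3 r)).1 (fb r)).
have -> : (setT : set S3) = \bigcup_n box3 n%:R.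
  apply/seteqP; split=> // x _; exists (Num.truncn `|x|).+1 => //.
  by rewrite /box /=; apply: ltW; exact: truncnS_gt.
apply/measurable_fun_bigcup => [i|i]; first exact: measurable_box3.
exact: intble_meas (fb _).
Qed.

Let tensor3_le1 (p q r : R -> R) x : (forall y, `|p y| <= 1) -> (forall y, `|q y| <= 1) ->
  (forall y, `|r y| <= 1) -> `|tensor3 p q r x| <= 1.
Proof.
move=> p1 q1 r1; rewrite /tensor3 !normrM.
by apply: mulr_ile1 => //; exact: mulr_ile1.
Qed.

Let tensor3_out (p q r : R -> R) a b c k (x : S3) : - k <= a -> - k <= b -> - k <= c ->
  (forall y, ~ (`[a, k]%classic : set R) y -> p y = 0) ->
  (forall y, ~ (`[b, k]%classic : set R) y -> q y = 0) ->
  (forall y, ~ (`[c, k]%classic : set R) y -> r y = 0) ->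
  x \notin box3 k -> tensor3 p q r x = 0.
Proof.
move=> ka kb kc p0 q0 r0 xk.
have : ~ (`[a, k]%classic : set R) x.1.1 \/ ~ (`[b, k]%classic : set R) x.1.2 \/
    ~ (`[c, k]%classic : set R) x.2.
  apply: contrapT => /not_orP[/contrapT xa /not_orP[/contrapT xb /contrapT xc]].
  move/negP: xk; apply; rewrite inE; apply/box3P.
  move: xa xb xc; rewrite /= !in_itv/= => /andP[x1 y1] /andP[x2 y2] /andP[x3 y3].
  by split; rewrite ler_norml ?y1 ?y2 ?y3 andbT;
    [exact: le_trans ka x1|exact: le_trans kb x2|exact: le_trans kc x3].
by rewrite /tensor3 => -[/p0|[/q0|/r0]] ->; rewrite ?(mul0r, mulr0).
Qed.

(** Limit of smooth windows; all of them vanish off the box of radius [k], on which [|h|] is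
    integrable and dominates. *)
Let window_cube h (k a b c : R) : loc_intble3 h ->
  (forall phi, test_function (@basis3 R) setT phi -> \int[leb3]_x (phi x * h x) = 0) ->
  - k <= a -> - k <= b -> - k <= c ->
  \int[leb3]_x (tensor3 \1_(`]a, k[%classic) \1_(`]b, k[%classic) \1_(`]c, k[%classic) x * h x) = 0.
Proof.
move=> hi h0 ka kb kc.
pose phi n := tensor3 (window a k n) (window b k n) (window c k n).
have tphi n : test_function (@basis3 R) setT (phi n).
  apply: (@tensor3_test R _ _ _ `[a, k]%classic `[b, k]%classic `[c, k]%classic);
    do ?[exact: window_smooth|exact: segment_compact|move=> x; exact: window_out].
have [mh hb] := hi.
have mphi n : measurable_fun setT (phi n).
  apply: (@mbasis_continuous_measurable R _ S3); first exact: mbasis_space3.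
  have [cphi _ _] := tphi n; have [_ cc] := cphi 0%N; exact: (cc [::]).
have lim : \int[leb3]_x (phi n x * h x) @[n --> \oo] -->
    \int[leb3]_x (tensor3 \1_(`]a, k[%classic) \1_(`]b, k[%classic) \1_(`]c, k[%classic) x * h x).
  have gi : intble leb3 setT (fun x => \1_(box3 k) x * `|h x|).
    apply: intble_ext (intble_norm (hb k)) => x; rewrite normrM ger0_norm//.
  apply: (Rint_dominated measurableT _ _ gi).
  - by move=> n; exact: measurable_funM.
  - move=> x _; apply: cvgM; last exact: cvg_cst.
    by rewrite /phi /tensor3; do 2 ?[apply: cvgM]; exact: window_cvg.
  - move=> n x _; rewrite normrM ler_wpM2r//.
    rewrite indicE; case: (boolP (x \in box3 k)) => [_|xk].
      have w1 (p : R) y : `|window p k n y| <= 1.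
        by have /andP[w0 w1] := window_01 p k n y; rewrite ger0_norm.
      exact: tensor3_le1.
    by rewrite /phi (tensor3_out ka kb kc _ _ _ xk) ?normr0// => y; exact: window_out.
apply: (@cvg_unique _ (@Rhausdorff R) _ _ _ _ lim).
by apply: cvg_near_cst; apply: nearW => n; exact: h0.
Qed.

(** On each open cube, [h] is integrable and orthogonal to indicators of products of rays, hence to
    every measurable set, hence zero almost everywhere. Countably many cubes cover the space. *)
Lemma fundamental_lemma h : loc_intble3 h ->
  (forall phi, test_function (@basis3 R) setT phi -> \int[leb3]_x (phi x * h x) = 0) ->
  {ae leb3, forall x, h x = 0}.
Proof.
move=> hi h0.
have [mh hb] := hi.
pose I k : set R := `]-k, k[%classic.
pose O k (x : S3) : R := tensor3 \1_(I k) \1_(I k) \1_(I k) x.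
have hk k : {ae leb3, forall x, O k x * h x = 0}.
  have Oi : intble leb3 setT (fun x => O k x * h x).
    apply: (intble_le measurableT _ _ (intble_norm (hb k))).
      apply: measurable_funM => //.
      have [m1 m2 m3] := (measurable_coords (fun x : S3 => x)).1 (@measurable_id _ _ _).
      have mI : measurable_fun setT (\1_(I k) : measurableTypeR R -> R).
        exact: (measurable_indic (meas_itv _)).
      by do 2 ?[apply: measurable_funM]; exact: measurableT_comp.
    move=> x _; rewrite (normrM (O k x)) (normrM (\1_(box3 k) x)) ler_wpM2r//.
    rewrite [\1_(box3 k) x]indicE; case: (boolP (x \in box3 k)) => [_|xk].
      rewrite normr1; apply: tensor3_le1 => y;
        by rewrite indicE; case: (_ \in _); rewrite ?normr1 ?normr0.
    rewrite /O (tensor3_out (lexx _) (lexx _) (lexx _) _ _ _ xk) ?normr0// => y yI;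
      rewrite indicE memNset// => yk; apply: yI; move: yk; rewrite /I /= !in_itv/=;
      by move=> /andP[/ltW -> /ltW ->].
  have sep := @tensor3_separating R (fun x => O k x * h x) (- k) Oi _ _.
  have {}sep : forall A : set S3, measurable A -> \int[leb3]_x (\1_A x * (O k x * h x)) = 0.
    apply: sep => [x xk|a b c].
      rewrite /O /tensor3 !indicE /I !mem_setE !in_itv/=.
      by case: xk; rewrite leNgt => /negbTE ->; rewrite ?(mul0r, mulr0).
    (* Within the cube the ray from [p] is the interval from [max p (-k)] to [k], to which
       [window_cube] applies. *)
    have ge (p : R) : - k <= Num.max p (- k) by rewrite le_max lexx orbT.
    rewrite -[RHS](window_cube hi h0 (ge a) (ge b) (ge c)); apply: eq_Rintegral => x _.
    rewrite mulrA; congr (_ * _); rewrite /O /tensor3 !indicE /I !mem_setE !in_itv/= !andbT !gt_max.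
    rewrite -!natrM !mulnb; congr (nat_of_bool _)%:R.
    by rewrite -!andbA; do !bool_congr.
  have := @integral_ae_eq _ _ _ leb3 setT measurableT (cst 0%E) (EFin \o (fun x => O k x * h x)) Oi.
  move=> /(_ (@measurable_cst _ _ _ _ _ _)) H.
  have : ae_eq leb3 setT (EFin \o (fun x => O k x * h x)) (cst 0%E).
    apply: H => E _ mE; rewrite integral0.
    have Ei : intble leb3 E (fun x => O k x * h x) by apply: (intble_sub measurableT mE _ Oi).
    rewrite -(fineK (integrable_fin_num mE Ei)); congr EFin.
    by have := sep E mE; rewrite -Rint_indicM.
  by apply: filterS => x /(_ Logic.I) [].
have : {ae leb3, forall x (n : nat), O n%:R x * h x = 0} by apply: ae_foralln.
apply: filterS => x xn; have := xn (Num.truncn `|x|).+1.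
suff -> : O (Num.truncn `|x|).+1%:R x = 1 by rewrite mul1r.
have [x1 x2 x3] := (box3P `|x| x).1 (lexx _).
have lt := @truncnS_gt R `|x|.
have oneI y : `|y| <= `|x| -> \1_(I (Num.truncn `|x|).+1%:R) y = 1 :> R.
  by move=> yx; rewrite indicE mem_set// /I /= in_itv/= -ltr_norml (le_lt_trans yx).
by rewrite /O /tensor3 !oneI// !mulr1.
Qed.

(** The order-zero entry of a weak jet is given only through test functions; the fundamental lemma
    identifies it with the function itself almost everywhere. *)
Lemma weak_partial_nil f w : @weak_partial _ R S3 leb3 3 (@basis3 R) setT [::] f w ->
  [/\ loc_intble3 f, loc_intble3 w & {ae leb3, forall x, f x = w x}].
Proof.
move=> [lf lw fw].
have fi := loc_integrable_intble3 lf; have wi := loc_integrable_intble3 lw; split=> //.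
have hi : loc_intble3 (fun x => f x + -1 * w x) by apply: loc_intble3D => //; exact: loc_intble3Z.
have int c phi : @loc_integrable _ R S3 leb3 setT c -> test_function (@basis3 R) setT phi ->
    intble leb3 setT (fun x => c x * phi x).
  move=> lc [cphi cA _]; have cp : continuous phi by have [_ cc] := cphi 0%N; exact: (cc [::]).
  have mA : measurable (tsupport phi : set S3).
    rewrite -[X in measurable X]setCK; apply: measurableC.
    apply: mbasis_open_measurable; first exact: mbasis_space3.
    by apply: closed_openC; exact: closed_closure.
  have [M [_ MP]] : bounded_set (phi @` tsupport phi).
    by apply: compact_bounded; apply: continuous_compact => //; exact: continuous_subspaceT.
  have phi0 x : ~ tsupport phi x -> phi x = 0.
    by move=> xA; apply/eqP/negPn/negP => px; apply: xA; exact: subset_closure.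
  apply: (intble_supp mA) => [x /phi0 ->|]; first by rewrite mulr0.
  apply: intble_ext (intble_mul_bd (C := M + 1) mA _ _ (lc _ cA (@subsetT _ _))) => [x||x Ax].
  - by rewrite mulrC.
  - apply: measurable_funS measurableT (@subsetT _ _) _.
    by apply: (@mbasis_continuous_measurable R _ S3) => //; exact: mbasis_space3.
  - by apply: (MP (M + 1)); [rewrite ltrDl|exists x].
apply: filterS (fundamental_lemma hi _) => [x|phi tphi].
  by rewrite mulN1r => /eqP; rewrite subr_eq0 => /eqP.
have := fw phi tphi; rewrite /= expr0 mul1r => E.
transitivity (\int[leb3]_x (f x * phi x) - \int[leb3]_x (w x * phi x)); last by rewrite E subrr.
rewrite -(RintegralB measurableT (int _ _ lf tphi) (int _ _ lw tphi)).
by apply: eq_Rintegral => x _; ring.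
Qed.
End FundamentalLemma.

(** * Local square-integrability of Sobolev fields *)

Section SobolevSquare.
Variable R : realType.
Local Notation leb3 := (@leb3 R).
Local Notation S3 := (space3 R).
Local Notation box3 := (@box R _ S3).

Lemma order0 k : Defs.order ([ffun=> ord0] : {ffun 'I_3 -> 'I_k.+1}) = 0%N.
Proof. by rewrite /Defs.order big1// => i _; rewrite ffunE. Qed.

Lemma dirs0 k : dirs ([ffun=> ord0] : {ffun 'I_3 -> 'I_k.+1}) = [::].
Proof.
rewrite /dirs; elim: (fintype.enum _) => //= i s.
by rewrite ffunE.
Qed.

Lemma root_sum_lty (I : finType) (P : {pred I}) (F : I -> \bar R) b : 0 < b ->
  (forall i, P i -> 0 <= F i)%E -> ((\sum_(i | P i) F i) `^ b^-1 < +oo)%E ->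
  forall i, P i -> (F i < +oo)%E.
Proof.
move=> b0 F0 H i Pi; rewrite ltey; apply/eqP => Fi; move: H.
rewrite (_ : (\sum_(i | P i) F i)%E = +oo%E).
  by rewrite poweRyr ?invr_eq0 ?gt_eqF// ltxx.
apply/eqP; rewrite esum_eqy; last first.
  by move=> j /F0 Fj; rewrite gt_eqF// (lt_le_trans _ Fj)// ltNy0.
by apply/existsP; exists i; rewrite Fi eqxx andbT.
Qed.

Lemma vsobolev_coord k b (m : S3 -> S3) i : 0 < b -> vsobolev k b m ->
  (@sobolev_norm _ R S3 leb3 3 (@basis3 R) k b (fun x => coord (m x) i) < +oo)%E.
Proof.
move=> b0 H; have P0 (j : 'I_3) : xpredT j ->
    (0 <= @sobolev_norm _ R S3 leb3 3 (@basis3 R) k b (fun x => coord (m x) j) `^ b)%E.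
  by move=> _; exact: poweR_ge0.
have := root_sum_lty b0 P0 H (i := i) isT.
by rewrite !ltey; apply: contra => /eqP/(eqy_poweR b0) ->.
Qed.

Lemma sobolev_power k b (f : S3 -> R) : 0 < b ->
  (@sobolev_norm _ R S3 leb3 3 (@basis3 R) k b f < +oo)%E ->
  exists w, @weak_partial _ R S3 leb3 3 (@basis3 R) setT [::] f w /\
    (\int[leb3]_x (`|w x| `^ b)%:E < +oo)%E.
Proof.
move=> b0 /ereal_inf_lt[N [w wj ->]] Noo.
exists (w [ffun=> ord0]); split; first by have := wj [ffun=> ord0]; rewrite order0 dirs0; apply.
have P0 (al : {ffun 'I_3 -> 'I_k.+1}) : (Defs.order al <= k)%N ->
    (0 <= \int[leb3]_x (`|w al x| `^ b)%:E)%E.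
  by move=> _; apply: integral_ge0 => x _; rewrite lee_fin powR_ge0.
by apply: (root_sum_lty b0 P0 Noo); rewrite order0.
Qed.

Lemma sqr_le_powR (b y : R) : 2 <= b -> y ^+ 2 <= 1 + `|y| `^ b.
Proof.
move=> b2; have [y1|y1] := leP `|y| 1.
  rewrite -real_normK ?num_real// -[leLHS]addr0 lerD ?powR_ge0//.
  by rewrite expr_le1.
rewrite -real_normK ?num_real// -powR_mulrn// -[leLHS]add0r lerD//.
by rewrite ler_powR// ltW.
Qed.

(** A finite Sobolev norm bounds the [b]-th power integral of the order-zero entry, which equals the
    field almost everywhere, and [y^2 <= 1 + |y|^b] for [b >= 2]. *)
Lemma vsobolev_loc k b (m : S3 -> S3) i : 2 <= b -> vsobolev k b m ->
  loc_intble3 (fun x => coord (m x) i) /\ loc_intble3 (fun x => coord (m x) i ^+ 2).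
Proof.
move=> b2 mW; have b0 : 0 < b by rewrite (lt_le_trans _ b2).
have [w [/weak_partial_nil[fi wi fw] wb]] := sobolev_power b0 (vsobolev_coord i b0 mW).
split=> //; have [mf _] := fi; have [mw _] := wi.
have mp : measurable_fun setT (fun x => `|w x| `^ b).
  by apply: measurableT_comp (measurable_powR b) _; exact: measurableT_comp.
have wbi : intble leb3 setT (fun x => `|w x| `^ b).
  apply/integrableP; split; first exact/measurable_EFinP.
  apply: le_lt_trans wb; apply: ge0_le_integral => //.
  - by apply: measurableT_comp => //; exact/measurable_EFinP.
  - exact/measurable_EFinP.
  - by move=> x _; rewrite /= ger0_norm ?powR_ge0.
split=> [|r]; first exact: measurable_funX.
have mI : measurable_fun setT (\1_(box3 r) : S3 -> R) by exact: measurable_indic (measurable_box3 r).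
have Ii : intble leb3 setT (\1_(box3 r) : S3 -> R).
  have := (intble_indicM leb3 (fun=> 1) (measurable_box3 r)).1 (intble_cst _ (measurable_box3 r) (finite_boxes_leb3 r)).
  by apply: intble_ext => x; rewrite mulr1.
apply: (intble_aele measurableT _ _ (intbleD measurableT Ii wbi)).
  by apply: measurable_funM => //; exact: measurable_funX.
apply: filterS fw => x fw _; rewrite indicE.
case: (_ \in _); rewrite /= ?mul1r ?mul0r ?normr0 ?add0r ?powR_ge0//.
by rewrite ger0_norm ?sqr_ge0// fw sqr_le_powR.
Qed.
End SobolevSquare.

(** * Functions of time with values in function spaces *)

Section BochnerVersion.
Variable R : realType.
Local Notation mu := (@lebesgue_measure R).
Local Notation S6 := (space6 R).
Local Notation TS := (measurableTypeR R * S6)%type.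

(** The integral of a nonnegative function is a supremum over simple functions below it, hence
    monotone without measurability. This is applied to the sup norm of [F t], a supremum over
    uncountably many points. *)
Lemma ge0_integral_mono d (T : measurableType d) (nu : {measure set T -> \bar R})
    (f g : T -> \bar R) : (forall x, 0 <= f x)%E -> (forall x, f x <= g x)%E ->
  (\int[nu]_x f x <= \int[nu]_x g x)%E.
Proof.
move=> f0 fg; have g0 x : (0 <= g x)%E by exact: le_trans (f0 x) (fg x).
rewrite !ge0_integralTE//; apply: ge_ereal_sup => _ [h hf <-].
by apply: ereal_sup_ubound; exists h => // x; exact: le_trans (hf x) (fg x).
Qed.

Let norm_le_sqr (y : R) : `|y| <= 1 + y ^+ 2.
Proof. by rewrite -real_normK ?num_real//; have := sqr_ge0 (`|y| - 1); nra. Qed.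

(** For every [z], [|F t z|] is below the sup norm of [F t], whose square has finite integral; with
    [|y| <= 1 + y^2] this yields one bound for all [z]. *)
Lemma bochner2_bound (T : R) (F : R -> S6 -> R) :
  (bochner_norm T (@sup_norm _ R S6) 2%:E F < +oo)%E ->
  exists2 D : R, 0 <= D & forall z,
    measurable_fun (`[0, T]%classic : set (measurableTypeR R)) (F ^~ z) ->
    intble mu `[0, T]%classic (F ^~ z) /\ \int[mu]_(t in `[0, T]) `|F t z| <= D.
Proof.
rewrite /bochner_norm unlock.
set g := fun t => _; move=> Hg.
pose I2 := (\int[mu]_x g x)%E.
have I2oo : (I2 < +oo)%E.
  by rewrite ltey; apply/eqP => E; move: Hg; rewrite -/I2 E poweRyr ?invr_eq0.
have g0 t : (0 <= g t)%E by exact: poweR_ge0.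
have I2f : I2 \is a fin_num by rewrite ge0_fin_numE// integral_ge0.
exists (`|T| + fine I2) => [|z mF]; first by rewrite addr_ge0// fine_ge0// integral_ge0.
pose J : set (measurableTypeR R) := `[0, T]%classic.
have mJ : measurable J by exact: meas_itv.
have mF2 : measurable_fun J (fun t => F t z ^+ 2) by exact: measurable_funX.
have F2g : (\int[mu]_(t in J) (F t z ^+ 2)%:E <= I2)%E.
  rewrite integral_mkcond; apply: ge0_integral_mono => t.
    by rewrite patchE; case: ifP => // _; rewrite lee_fin sqr_ge0.
  rewrite patchE; case: ifPn => [tJ|_]; last exact: g0.
  rewrite /g patchE tJ /= gee0_abs; last first.
    by apply: le_trans (_ : `|F t z|%:E <= _)%E; [rewrite lee_fin|apply: ereal_sup_ubound; exists z].
  have -> : ((F t z ^+ 2)%:E = `|F t z|%:E `^ 2)%E.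
    by rewrite poweR_EFin powR_mulrn// real_normK// num_real.
  have Fs : (`|F t z|%:E <= sup_norm (F t))%E by apply: ereal_sup_ubound; exists z.
  apply: gt0_ler_poweR => //; rewrite in_itv/= leey andbT ?lee_fin//.
  exact: le_trans Fs.
have F2i : intble mu J (fun t => F t z ^+ 2).
  apply/integrableP; split; first exact/measurable_EFinP.
  apply: le_lt_trans I2oo; apply: le_trans F2g.
  rewrite le_eqVlt; apply/orP; left; apply/eqP; apply: eq_integral => t _.
  by rewrite /= ger0_norm ?sqr_ge0.
have Ji : intble mu J (fun=> 1) by apply: (intble_cst _ mJ); exact: mu_cc_lty.
have Fi : intble mu J (F ^~ z).
  apply: (intble_le mJ mF _ (intbleD mJ Ji F2i)) => t _.
  exact: norm_le_sqr.
split=> //.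
apply: le_trans (Rint_le mJ (intble_norm Fi) (intbleD mJ Ji F2i) _) _ => [t _|].
  exact: norm_le_sqr.
rewrite (RintegralD mJ Ji F2i) lerD//.
  rewrite Rintegral_cst// mul1r; have [T0|T0] := leP 0 T.
    by rewrite (congr1 fine (mu_itv_cc T0)) /= subr0 ler_norm.
  have J0 : J = set0.
    apply/seteqP; split=> // t; rewrite /J /= in_itv/= => /andP[t0 /(le_trans t0)].
    by rewrite leNgt T0.
  by rewrite J0 measure0 /= normr_ge0.
by apply: (fine_le _ I2f F2g); exact: (integrable_fin_num mJ F2i).
Qed.

(** Finitely many continuous values, each taken on a measurable set of times: preimages are finite
    unions of measurable rectangles. *)
Lemma simple_map_measurable (s : R -> S6 -> R) :
  simple_map (@Cb _ R S6) s -> measurable_fun setT (fun p : TS => s p.1 p.2).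
Proof.
move=> [fs sS ms] _ Y mY; rewrite setTI.
rewrite [X in measurable X](_ : _ =
  \bigcup_(x in range s) ((s @^-1` [set x] : set (measurableTypeR R)) `*` (x @^-1` Y))).
  apply: fin_bigcup_measurable => // x [t _ <-]; apply: measurableX => //.
  have [cx _] : Cb (s t) by apply: sS; exists t.
  rewrite -[X in measurable X]setTI.
  exact: (@mbasis_continuous_measurable R _ S6 _ (mbasis_space6 R) cx measurableT Y mY).
apply/seteqP; split=> [[t z] /= Ytz|[t z] /= [x [t' _ <-]] [/= <-]//].
by exists (s t); [exists t|split].
Qed.

Let cvg0_lt (u : nat -> \bar R) (e : R) : u @ \oo --> 0%E -> 0 < e ->
  \forall n \near \oo, (u n < e%:E)%E.
Proof.
move=> u0 e0; apply: (u0 [set y | (y < e%:E)%E]); apply: open_nbhs_nbhs.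
by split; [exact: open_ereal_lt_ereal|rewrite /= lte_fin].
Qed.

(** The approximating simple maps converge uniformly in [z] off a null set of times. Cutting that
    set out makes the limit jointly measurable, and changes [F] only there and outside [[0, T]]. *)
Lemma strongly_measurable_version (T : R) (F : R -> S6 -> R) :
  strongly_measurable T (@Cb _ R S6) (@sup_norm _ R S6) F ->
  exists F' : R -> S6 -> R, measurable_fun setT (fun p : TS => F' p.1 p.2) /\
    {ae mu, forall t : R, 0 <= t <= T -> F' t = F t}.
Proof.
move=> [s ss [N [mN N0 sN]]].
pose G : set (measurableTypeR R) := `[0, T]%classic `\` N.
have mG : measurable G by apply: measurableD => //; exact: meas_itv.
have GP t : G t -> @sup_norm _ R S6 (s n t - F t) @[n --> \oo] --> 0%E.
  move=> [t0 tN]; apply: contrapT => H; apply: tN; apply: sN => /= K.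
  exact: H (K t0).
exists (fun t z => \1_G t * F t z); split; last first.
  exists N; split=> // t /= H; apply: contrapT => tN; apply: H => t0.
  by apply/funext => z; rewrite indicE mem_set ?mul1r//; split=> //; rewrite /= in_itv.
apply: (@measurable_fun_cvg _ _ R setT (fun n (p : TS) => \1_G p.1 * s n p.1 p.2)) => //.
- move=> n; apply: measurable_funM; last exact: simple_map_measurable.
  by apply: measurableT_comp; [exact: measurable_indic|exact: measurable_fst].
- move=> [t z] _ /=; rewrite indicE.
  case: (boolP (t \in G)) => [/set_mem /GP st|_]; last first.
    by rewrite mul0r; apply: cvg_near_cst; apply: nearW => n; rewrite mul0r.
  rewrite mul1r; under eq_cvg do rewrite mul1r.
  apply/cvgrPdist_le => e e0.
  have H := cvg0_lt st e0.
  apply: filterS H => n /ltW sn; rewrite distrC -lee_fin; apply: le_trans sn.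
  by apply: ereal_sup_ubound; exists z.
Qed.
End BochnerVersion.

(** * Uniform bounds from continuity in time *)

Section UniformC1.
Variable R : realType.
Local Notation S6 := (space6 R).
Local Notation nC1 := (@C1b_norm _ R S6 6 (@basis6 R)).
Local Notation sC1 := (@C1b _ R S6 6 (@basis6 R)).

Let sup_norm_ge0 (h : S6 -> R) : (0 <= @sup_norm _ R S6 h)%E.
Proof. by apply: le_trans (_ : `|h 0|%:E <= _)%E; [rewrite lee_fin|apply: ereal_sup_ubound; exists 0]. Qed.

Lemma C1b_norm_ge (h : S6 -> R) z : (`|h z|%:E <= nC1 h)%E.
Proof.
apply: le_trans (_ : @sup_norm _ R S6 h <= _)%E; first by apply: ereal_sup_ubound; exists z.
by rewrite /C1b_norm leeDl// sume_ge0.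
Qed.

Lemma C1b_norm_pd_ge (h : S6 -> R) i z : (`|pd i h z|%:E <= nC1 h)%E.
Proof.
apply: le_trans (_ : @sup_norm _ R S6 (pd i h) <= _)%E; first by apply: ereal_sup_ubound; exists z.
rewrite /C1b_norm (bigD1 i)//= addeCA.
by apply: leeDl; apply: adde_ge0; [exact: sup_norm_ge0|exact: sume_ge0].
Qed.

Variables (T : R) (f : R -> S6 -> R).
Hypothesis cf : continuous_in T sC1 nC1 f.

Lemma C1b_in t : 0 <= t <= T -> sC1 (f t).
Proof. by move=> t0; have [] := cf (t0 : t \in `[0, T]). Qed.

Lemma C1b_der t i z : 0 <= t <= T -> derivable (f t) z (@basis6 R i).
Proof. by move=> /C1b_in[[d _] _]; exact: (d [::]). Qed.

Lemma C1b_near t0 (e : R) : 0 <= t0 <= T -> 0 < e ->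
  \forall t \near within `[0, T]%classic (nbhs t0), (nC1 (f t - f t0)%R < e%:E)%E.
Proof.
move=> t00 e0; have [_ c] := cf (t00 : t0 \in `[0, T]).
apply: (c [set y | (y < e%:E)%E]); apply: open_nbhs_nbhs.
by split; [exact: open_ereal_lt_ereal|rewrite /= lte_fin].
Qed.

Lemma C1b_continuous z : {within `[0, T]%classic, continuous (fun t => f t z)}.
Proof.
apply/subspace_continuousP => t0 t00; apply/cvgrPdist_lt => e e0.
have := C1b_near t00 e0; apply: filterS => t tt0.
by rewrite distrC -lte_fin; apply: le_lt_trans tt0; exact: (C1b_norm_ge (f t - f t0)).
Qed.

(** Near each time the [C^1] norm exceeds its value there by less than [1]; compactness of [[0, T]]
    gives one constant. *)
Lemma C1b_uniform : exists C : R, forall t, 0 <= t <= T ->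
  (forall z, `|f t z| <= C) /\ forall i z, `|pd i (f t) z| <= C.
Proof.
have /compact_near_coveringP cov := @segment_compact R 0 T.
have := cov R (pinfty_nbhs R) (fun C t => 0 <= t <= T ->
  (forall z, `|f t z| <= C) /\ forall i z, `|pd i (f t) z| <= C) _ _.
case=> [t0 t00|M [_ MP]].
  have /C1b_in[_ N0] := (t00 : 0 <= t0 <= T).
  have := C1b_near t00 ltr01; rewrite near_withinE => H.
  have Nf : nC1 (f t0) \is a fin_num.
    by rewrite ge0_fin_numE//; apply: le_trans (C1b_norm_ge (f t0) 0); rewrite lee_fin.
  have bd (u v w : R) : (`|(v - u)%R|%:E <= w%:E)%E -> w < 1 -> (`|u|%:E <= nC1 (f t0))%E ->
      `|v| <= fine (nC1 (f t0)) + 1.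
    rewrite lee_fin => vu w1; rewrite -(fineK Nf) lee_fin => u0.
    rewrite -[v](subrK u); apply: le_trans (ler_normD _ _) _.
    by rewrite addrC lerD// (le_trans vu)// ltW.
  exists ([set t | t \in `[0, T] -> (nC1 (f t - f t0)%R < 1%:E)%E],
      [set C | fine (nC1 (f t0)) + 1 < C]) => /=.
    by split; [exact: H|exists (fine (nC1 (f t0)) + 1); split=> //; exact: num_real].
  move=> [t C] /= [Ht HC] t1; have {}Ht := Ht t1.
  have ft0 : (0 <= nC1 (f t - f t0)%R)%E.
    by apply: le_trans (C1b_norm_ge (f t - f t0) 0); rewrite lee_fin.
  have wf : nC1 (f t - f t0) \is a fin_num.
    by rewrite (ge0_fin_numE ft0); exact: lt_trans Ht (ltry _).
  have w1 : fine (nC1 (f t - f t0)) < 1 by rewrite -lte_fin fineK.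
  split=> [z|i z]; apply: le_trans _ (ltW HC).
    apply: (bd (f t0 z) _ _ _ w1 (C1b_norm_ge (f t0) z)).
    by rewrite (fineK wf); exact: (C1b_norm_ge (f t - f t0)).
  apply: (bd (pd i (f t0) z) _ _ _ w1 (C1b_norm_pd_ge (f t0) i z)).
  rewrite (fineK wf); have := C1b_norm_pd_ge (f t - f t0) i z.
  by rewrite /pd deriveB//; exact: C1b_der.
exists (M + 1) => t t0; apply: (MP (M + 1) _ t) => //.
by rewrite ltrDl.
Qed.
End UniformC1.

(** * What is used of a strong solution *)

Section TimeRegularity.
Variable R : realType.
Local Notation mu := (@lebesgue_measure R).
Local Notation leb6 := (@leb6 R).
Local Notation S6 := (space6 R).
Local Notation box6 := (@box R _ S6).
Local Notation TS := (measurableTypeR R * S6)%type.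

Lemma lebesgue_ae2 (P Q S : R -> Prop) : (forall t, P t -> Q t -> S t) ->
  {ae mu, forall t : R, P t} -> {ae mu, forall t : R, Q t} -> {ae mu, forall t : R, S t}.
Proof.
by move=> PQS; apply: filterS2 => //; exact: (ae_filter_ringOfSetsType mu).
Qed.

Lemma lebesgue_aeS (P Q : R -> Prop) : (forall t, P t -> Q t) ->
  {ae mu, forall t : R, P t} -> {ae mu, forall t : R, Q t}.
Proof. by move=> PQ; apply: filterS => //; exact: (ae_filter_ringOfSetsType mu). Qed.

Let box_le r r' (z : S6) : r <= r' -> box6 r z -> box6 r' z.
Proof. by move=> rr bz; exact: le_trans bz rr. Qed.

Lemma ball6_box r (z : S6) : ball6 r z -> box6 r z.
Proof.
rewrite /ball6 /= /enorm6 !dotE => /ltW zr; apply/box6P.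
have le (y s : R) : y ^+ 2 <= s -> Num.sqrt s <= r -> `|y| <= r.
  by move=> ys; apply: le_trans; rewrite -sqrtr_sqr ler_wsqrtr.
have := sqr_ge0 z.1.1.1; have := sqr_ge0 z.1.1.2; have := sqr_ge0 z.1.2.
have := sqr_ge0 z.2.1.1; have := sqr_ge0 z.2.1.2; have := sqr_ge0 z.2.2.
by rewrite !expr2 => p1 p2 p3 p4 p5 p6; split; apply/box3P; split;
  apply: le zr; rewrite expr2; lra.
Qed.

(* Bochner measurability only provides a representative measurable in [(t, z)] that *)
(* agrees with [F t] for almost every [t].                                          *)
Definition jointly_measurable (T : R) (F : R -> S6 -> R) :=
  exists F' : R -> S6 -> R, measurable_fun setT (fun p : TS => F' p.1 p.2) /\
    {ae mu, forall t : R, 0 <= t <= T -> F' t = F t}.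

(* [tr_bd] is uniform in [z]: it is what makes [Ft] integrable on space-time boxes. *)
Record time_regular (T r C : R) (F Ft : R -> S6 -> R) : Prop := TimeRegular {
  tr_c1 : forall t, 0 <= t <= T -> c1_supported r C (F t);
  tr_meas : jointly_measurable T F;
  tr_dmeas : jointly_measurable T Ft;
  tr_cont : forall z, {within `[0, T]%classic, continuous (fun t => F t z)};
  tr_int : forall z, intble mu `[0, T]%classic (Ft ^~ z);
  tr_prim : forall z t, 0 <= t <= T -> F t z = F 0 z + \int[mu]_(s in `[0, t]) Ft s z;
  tr_bd : exists D, forall z, \int[mu]_(t in `[0, T]) `|Ft t z| <= D }.

Lemma time_regularB T r C C' F Ft G Gt :
  time_regular T r C F Ft -> time_regular T r C' G Gt ->
  time_regular T r (C + C') (fun t z => F t z - G t z) (fun t z => Ft t z - Gt t z).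
Proof.
have jB A B : jointly_measurable T A -> jointly_measurable T B ->
    jointly_measurable T (fun t z => A t z - B t z).
  move=> [A' [mA eA]] [B' [mB eB]]; exists (fun t z => A' t z - B' t z); split.
    exact: measurable_funB.
  by apply: lebesgue_ae2 eA eB => t eA eB tT; rewrite eA// eB.
move=> [F1 F2 F3 F0 F4 F5 [D F6]] [G1 G2 G3 G0 G4 G5 [D' G6]].
have J := meas_itv `[0, T].
split.
- by move=> t tT; exact: c1_supportedB (F1 t tT) (G1 t tT).
- exact: jB.
- exact: jB.
- by move=> z t; apply: cvgB; [exact: F0|exact: G0].
- by move=> z; exact: intbleB.
- move=> z t tT; rewrite (F5 z t tT) (G5 z t tT).
  have sub : `[0, t]%classic `<=` (`[0, T]%classic : set R).
    by move=> s; rewrite /= !in_itv/= => /andP[-> /le_trans]; apply; case/andP: tT.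
  have It := meas_itv `[0, t].
  by rewrite (RintegralB It (intble_sub J It sub (F4 z)) (intble_sub J It sub (G4 z))); ring.
- exists (D + D') => z.
  apply: le_trans (_ : \int[mu]_(t in `[0, T]) (`|Ft t z| + `|Gt t z|) <= _).
    apply: (Rint_le J) => [||t _]; last exact: ler_normB.
      exact: intble_norm (intbleB J (F4 z) (G4 z)).
    exact: intbleD J (intble_norm (F4 z)) (intble_norm (G4 z)).
  by rewrite (RintegralD J (intble_norm (F4 z)) (intble_norm (G4 z))) lerD.
Qed.

Lemma jointly_measurable_slices T (F : R -> S6 -> R) : jointly_measurable T F ->
  {ae mu, forall t : R, 0 <= t <= T -> measurable_fun setT (F t)}.
Proof.
move=> [F' [mF eF]]; apply: lebesgue_aeS eF => t eF /eF <-.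
exact: measurableT_comp mF (pair1_measurable t).
Qed.

(** [G] is integrable on compact subintervals of []0, T[], which exhaust it; adding the two end
    points does not affect measurability. *)
Lemma weak_partial_measurable (T : R) (F G : R -> R) :
  weak_partial mu (@basis1 R) `]0, T[%classic [:: ord0] F G ->
  measurable_fun (`[0, T]%classic : set (measurableTypeR R)) G.
Proof.
move=> [_ lG _]; apply/measurable_fun_itv_obnd_cbndP/measurable_fun_itv_bndo_bndcP.
rewrite (_ : `]0, T[%classic = \bigcup_n `[n.+1%:R^-1, T - n.+1%:R^-1]%classic).
  apply/measurable_fun_bigcup => [n|n]; first exact: meas_itv.
  apply: (@intble_meas _ _ _ mu); apply: lG; first exact: segment_compact.
  move=> x; rewrite /= !in_itv/= => /andP[nx xn].
  have n0 : (0 : R) < n.+1%:R^-1 by rewrite invr_gt0.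
  by rewrite (lt_le_trans n0 nx) (le_lt_trans xn)// ltrBlDr ltrDl.
apply/seteqP; split=> [x|x [n _]]; rewrite /= !in_itv/= => /andP[x0 xT]; last first.
  have n0 : (0 : R) < n.+1%:R^-1 by rewrite invr_gt0.
  by rewrite (lt_le_trans n0 x0) (le_lt_trans xT)// ltrBlDr ltrDl.
have Tx : 0 < T - x by rewrite subr_gt0.
near \oo => n; exists n => //=; rewrite in_itv/=; apply/andP; split.
  by apply: ltW; near: n; exact: (near_infty_natSinv_lt (PosNum x0)).
rewrite lerBrDr addrC -lerBrDr; apply: ltW; near: n.
exact: (near_infty_natSinv_lt (PosNum Tx)).
Unshelve. all: end_near. Qed.

(** The constant is chosen before the radius, and any larger radius is allowed, so that state and
    costate can be placed in a common box. *)
Lemma solution_time_regular (T q rho : R) (F Ft : R -> S6 -> R) : 0 < T ->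
  solution_space T q F Ft ->
  (forall t : R, t \in `[0, T] -> tsupport (F t) `<=` @ball6 R rho) ->
  exists C, forall r', rho <= r' -> time_regular T r' C F Ft.
Proof.
move=> T0 [[[_ sF _] [_ sFt bFt] wF] cF _ _] sup.
have [C CP] := C1b_uniform cF.
have [D D0 DP] := bochner2_bound bFt.
exists C => r' rr'.
have mFt z := weak_partial_measurable (wF z).
split.
- move=> t tT; have [[d c] _] := C1b_in cF tT; have [C1 C2] := CP t tT.
  split=> //.
  + exact: (c [::]).
  + by move=> i z; exact: (d [::]).
  + by move=> i z; exact: (c [:: i] isT z).
  + move=> z nb; apply/eqP/negPn/negP => Fz; apply: nb.
    apply: (box_le rr').
    apply: ball6_box; apply: (sup t tT); exact: subset_closure.
- exact: strongly_measurable_version sF.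
- exact: strongly_measurable_version sFt.
- exact: C1b_continuous cF.
- by move=> z; have [] := DP z (mFt z).
- move=> z; apply: weak_derivative_primitive T0 (wF z) _ _; first exact: C1b_continuous cF z.
  by have [] := DP z (mFt z).
- by exists D => z; have [] := DP z (mFt z).
Qed.
End TimeRegularity.

(** * Time derivative of an integral of a product *)

Section TimeProduct.
Variable R : realType.
Local Notation mu := (@lebesgue_measure R).
Local Notation leb6 := (@leb6 R).
Local Notation S6 := (space6 R).
Local Notation box6 := (@box R _ S6).
Local Notation TS := (measurableTypeR R * S6)%type.
Variables (T r C C' : R) (F Ft G Gt : R -> S6 -> R).
Hypotheses (rF : time_regular T r C F Ft) (rG : time_regular T r C' G Gt).

Let J : set (measurableTypeR R) := `[0, T]%classic.
Let mJ : measurable J. Proof. exact: meas_itv. Qed.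
Let Jt t : (t \in J) = (0 <= t <= T). Proof. by rewrite mem_setE in_itv. Qed.

Let density (A At B Bt : R -> S6 -> R) (p : TS) : R :=
  At p.1 p.2 * B p.1 p.2 + A p.1 p.2 * Bt p.1 p.2.

Let ind_le1 U (A : set U) y : `|\1_A y : R| <= 1.
Proof. by rewrite indicE; case: (_ \in _); rewrite ?normr1 ?normr0. Qed.

Let density_out t z : 0 <= t <= T -> ~ box6 r z -> density F Ft G Gt (t, z) = 0.
Proof.
move=> tT zB; rewrite /density /= (c1s_supp (tr_c1 rF tT) zB) (c1s_supp (tr_c1 rG tT) zB).
by rewrite mulr0 mul0r addr0.
Qed.

(** A version of the integrand that is jointly measurable and vanishes outside [[0, T]] times the
    box, so that Fubini can be applied on the full product space. *)
Let density_cut : exists H : TS -> R, [/\ measurable_fun setT H,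
  forall t z, ~~ (0 <= t <= T) \/ ~ box6 r z -> H (t, z) = 0 &
  {ae mu, forall t : R, 0 <= t <= T -> forall z, H (t, z) = density F Ft G Gt (t, z)}].
Proof.
have [F' [mF eF]] := tr_meas rF; have [Ft' [mFt eFt]] := tr_dmeas rF.
have [G' [mG eG]] := tr_meas rG; have [Gt' [mGt eGt]] := tr_dmeas rG.
have mB := measurable_box6 r.
exists (fun p => \1_J p.1 * (\1_(box6 r) p.2 * density F' Ft' G' Gt' p)); split.
- apply: measurable_funM.
    by apply: measurableT_comp; [exact: measurable_indic|exact: measurable_fst].
  apply: measurable_funM.
    by apply: measurableT_comp; [exact: measurable_indic|exact: measurable_snd].
  by apply: measurable_funD; exact: measurable_funM.
- move=> t z [/negbTE tT|zB] /=; first by rewrite indicE Jt tT mul0r.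
  by rewrite [X in _ * (X * _)]indicE memNset// mul0r mulr0.
- have e1 := lebesgue_ae2 (fun t a b => conj a b) eF eFt.
  have e2 := lebesgue_ae2 (fun t a b => conj a b) eG eGt.
  apply: lebesgue_ae2 e1 e2 => t [eF' eFt'] [eG' eGt'] tT z.
  have -> : density F' Ft' G' Gt' (t, z) = density F Ft G Gt (t, z).
    by rewrite /density /= eF'// eFt'// eG'// eGt'.
  rewrite /= indicE Jt tT mul1r indicE.
  case: (boolP (z \in box6 r)) => [_|zB]; first by rewrite mul1r.
  by rewrite mul0r density_out// => zb; move/negP: zB; apply; rewrite inE.
Qed.

(** At each fixed [z] the product rule is [primitive_mul]; integrating it over [z] and exchanging
    the integrals shows that [e] is the derivative of [int F G] in integrated form. *)
Lemma time_product : 0 <= T -> exists e : R -> R, [/\ intble mu `[0, T]%classic e,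
  {ae mu, forall t : R, 0 <= t <= T ->
     intble leb6 setT (fun z => Ft t z * G t z + F t z * Gt t z) /\
     e t = \int[leb6]_z (Ft t z * G t z + F t z * Gt t z)} &
  forall t, 0 <= t <= T ->
    \int[leb6]_z (F t z * G t z) - \int[leb6]_z (F 0 z * G 0 z) = \int[mu]_(s in `[0, t]) e s].
Proof.
move=> T0; have [H [mH H0 HE]] := density_cut.
have [D DP] := tr_bd rF; have [D' DP'] := tr_bd rG.
have C0 t : 0 <= t <= T -> 0 <= C by move=> tT; exact: c1s_C0 (tr_c1 rF tT).
have mHz z : measurable_fun setT (fun s : measurableTypeR R => H (s, z)).
  exact: measurableT_comp mH (pair2_measurable z).
pose k z s := C' * `|Ft s z| + C * `|Gt s z|.
have ki z : intble mu J (k z).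
  by apply: intbleD mJ (intbleZ _ mJ (intble_norm (tr_int rF z))) (intbleZ _ mJ (intble_norm (tr_int rG z))).
have Hk z : {ae mu, forall s : R, True -> `|H (s, z)| <= \1_J s * k z s}.
  apply: lebesgue_aeS HE => s Hs _.
  have [sT|sT] := boolP (0 <= s <= T); last first.
    by rewrite H0; [rewrite normr0 indicE Jt (negbTE sT) mul0r|left].
  rewrite indicE Jt sT mul1r Hs// /density /k /=.
  apply: le_trans (ler_normD _ _) _; rewrite !normrM lerD//.
    by rewrite mulrC ler_wpM2r// (c1s_bd (tr_c1 rG sT)).
  by rewrite ler_wpM2r// (c1s_bd (tr_c1 rF sT)).
have Ki z : intble mu setT (fun s => \1_J s * k z s) by exact: ((intble_indicM _ _ mJ).1 (ki z)).
have Hzi z : intble mu setT (fun s => H (s, z)) by apply: (intble_aele measurableT (mHz z) (Hk z) (Ki z)).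
(* The time integrals are bounded uniformly over the box by [tr_bd], and the box has finite measure;
   this is what Tonelli needs. *)
have Hbd z : \int[mu]_s `|H (s, z)| <= \1_(box6 r) z * (C' * D + C * D').
  rewrite indicE; case: (boolP (z \in box6 r)) => [_|zB]; last first.
    rewrite mul0r Rint_eq0// => s _; rewrite H0 ?normr0//; right=> zb.
    by move/negP: zB; apply; rewrite inE.
  rewrite mul1r; apply: le_trans (Rint_aele measurableT (intble_norm (Hzi z)) (Ki z) (Hk z)) _.
  rewrite -Rint_indicM /k (RintegralD mJ (intbleZ _ mJ (intble_norm (tr_int rF z))) (intbleZ _ mJ (intble_norm (tr_int rG z)))).
  have TT : 0 <= T <= T by rewrite T0 lexx.
  rewrite (RintegralZl _ mJ (intble_norm (tr_int rF z))) (RintegralZl _ mJ (intble_norm (tr_int rG z))).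
  by apply: lerD; rewrite ler_wpM2l ?(c1s_C0 (tr_c1 rF TT)) ?(c1s_C0 (tr_c1 rG TT)).
have Bi : intble leb6 setT (fun z => \1_(box6 r) z * (C' * D + C * D')).
  apply: (intble_indicM leb6 (fun=> _) (measurable_box6 r)).1.
  by apply: (intble_cst _ (measurable_box6 r)); exact: finite_boxes_leb6.
have Hi : intble (mu \x leb6)%E setT H.
  apply: (tonelli_intble2 mH Bi); apply: aeW => z.
  apply: le_trans (_ : (\int[mu]_s `|H (s, z)|)%:E <= _)%E; last by rewrite lee_fin.
  by rewrite /Rintegral fineK//; exact: (integrable_fin_num measurableT (intble_norm (Hzi z))).
pose e s := \int[leb6]_z H (s, z).
have ei : intble mu setT e := fubini_intble1 Hi.
exists e; split.
- exact: (intble_sub measurableT mJ _ ei).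
- apply: lebesgue_ae2 HE (fubini_ae1 Hi) => t Ht Hit tT; split.
    by apply: intble_ext Hit => z; rewrite Ht.
  by apply: eq_Rintegral => z _; rewrite Ht.
move=> t tT; pose I : set (measurableTypeR R) := `[0, t]%classic.
have mI : measurable I by exact: meas_itv.
have IJ : I `<=` J.
  by move=> s; rewrite /I /J /= !in_itv/= => /andP[-> /le_trans]; apply; case/andP: tT.
have HIi : intble (mu \x leb6)%E setT (fun p => \1_I p.1 * H p).
  apply: (intble_mul_bd (C := 1) measurableT _ _ Hi) => [|p _]; last exact: ind_le1.
  by apply: measurableT_comp; [exact: measurable_indic|exact: measurable_fst].
have -> : \int[mu]_(s in `[0, t]) e s = \int[leb6]_z \int[mu]_s (\1_I s * H (s, z)).
  rewrite -(fubiniR2 HIi) (fubiniR1 HIi) Rint_indicM; apply: eq_Rintegral => s _ /=.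
  rewrite /e; have [sI|sI] := boolP (s \in I); rewrite indicE ?sI ?(negbTE sI).
    by rewrite mul1r; apply: eq_Rintegral => z _; rewrite mul1r.
  by rewrite mul0r Rint_eq0// => z _; rewrite mul0r.
have FGi s : 0 <= s <= T -> intble leb6 setT (fun z => F s z * G s z).
  move=> sT; apply: (intble_mul_bd measurableT _ _ (c1s_intble (tr_c1 rG sT))).
    exact: c1s_meas (tr_c1 rF sT).
  by move=> z _; exact: c1s_bd (tr_c1 rF sT) z.
have T00 : 0 <= (0 : R) <= T by rewrite lexx.
rewrite -(RintegralB measurableT (FGi t tT) (FGi 0 T00)); apply: eq_Rintegral => z _.
have cm (h : R -> R) : {within `[0, T]%classic, continuous h} -> measurable_fun I h.
  move=> ch; apply: (measurable_funS mJ IJ).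
  by apply: subspace_continuous_measurable_fun.
have mFt : measurable_fun I (Ft ^~ z).
  exact: intble_meas (intble_sub mJ mI IJ (tr_int rF z)).
have mGt : measurable_fun I (Gt ^~ z).
  exact: intble_meas (intble_sub mJ mI IJ (tr_int rG z)).
have /andP[t0 tT'] := tT.
rewrite -Rint_indicM (primitive_mul t0 (intble_sub mJ mI IJ (tr_int rF z))
  (intble_sub mJ mI IJ (tr_int rG z)) (F := fun s => F s z) (G := fun s => G s z)).
- apply: Rint_aeeq => //.
  + by apply: measurable_funD; apply: measurable_funM => //; apply: cm; [exact: tr_cont rG z|exact: tr_cont rF z].
  + exact: measurable_funS (mHz z).
  + apply: lebesgue_aeS HE => s Hs /IJ sJ; rewrite Hs//.
- by move=> s /andP[s0 st]; apply: (tr_prim rF); rewrite s0 (le_trans st).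
- by move=> s /andP[s0 st]; apply: (tr_prim rG); rewrite s0 (le_trans st).
Qed.
End TimeProduct.

Section AeProduct.
Context d1 d2 (T1 : measurableType d1) (T2 : measurableType d2) (R : realType).
Variables (m1 : {sigma_finite_measure set T1 -> \bar R})
  (m2 : {sigma_finite_measure set T2 -> \bar R}).

(** The exceptional set is enclosed in a measurable null set, almost all of whose slices have
    measure zero by Tonelli. *)
Lemma ae_product_slices (P : T1 * T2 -> Prop) : {ae (m1 \x m2)%E, forall p, P p} ->
  {ae m1, forall x, {ae m2, forall y, P (x, y)}}.
Proof.
move=> [N [mN N0 PN]].
have mS : measurable_fun setT (m2 \o xsection N) by exact: measurable_fun_xsection.
have S0 : ae_eq m1 setT (m2 \o xsection N) (cst 0%E).
  apply/(ae_eq_integral_abs _ measurableT mS); rewrite -[RHS]N0.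
  by apply: eq_integral => x _; rewrite gee0_abs.
apply: filterS S0 => x /(_ I) Sx.
exists (xsection N x); split => //; first exact: measurable_xsection.
by move=> y /= nP; rewrite /xsection /= inE; exact: PN.
Qed.
End AeProduct.

Section Gronwall.
Variable R : realType.
Local Notation mu := (@lebesgue_measure R).

(* With [S = sup E e^(-2 k t)] the hypothesis gives [S <= A + S / 2]. *)
Lemma gronwall (T k A B : R) (E : R -> R) : 0 < k -> 0 <= A ->
  (forall t, 0 <= t <= T -> E t <= B) ->
  {within `[0, T]%classic, continuous E} ->
  (forall t, 0 <= t <= T -> E t <= A + k * \int[mu]_(s in `[0, t]) E s) ->
  forall t, 0 <= t <= T -> E t <= 2 * A * expR (2 * k * t).
Proof.
move=> k0 A0 EB cE HE.
pose S := sup [set y | exists2 t, 0 <= t <= T & y = E t * expR (- (2 * k * t))].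
have k2 : 0 < 2 * k by rewrite mulr_gt0.
move=> t0 t0T.
have hS : has_sup [set y | exists2 t, 0 <= t <= T & y = E t * expR (- (2 * k * t))].
  split; first by exists (E t0 * expR (- (2 * k * t0))), t0.
  exists (Num.max B 0) => _ [t tT ->].
  have [Et|Et] := leP (E t) 0.
    by rewrite le_max (mulr_le0_ge0 Et (expR_ge0 _)) orbT.
  rewrite le_max; apply/orP; left; apply: le_trans (EB t tT).
  rewrite (ler_piMr (ltW Et))// -[leRHS]expR0 ler_expR oppr_le0 mulr_ge0 ?(ltW k2)//.
  by case/andP: tT.
have ES t : 0 <= t <= T -> E t <= S * expR (2 * k * t).
  move=> tT; rewrite -ler_pdivrMr ?expR_gt0// -expRN.
  by apply: sup_upper_bound => //; exists t.
have SA : S <= 2 * A.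
  have [S0|S0] := leP S 0; first by apply: le_trans S0 _; rewrite mulr_ge0.
  suff : S <= A + S / 2 by lra.
  apply: sup_le_ub; first by case: hS.
  move=> _ [t tT ->]; have /andP[t0' tT'] := tT.
  rewrite expRN ler_pdivrMr ?expR_gt0//.
  apply: le_trans (HE t tT) _.
  have daff (x : R) : is_derive x (1 : R) (fun s : R => 2 * k * s) (2 * k).
    by apply: is_derive_eq; rewrite /GRing.scale /= mulr1.
  have dE (x : R) : is_derive x (1 : R) (fun s : R => expR (2 * k * s)) (expR (2 * k * x) * (2 * k)).
    exact: (@is_derive1_comp _ (@expR R) (fun s : R => 2 * k * s)).
  have cexp : continuous (fun s : R => expR (2 * k * s) * (2 * k)).
    have ce : continuous (fun s : R => expR (2 * k * s)).
      by move=> x; apply/differentiable_continuous/derivable1_diffP; case: (dE x).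
    by move=> x; apply: cvgM; [exact: ce|exact: cvg_cst].
  have mI := meas_itv `[0, t].
  have Ei : intble mu `[0, t]%classic E.
    apply: (@continuous_compact_integrable); first exact: segment_compact.
    apply: continuous_subspaceW cE => s.
    by rewrite /= !in_itv/= => /andP[-> /le_trans]; apply.
  have xi := intble_cont 0 t cexp.
  have cmp : \int[mu]_(s in `[0, t]) E s <= S / (2 * k) * (expR (2 * k * t) - 1).
    have -> : S / (2 * k) * (expR (2 * k * t) - 1) =
        \int[mu]_(s in `[0, t]) (S / (2 * k) * (expR (2 * k * s) * (2 * k))).
      rewrite (RintegralZl _ mI xi); congr (_ * _).
      move: t0'; rewrite le_eqVlt => /predU1P[<-|t0']; last first.
        by rewrite (Rint_derive dE cexp t0') mulr0 expR0.
      by rewrite mulr0 expR0 subrr set_itv1 Rintegral_set1.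
    apply: (Rint_le mI Ei (intbleZ _ mI xi)) => s; rewrite /= in_itv/= => /andP[s0 st].
    have := ES s; rewrite s0 (le_trans st tT') => /(_ isT) /le_trans; apply.
    by rewrite le_eqVlt; apply/orP; left; apply/eqP; field; rewrite gt_eqF.
  have e1 : 1 <= expR (2 * k * t) by rewrite -[leLHS]expR0 ler_expR mulr_ge0// ltW.
  apply: le_trans (_ : A + k * (S / (2 * k) * (expR (2 * k * t) - 1)) <= _).
    by rewrite lerD2l (ler_wpM2l (ltW k0)).
  have -> : k * (S / (2 * k) * (expR (2 * k * t) - 1)) = S / 2 * (expR (2 * k * t) - 1).
    by field; rewrite gt_eqF.
  have : A <= A * expR (2 * k * t) by rewrite ler_peMr.
  by rewrite mulrDl mulrBr mulr1 => ?; lra.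
apply: le_trans (ES t0 t0T) _.
by rewrite ler_wpM2r ?expR_ge0.
Qed.
End Gronwall.

(** * Continuity of the pairing with the control fields *)

Section PairingContinuity.
Variables (R : realType) (N : nat) (m : 'I_N -> space3 R -> space3 R).
Local Notation leb6 := (@leb6 R).
Local Notation S6 := (space6 R).
Local Notation box6 := (@box R _ S6).
Hypothesis m1 : forall k, loc_intble_field (m k).

Let prod_diff (a q q' g g' e C C' : R) : `|q - q'| <= e -> `|g - g'| <= e ->
  `|g| <= C -> `|q'| <= C' -> `|q * a * g - q' * a * g'| <= e * (C + C') * `|a|.
Proof.
move=> qq gg gC qC.
have -> : q * a * g - q' * a * g' = ((q - q') * g + q' * (g - g')) * a by ring.
rewrite normrM ler_wpM2r//; apply: le_trans (ler_normD _ _) _.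
rewrite [in leRHS]mulrDr [`|_ * g|]normrM [`|_ * (g - g')|]normrM; apply: lerD; first exact: ler_pM.
by rewrite mulrC ler_pM.
Qed.

(** The pairing is bilinear in the velocity gradient of [F] and in [G], with a weight integrable
    over the box; [D] depends only on that weight and on the common bounds, so it is the same at all
    times. *)
Lemma cross_der_pairing_lipschitz k r C C' : exists2 D : R, 0 <= D &
  forall e F F' G G', c1_supported r C F -> c1_supported r C F' ->
  c1_supported r C' G -> c1_supported r C' G' ->
  (forall i z, `|pd i F z - pd i F' z| <= e) -> (forall z, `|G z - G' z| <= e) ->
  `|\int[leb6]_z (cross_der m F k z * G z) - \int[leb6]_z (cross_der m F' k z * G' z)| <= e * D.
Proof.
pose a i (z : S6) := \1_(box6 r) z * coord (cross z.2 (m k z.1)) i.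
have ai i : intble leb6 setT (a i) by exact: (intble_cross r i (m1 k)).
pose A i := \int[leb6]_z `|a i z|.
have A0 i : 0 <= A i by rewrite /A /Rintegral fine_ge0// integral_ge0.
have [C0|C0] := leP 0 C; last first.
  by exists 0 => // e F F' G G' /c1s_C0; rewrite leNgt C0.
have [C0'|C0'] := leP 0 C'; last first.
  by exists 0 => // e F F' G G' _ _ /c1s_C0; rewrite leNgt C0'.
exists ((C' + C) * \sum_i A i) => [|e F F' G G' cF cF' cG cG' FF GG].
  by rewrite mulr_ge0 ?addr_ge0// sumr_ge0.
have i1 := intble_cross_der m1 k cF (c1s_bd_supported cG).
have i2 := intble_cross_der m1 k cF' (c1s_bd_supported cG').
rewrite -(RintegralB measurableT i1 i2).
have bi : intble leb6 setT (fun z => e * (C' + C) * \sum_i `|a i z|).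
  by apply: intbleZ => //; apply: intble_sum => // i; exact: intble_norm.
apply: le_trans (Rint_norm_le measurableT (intble_meas (intbleB measurableT i1 i2)) bi _) _.
  apply: aeW => z _; rewrite mulr_sumr /cross_der !dot_gradv !mulr_suml -sumrB.
  apply: le_trans (ler_norm_sum _ _ _) _; apply: ler_sum => i _.
  have [zb|zb] := pselect (box6 r z); last first.
    rewrite (c1s_supp cG zb) (c1s_supp cG' zb) !mulr0 subrr normr0.
    rewrite mulr_ge0// mulr_ge0 ?addr_ge0//; exact: le_trans (normr_ge0 _) (GG z).
  rewrite /a indicE mem_set// mul1r ![coord _ _ * _]mulrC.
  by apply: prod_diff => //; [exact: c1s_bd cG z|exact: c1s_dbd cF' _ z].
rewrite RintegralZl//; last by apply: intble_sum => // i; exact: intble_norm.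
by rewrite Rint_sum// => [|i]; [rewrite mulrA|exact: intble_norm].
Qed.
End PairingContinuity.

(** * Optimality *)

Section SquareIntegrable.
Variables (R : realType) (T : R).
Local Notation mu := (@lebesgue_measure R).
Local Notation J := (`[0, T]%classic : set (measurableTypeR R)).
Implicit Types x y : R -> R.

Let mJ : measurable J. Proof. exact: meas_itv. Qed.

Lemma L2_intble x : L2 T x -> intble mu J (fun t => x t ^+ 2).
Proof. by case. Qed.

Lemma L2_mul x y : L2 T x -> L2 T y -> intble mu J (fun t => x t * y t).
Proof.
move=> [mx ix] [my iy].
apply: (intble_le mJ (measurable_funM mx my) _ (intbleD mJ ix iy)) => t _.
have n2 (z : R) : z ^+ 2 = `|z| ^+ 2 by rewrite real_normK ?num_real.
rewrite normrM [in leRHS]n2 [y t ^+ 2]n2; have := sqr_ge0 (`|x t| - `|y t|).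
by have := mulr_ge0 (normr_ge0 (x t)) (normr_ge0 (y t)); nra.
Qed.

Lemma L2_bd x y : measurable_fun J x -> L2 T y ->
  {ae mu, forall t : R, 0 <= t <= T -> `|x t| <= y t} -> L2 T x.
Proof.
move=> mx [my iy] xy; split=> //.
have mx2 : measurable_fun J (fun t => x t ^+ 2) by exact: measurable_funX.
apply: (intble_aele mJ mx2 _ iy); apply: lebesgue_aeS xy => t xy; rewrite /= in_itv => /xy h.
by rewrite normrX lerXn2r ?nnegrE ?(le_trans (normr_ge0 _) h).
Qed.

Lemma L2_add x y (c : R) : L2 T x -> L2 T y -> L2 T (fun t => x t + c * y t).
Proof.
move=> [mx ix] [my iy].
have mz : measurable_fun J (fun t => x t + c * y t).
  by apply: measurable_funD => //; apply: measurable_funM => //; exact: measurable_cst.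
split=> //; have mz2 : measurable_fun J (fun t => (x t + c * y t) ^+ 2) by exact: measurable_funX.
apply: (intble_le mJ mz2 _ (intbleD mJ (intbleZ 2 mJ ix) (intbleZ (2 * c ^+ 2) mJ iy))) => t _.
by rewrite ger0_norm ?sqr_ge0//; have := sqr_ge0 (x t - c * y t); nra.
Qed.

Lemma L2_cont x : {within `[0, T]%classic, continuous x} -> L2 T x.
Proof.
move=> cx; split; first by apply: subspace_continuous_measurable_fun.
apply: continuous_compact_integrable; first exact: segment_compact.
move/subspace_continuousP in cx; apply/subspace_continuousP => t tJ.
by apply: (@cvgM R _ _ _ x x); exact: cx.
Qed.
End SquareIntegrable.

(** * Projection onto an interval *)

Section Projection.
Variable R : realType.
Implicit Types a b xi w lam p : R.

Lemma proj_itvP a b xi : a <= b -> a <= proj_itv a b xi <= b.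
Proof. by move=> ab; rewrite /proj_itv le_min ge_min le_max !lexx ab !orbT. Qed.

(** With [q = p / lam] the first factor is [lam] times the projection of [q] minus [q]. It is zero
    when [q] lies between [a] and [b], nonnegative when the projection is [a], and nonpositive when
    it is [b]; the second factor has the matching sign. *)
Lemma proj_itv_vi lam a b p w : 0 < lam -> a <= w <= b ->
  0 <= (lam * proj_itv a b (lam^-1 * p) - p) * (w - proj_itv a b (lam^-1 * p)).
Proof.
move=> l0 /andP[aw wb]; have ab := le_trans aw wb.
have pE : p = lam * (lam^-1 * p) by rewrite mulrA divff ?mul1r ?gt_eqF.
rewrite {1}[X in _ - X]pE -mulrBr -mulrA mulr_ge0 ?(ltW l0)//.
set q := lam^-1 * p; rewrite /proj_itv.
have [qa|aq] := leP q a.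
  rewrite (min_idPl ab) mulr_ge0 ?subr_ge0//.
have [qb|bq] := leP q b; first by rewrite subrr mul0r.
by rewrite mulr_le0 ?subr_le0// ltW.
Qed.

(** Strong monotonicity: replacing [w] by its projection in the first factor of [proj_itv_vi] costs
    exactly [lam] times the squared distance. *)
Lemma proj_itv_gap lam a b p w : 0 < lam -> a <= w <= b ->
  (lam * w - p) * (proj_itv a b (lam^-1 * p) - w) <=
  - lam * (proj_itv a b (lam^-1 * p) - w) ^+ 2.
Proof.
move=> l0 aw; have := proj_itv_vi p l0 aw; set q := proj_itv _ _ _.
by nra.
Qed.
End Projection.

Section VariationalInequality.
Variables (R : realType) (T : R) (N : nat) (lam : 'I_N -> R).
Variables (a b p ubar : 'I_N -> R -> R).
Local Notation mu := (@lebesgue_measure R).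
Local Notation J := (`[0, T]%classic : set (measurableTypeR R)).
Hypotheses (lam_gt0 : forall i, 0 < lam i)
  (a_L2 : forall i, L2 T (a i)) (b_L2 : forall i, L2 T (b i))
  (ab0 : forall i, {ae mu, forall t, t \in `[0, T] -> a i t <= 0 <= b i t})
  (p_L2 : forall i, L2 T (p i)) (ubar_adm : admissible T a b ubar).

Let mJ : measurable J. Proof. exact: meas_itv. Qed.

(** The projection [v] is itself admissible. Testing with it and using [proj_itv_gap] bounds [lam]
    times the integral of [(v - ubar)^2] by [0]. Conversely the integrand is nonnegative almost
    everywhere by [proj_itv_vi]. *)
Lemma vi_projection : variational_inequality T lam a b p ubar <->
  projection_formula T lam a b p ubar.
Proof.
pose v i t := proj_itv (a i t) (b i t) ((lam i)^-1 * p i t).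
have q_L2 i : L2 T (fun t => lam i * ubar i t - p i t).
  have [uL _] := ubar_adm i.
  have := L2_add (lam i - 1) (L2_add (-1) uL (p_L2 i)) uL.
  by congr (L2 T); apply/funext => t; ring.
have v_adm : admissible T a b v.
  move=> i; have mv : measurable_fun J (v i).
    have [ma _] := a_L2 i; have [mb _] := b_L2 i; have [mp _] := p_L2 i.
    apply: measurable_minr => //; apply: measurable_maxr => //.
    by apply: measurable_funM => //; exact: measurable_cst.
  have vab : {ae mu, forall t, t \in `[0, T] -> a i t <= v i t <= b i t}.
    apply: lebesgue_aeS (ab0 i) => t h tT; apply: proj_itvP.
    by have /andP[a0 b0] := h tT; exact: le_trans a0 b0.
  (* Since [a <= 0 <= b], any value between [a] and [b] is at most [b - a] in absolute value. *)
  split=> //; apply: (L2_bd mv (L2_add (-1) (b_L2 i) (a_L2 i))).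
  apply: lebesgue_ae2 (ab0 i) vab => t h {}vab tT.
  have /andP[? ?] := h tT; have /andP[? ?] := vab tT.
  by rewrite ler_norml; apply/andP; split; lra.
split=> [vi|pf].
  have vu i : {ae mu, forall t, t \in `[0, T] -> ubar i t = v i t}.
    have [uL uab] := ubar_adm i; have [vL _] := v_adm i.
    have dL : L2 T (fun t => v i t + -1 * ubar i t) by exact: L2_add.
    have d2 := L2_intble dL.
    have le0 : \int[mu]_(t in J) ((v i t + -1 * ubar i t) ^+ 2) <= 0.
      have := vi v v_adm i.
      have dL' : L2 T (fun t => v i t - ubar i t).
        by move: dL; congr (L2 T); apply/funext => t; rewrite mulN1r.
      move/le_trans/(_ (Rint_aele mJ (L2_mul (q_L2 i) dL') (intbleZ (- lam i) mJ d2) _)).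
      rewrite (RintegralZl _ mJ d2) mulNr oppr_ge0 pmulr_rle0//; apply.
      apply: lebesgue_aeS uab => t uab; rewrite /= in_itv => tT.
      by rewrite mulN1r; apply: proj_itv_gap => //; exact: uab.
    have d20 : \int[mu]_(t in J) (v i t + -1 * ubar i t) ^+ 2 = 0.
      apply/eqP; rewrite eq_le le0 /=.
      by apply: (Rint_aege0 mJ d2); apply: aeW => t _; exact: sqr_ge0.
    have := ae_eq_integral_abs mu mJ (measurable_int mu d2).
    move=> [+ _]; rewrite (_ : (\int[mu]_(x in J) _)%E = 0%E) => [/(_ erefl)|]; last first.
      transitivity (\int[mu]_(t in J) ((v i t + -1 * ubar i t) ^+ 2)%:E)%E.
        by apply: eq_integral => t _; rewrite /= ger0_norm ?sqr_ge0.
      by apply: etrans (esym (fineK (integrable_fin_num mJ d2))) _; congr EFin.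
    apply: lebesgue_aeS => t H tT; have := H tT => /= -[] /eqP.
    by rewrite sqrf_eq0 mulN1r subr_eq0 => /eqP ->.
  have := @filter_forall _ _ (fun i t => t \in `[0, T] -> ubar i t = v i t) _
    (ae_filter_ringOfSetsType mu) vu.
  by apply: lebesgue_aeS => t H tT i; exact: H.
move=> u uadm i.
have [uL uab] := uadm i; have [ubL _] := ubar_adm i.
have dL : L2 T (fun t => u i t - ubar i t).
  have := L2_add (-1) uL ubL; congr (L2 T); apply/funext => t; rewrite mulN1r.
  by [].
apply: (Rint_aege0 mJ (L2_mul (q_L2 i) dL)).
apply: lebesgue_ae2 uab pf => t uab pf; rewrite /= in_itv => tT.
by rewrite (pf tT i) proj_itv_vi// uab.
Qed.
End VariationalInequality.

(** * Perturbation of the state over the whole time interval *)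

Section Perturbation.
Variables (R : realType) (N : nat) (m : 'I_N -> space3 R -> space3 R).
Local Notation mu := (@lebesgue_measure R).
Local Notation leb6 := (@leb6 R).
Local Notation S6 := (space6 R).
Hypotheses (m1 : forall k, loc_intble_field (m k))
  (m2 : forall k i, loc_intble3 (fun x => coord (m k x) i ^+ 2)).

Let meas_itv' (t : R) : measurable (`[0, t]%classic : set (measurableTypeR R)).
Proof. exact: meas_itv. Qed.

Let half_double (x y : R) : 2^-1 * (y * x + x * y) = x * y.
Proof. by field. Qed.

Let double_product (x y : R) : 2 * (x * y) = y * x + x * y.
Proof. by ring. Qed.

Lemma Rint_initial_le (T t : R) (h : R -> R) : 0 <= t <= T -> (forall s, 0 <= h s) ->
  intble mu `[0, T]%classic h ->
  \int[mu]_(s in `[0, t]) h s <= \int[mu]_(s in `[0, T]) h s.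
Proof.
move=> /andP[t0 tT] h0 hi.
have sub : `[0, t]%classic `<=` (`[0, T]%classic : set R).
  by move=> s; rewrite /= !in_itv/= => /andP[-> /le_trans]; apply.
have hti := intble_sub (meas_itv' T) (meas_itv' t) sub hi.
rewrite [leLHS]Rint_indicM [leRHS]Rint_indicM.
apply: (Rint_le measurableT ((intble_indicM _ _ (meas_itv' t)).1 hti)
  ((intble_indicM _ _ (meas_itv' T)).1 hi)) => s _.
rewrite ler_wpM2r// !indicE ler_nat; case: (boolP (s \in _)) => // st.
by rewrite mem_set//; apply: sub; exact: set_mem.
Qed.

(** The space-time equation with the control field in the form [combine], for state and costate
    alike: [f] supplies the potential and [h] is transported. *)
Definition vlasov_on (T : R) (c : 'I_N -> R -> R) (f h ht : R -> S6 -> R)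
    (rhs : R -> S6 -> R) :=
  {ae (mu \x leb6)%E, forall tz, (tz.1 : R) \in `[0, T] ->
     vlasov (potential (f tz.1)) (combine m (fun k => c k tz.1)) (h tz.1) (ht tz.1) tz.2
     = rhs tz.1 tz.2}.

Lemma vlasov_on_slices T c f h ht rhs : vlasov_on T c f h ht rhs ->
  {ae mu, forall t : R, 0 <= t <= T -> {ae leb6, forall z,
     vlasov (potential (f t)) (combine m (fun k => c k t)) (h t) (ht t) z = rhs t z}}.
Proof.
move=> /ae_product_slices; apply: lebesgue_aeS => t H tT; apply: filterS H => z; exact.
Qed.

(** [time_product] for [d d] and for [d g] turns the fixed-time bounds of [energy_step] into
    integral inequalities. Gronwall gives the first estimate, which is then inserted into the
    second. [K] is chosen before the perturbed state, hence is uniform over all increments. *)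
Lemma state_perturbation (T r Cf Cg : R) (c : 'I_N -> R -> R)
    (f ft g gt : R -> S6 -> R) (chi : S6 -> R) : 0 < T -> 0 < r ->
  time_regular T r Cf f ft -> time_regular T r Cg g gt ->
  vlasov_on T c f f ft (fun _ _ => 0) ->
  vlasov_on T c f g gt (fun t z => Phi (f t) (g t) z.1 * chi z) ->
  (forall k, L2 T (p_fun m f g k)) ->
  exists2 K : R, 0 <= K & forall Ch (fh fht : R -> S6 -> R) (e : 'I_N -> R -> R),
  time_regular T r Ch fh fht -> (forall k, L2 T (e k)) ->
  (forall t z, 0 <= t <= T -> chi z = 1 \/ (f t z = 0 /\ fh t z = 0)) ->
  vlasov_on T (fun k t => c k t + e k t) fh fh fht (fun _ _ => 0) ->
  (forall z, fh 0 z = f 0 z) ->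
  \int[leb6]_z ((fh T z - f T z) ^+ 2) <= K * \sum_k sqnorm_L2 T (e k) /\
  `|\int[leb6]_z ((fh T z - f T z) * g T z) +
     \sum_k \int[mu]_(t in `[0, T]) (e k t * p_fun m f g k t)| <= K * \sum_k sqnorm_L2 T (e k).
Proof.
move=> T0 r0 rf rg vf vg pL.
have [K0 K00 step] := energy_step m1 m2 r0.
(* The factor [2] comes from the derivative of [d^2]; the [+ 1] makes [k1] positive, as [gronwall]
   requires. *)
pose k1 := 2 * (K0 * (1 + Cf ^+ 2)) + 1; pose k2 := K0 * (1 + Cg ^+ 2).
have k10 : 0 < k1 by rewrite ltr_wpDl// mulr_ge0// mulr_ge0// addr_ge0// sqr_ge0.
have k20 : 0 <= k2 by rewrite mulr_ge0// addr_ge0// sqr_ge0.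
(* The Gronwall bound with initial term [k1 W], taken at the final time and divided by [W]. *)
pose K1 := 2 * k1 * expR (2 * k1 * T).
have K10 : 0 <= K1 by rewrite mulr_ge0 ?expR_ge0// mulr_ge0// ltW.
exists (K1 + k2 * (1 + T * K1)) => [|Ch fh fht e rh eL chi1 vh init].
  by rewrite addr_ge0// mulr_ge0// addr_ge0// mulr_ge0// ltW.
pose d t z := fh t z - f t z; pose dt t z := fht t z - ft t z.
have rd : time_regular T r (Ch + Cf) d dt := time_regularB rh rf.
pose W := \sum_k sqnorm_L2 T (e k).
pose E t := \int[leb6]_z (d t z ^+ 2).
pose w t := \sum_k e k t ^+ 2.
have J := meas_itv' T.
have wi : intble mu `[0, T]%classic w by apply: intble_sum => // k; exact: L2_intble.
have w0 t : 0 <= w t by apply: sumr_ge0 => k _; exact: sqr_ge0.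
have E0 t : 0 <= E t by rewrite /E /Rintegral fine_ge0// integral_ge0// => z _; rewrite lee_fin sqr_ge0.
have WE : \int[mu]_(t in `[0, T]) w t = W.
  by rewrite /w Rint_sum// => k; exact: L2_intble.
have T0' := ltW T0.
have [e1 [e1i e1E e1P]] := time_product rd rd T0'.
have [e2 [e2i e2E e2P]] := time_product rd rg T0'.
have zeroT : 0 <= (0 : R) <= T by rewrite lexx.
have TT : 0 <= T <= T by rewrite lexx T0'.
have d0 z : d 0 z = 0 by rewrite /d init subrr.
(* At almost every time all three equations hold almost everywhere in phase space, the time
   derivatives have measurable slices, and [e1] and [e2] have their integral form; there
   [energy_step] applies. *)
have stepae : {ae mu, forall t : R, 0 <= t <= T ->
    e1 t <= k1 * (w t + E t) /\
    `|e2 t + \sum_k e k t * p_fun m f g k t| <= k2 * (w t + E t)}.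
  have s1 := lebesgue_ae2 (fun t x y => conj x y) (vlasov_on_slices vf) (vlasov_on_slices vg).
  have s2 := lebesgue_ae2 (fun t x y => conj x y) (vlasov_on_slices vh) e1E.
  have s3 := lebesgue_ae2 (fun t x y => conj x y) (jointly_measurable_slices (tr_dmeas rf))
    (jointly_measurable_slices (tr_dmeas rh)).
  have s4 := lebesgue_ae2 (fun t x y => conj x y) (jointly_measurable_slices (tr_dmeas rg)) e2E.
  have s12 := lebesgue_ae2 (fun t x y => conj x y) s1 s2.
  have s34 := lebesgue_ae2 (fun t x y => conj x y) s3 s4.
  apply: lebesgue_ae2 s12 s34 => t [[tvf tvg] [tvh te1]] [[mf mh] [mg te2]] tT.
  have [S1 S2] := step _ _ _ _ _ _ _ _ _ _ _ _ (tr_c1 rf tT) (tr_c1 rh tT) (tr_c1 rg tT)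
    (fun z => chi1 t z tT) (mf tT) (mh tT) (mg tT) (tvf tT) (tvh tT) (tvg tT).
  have [i1 ->] := te1 tT; have [_ ->] := te2 tT.
  split; last exact: S2.
  have wE0 : 0 <= w t + E t by exact: addr_ge0.
  have dbl z : 2 * (d t z * dt t z) = dt t z * d t z + d t z * dt t z by exact: double_product.
  have Xi : intble leb6 setT (fun z => d t z * dt t z).
    by apply: intble_ext (intbleZ 2^-1 measurableT i1) => z; exact: half_double.
  rewrite -(eq_Rintegral _ (fun z _ => dbl z)) (RintegralZl _ measurableT Xi).
  apply: le_trans (_ : 2 * `|\int[leb6]_z (d t z * dt t z)| <= _).
    by rewrite ler_wpM2l// ler_norm.
  apply: le_trans (_ : 2 * (K0 * (1 + Cf ^+ 2)) * (w t + E t) <= _).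
    by rewrite -mulrA ler_wpM2l.
  by rewrite ler_wpM2r// lerDl.
have EP t : 0 <= t <= T -> E t = \int[mu]_(s in `[0, t]) e1 s.
  move=> tT; rewrite -(e1P t tT) [X in _ - X]Rint_eq0 ?subr0.
    by apply: eq_Rintegral => z _; rewrite expr2.
  by move=> z _; rewrite d0 mul0r.
have cE : {within `[0, T]%classic, continuous E}.
  have cI : {within `[0, T], continuous (fun t => \int[mu]_(s in `[0, t]) e1 s)}.
    by apply: parameterized_integral_continuous T0' e1i.
  apply: subspace_eq_continuous cI => t; rewrite inE /= in_itv/= => tT.
  by rewrite /from_subspace /= EP.
have Ei : intble mu `[0, T]%classic E.
  by apply: continuous_compact_integrable => //; exact: segment_compact.
have sub t : 0 <= t <= T -> `[0, t]%classic `<=` (`[0, T]%classic : set R).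
  by move=> /andP[_ tT] s; rewrite /= !in_itv/= => /andP[-> /le_trans]; apply.
have [x _ xP] := EVT_max T0' cE.
have grow t : 0 <= t <= T -> E t <= k1 * W + k1 * \int[mu]_(s in `[0, t]) E s.
  move=> tT; have I := meas_itv' t; have st := sub t tT.
  have wit := intble_sub J I st wi; have Eit := intble_sub J I st Ei.
  rewrite (EP t tT).
  apply: le_trans (Rint_aele I (intble_sub J I st e1i) (intbleZ k1 I (intbleD I wit Eit)) _) _.
    apply: lebesgue_aeS stepae => s H; rewrite /= in_itv/= => /andP[s0 ss].
    have [|//] := H _; rewrite s0 (le_trans ss)//; by case/andP: tT.
  rewrite (RintegralZl _ I (intbleD I wit Eit)) (RintegralD I wit Eit) mulrDr lerD2r.
  by rewrite (ler_wpM2l (ltW k10))// -WE; exact: Rint_initial_le.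
have W0 : 0 <= W by rewrite -WE /Rintegral fine_ge0// integral_ge0// => t _; rewrite lee_fin.
have EK t : 0 <= t <= T -> E t <= K1 * W.
  move=> tT; have kW0 : 0 <= k1 * W by rewrite mulr_ge0// ltW.
  have EB s : 0 <= s <= T -> E s <= E x by move=> sT; apply: xP; rewrite in_itv.
  apply: le_trans (gronwall k10 kW0 EB cE grow tT) _.
  have -> : K1 * W = 2 * (k1 * W) * expR (2 * k1 * T) by rewrite /K1; ring.
  rewrite (ler_wpM2l (mulr_ge0 _ kW0))// ler_expR; have /andP[_ tT'] := tT.
  by rewrite (ler_wpM2l (mulr_ge0 _ (ltW k10))).
split.
  by apply: le_trans (EK T TT) _; rewrite ler_wpM2r// lerDl mulr_ge0// addr_ge0// mulr_ge0.
have epi k : intble mu `[0, T]%classic (fun t => e k t * p_fun m f g k t) by exact: L2_mul.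
have si : intble mu `[0, T]%classic (fun t => \sum_k e k t * p_fun m f g k t).
  exact: intble_sum.
have -> : \int[leb6]_z ((fh T z - f T z) * g T z) = \int[mu]_(s in `[0, T]) e2 s.
  by rewrite -(e2P T TT) [X in _ - X]Rint_eq0 ?subr0// => z _; rewrite d0 mul0r.
rewrite -(Rint_sum (index_enum _) J epi) -(RintegralD J e2i si).
have wEi := intbleD J wi Ei.
apply: le_trans (Rint_norm_le J (intble_meas (intbleD J e2i si)) (intbleZ k2 J wEi) _) _.
  apply: lebesgue_aeS stepae => s H; rewrite /= in_itv/= => sT.
  by have [] := H sT.
rewrite (RintegralZl _ J wEi) (RintegralD J wi Ei) WE.
have KWi : intble mu `[0, T]%classic (fun=> K1 * W) by apply: (intble_cst _ J); exact: mu_cc_lty.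
have EKi : \int[mu]_(t in `[0, T]) E t <= T * (K1 * W).
  apply: le_trans (Rint_le J Ei KWi _) _ => [t|]; first by rewrite /= in_itv/=; exact: EK.
  by rewrite Rintegral_cst// (congr1 fine (mu_itv_cc T0'))/= subr0 mulrC.
apply: le_trans (_ : k2 * (W + T * (K1 * W)) <= _); first by rewrite ler_wpM2l// lerD2l.
have -> : k2 * (W + T * (K1 * W)) = k2 * (1 + T * K1) * W by ring.
by rewrite ler_wpM2r// lerDr.
Qed.
End Perturbation.

(** * First-order expansion and continuity of [p] *)

Section FirstOrder.
Variable R : realType.
Local Notation mu := (@lebesgue_measure R).
Local Notation leb6 := (@leb6 R).
Local Notation S6 := (space6 R).

(** Division by [h] and the limit [h -> 0], made with one explicit [h]. The side condition on [h D]
    is the locality of the minimum. *)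
Lemma first_order_nonneg (A M D delta : R) : 0 < delta -> 0 <= D ->
  (forall h, 0 < h <= 1 -> h * D < delta -> 0 <= h * A + h ^+ 2 * M) -> 0 <= A.
Proof.
move=> delta0 D0 H; rewrite leNgt; apply/negP => A0.
(* The three entries ensure [h <= 1], [h D < delta] and [h |M| < - A]. *)
pose h := Num.min (Num.min 1 (delta / (D + 1))) (- A / (2 * (`|M| + 1))).
have D1 : 0 < D + 1 by rewrite ltr_wpDl.
have M1 : 0 < 2 * (`|M| + 1) by rewrite mulr_gt0// ltr_wpDl.
have h0 : 0 < h by rewrite !lt_min ltr01 !divr_gt0// oppr_gt0.
have h1 : h <= 1 by rewrite !ge_min lexx.
have hD : h * D < delta.
  have : h <= delta / (D + 1) by rewrite !ge_min lexx !orbT.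
  by rewrite ler_pdivlMr// => hd; have := mulr_ge0 (ltW h0) D0; lra.
have hM : h * `|M| < - A.
  have : h <= - A / (2 * (`|M| + 1)) by rewrite !ge_min lexx !orbT.
  by rewrite ler_pdivlMr// => hd; have := mulr_ge0 (ltW h0) (normr_ge0 M); lra.
have := H h; rewrite h0 h1 => /(_ isT hD).
have -> : h * A + h ^+ 2 * M = h * (A + h * M) by ring.
rewrite pmulr_rge0//; apply/negP; rewrite -ltNge.
have := ler_wpM2l (ltW h0) (ler_norm M); lra.
Qed.

Lemma sqnorm_L2D (T c : R) x y : L2 T x -> L2 T y ->
  sqnorm_L2 T (fun t => x t + c * y t) = sqnorm_L2 T x +
    2 * c * \int[mu]_(t in `[0, T]) (x t * y t) + c ^+ 2 * sqnorm_L2 T y.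
Proof.
move=> xL yL; rewrite /sqnorm_L2.
have J := meas_itv `[0, T].
have i1 := L2_intble xL; have i2 := L2_mul xL yL; have i3 := L2_intble yL.
rewrite -(RintegralZl _ J i2) -(RintegralZl _ J i3).
have i2' := intbleZ (2 * c) J i2; have i3' := intbleZ (c ^+ 2) J i3.
rewrite -(RintegralD J i1 i2') -(RintegralD J (intbleD J i1 i2') i3').
by apply: eq_Rintegral => t _; ring.
Qed.

Lemma sqnorm_L2Z (T c : R) y : L2 T y ->
  sqnorm_L2 T (fun t => c * y t) = c ^+ 2 * sqnorm_L2 T y.
Proof.
move=> yL; rewrite /sqnorm_L2 -(RintegralZl _ (meas_itv `[0, T]) (L2_intble yL)).
by apply: eq_Rintegral => t _; rewrite exprMn.
Qed.

Lemma sqnorm_L2_ge0 (T : R) y : 0 <= sqnorm_L2 T y.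
Proof. by rewrite /sqnorm_L2 /Rintegral fine_ge0// integral_ge0// => t _; rewrite lee_fin sqr_ge0. Qed.

Lemma Rint_sqrD r C C' (d g : S6 -> R) : c1_supported r C d -> c1_supported r C' g ->
  \int[leb6]_z ((d z + g z) ^+ 2) = \int[leb6]_z (d z ^+ 2) +
    2 * \int[leb6]_z (d z * g z) + \int[leb6]_z (g z ^+ 2).
Proof.
move=> cd cg.
have M C1 C2 (x y : S6 -> R) : c1_supported r C1 x -> c1_supported r C2 y ->
    intble leb6 setT (fun z => x z * y z).
  move=> cx cy; apply: (intble_mul_bd measurableT (c1s_meas cx) _ (c1s_intble cy)) => z _.
  exact: c1s_bd cx z.
have i1 := M _ _ _ _ cd cd; have i2 := M _ _ _ _ cd cg; have i3 := M _ _ _ _ cg cg.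
rewrite -(RintegralZl _ measurableT i2); have i2' := intbleZ 2 measurableT i2.
rewrite -(RintegralD measurableT i1 i2') -(RintegralD measurableT (intbleD measurableT i1 i2') i3).
by apply: eq_Rintegral => z _; ring.
Qed.

Lemma C1b_near_pointwise (T : R) (f : R -> S6 -> R) t0 (e : R) :
  continuous_in T (@C1b _ R S6 6 (@basis6 R)) (@C1b_norm _ R S6 6 (@basis6 R)) f ->
  0 <= t0 <= T -> 0 < e -> \forall t \near within `[0, T]%classic (nbhs t0),
  (forall i z, `|pd i (f t) z - pd i (f t0) z| <= e) /\ forall z, `|f t z - f t0 z| <= e.
Proof.
move=> cf t00 e0; have := C1b_near cf t00 e0; rewrite !near_withinE.
apply: filterS => t H tT; have /ltW fe := H tT; split=> [i z|z].
  have := le_trans (C1b_norm_pd_ge (f t - f t0) i z) fe.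
  by rewrite lee_fin /pd deriveB//; [exact: (C1b_der cf)..].
by have := le_trans (C1b_norm_ge (f t - f t0) z) fe; rewrite lee_fin.
Qed.

(** Continuity in time in the [C^1] norm makes the velocity gradient of [f] and the values of [g]
    uniformly close, and the pairing is Lipschitz in these. *)
Lemma p_fun_continuous N (m : 'I_N -> space3 R -> space3 R) (T r C C' : R) f ft g gt i :
  (forall k, loc_intble_field (m k)) ->
  continuous_in T (@C1b _ R S6 6 (@basis6 R)) (@C1b_norm _ R S6 6 (@basis6 R)) f ->
  continuous_in T (@C1b _ R S6 6 (@basis6 R)) (@C1b_norm _ R S6 6 (@basis6 R)) g ->
  time_regular T r C f ft -> time_regular T r C' g gt ->
  {within `[0, T], continuous (p_fun m f g i)}.
Proof.
move=> m1 cf cg rf rg; have [D D0 lip] := cross_der_pairing_lipschitz m1 i r C C'.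
apply/subspace_continuousP => t0 t0J; apply/cvgrPdist_le => e e0.
have t00 : 0 <= t0 <= T by [].
pose e' := e / (D + 1); have D1 : 0 < D + 1 by rewrite ltr_wpDl.
have e'0 : 0 < e' by rewrite divr_gt0.
have := C1b_near_pointwise cf t00 e'0; have := C1b_near_pointwise cg t00 e'0.
rewrite !near_withinE; apply: filterS2 => t Hg Hf tT.
have [Hf1 Hf2] := Hf tT; have [Hg1 Hg2] := Hg tT.
have tT' : 0 <= t <= T by [].
rewrite distrC.
apply: le_trans (lip e' _ _ _ _ (tr_c1 rf tT') (tr_c1 rf t00) (tr_c1 rg tT') (tr_c1 rg t00) Hf1 Hg2) _.
rewrite /e' mulrAC ler_pdivrMr// ler_wpM2l ?(ltW e0)// lerDl.
by [].
Qed.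
End FirstOrder.

Section AdmissibleSegment.
Variables (R : realType) (N : nat) (T : R) (m : 'I_N -> space3 R -> space3 R).
Variables (lam : 'I_N -> R) (a b ubar : 'I_N -> R -> R).
Local Notation mu := (@lebesgue_measure R).
Local Notation leb6 := (@leb6 R).
Local Notation S6 := (space6 R).
Hypothesis ubar_adm : admissible T a b ubar.

Let segment u (h : R) k t := ubar k t + h * (u k t - ubar k t).

Lemma admissible_segment u h : 0 <= h <= 1 -> admissible T a b u ->
  admissible T a b (segment u h).
Proof.
move=> /andP[h0 h1] uadm k; have [uL uab] := uadm k; have [vL vab] := ubar_adm k.
split.
  have := L2_add h vL (L2_add (-1) uL vL).
  by congr (L2 T); apply/funext => t; rewrite /segment; ring.
apply: lebesgue_ae2 uab vab => t u1 v1 tT.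
have /andP[u2 u3] := u1 tT; have /andP[v2 v3] := v1 tT.
have E : segment u h k t = (1 - h) * ubar k t + h * u k t by rewrite /segment; ring.
have Ea c : c = (1 - h) * c + h * c by ring.
have h1' : 0 <= 1 - h by rewrite subr_ge0.
rewrite E [a k t]Ea [b k t]Ea; apply/andP; split; apply: lerD; exact: ler_wpM2l.
Qed.
End AdmissibleSegment.

Theorem theorem4p3 (R : realType) (T beta M K r rZ : R) (N : nat)
    (m : 'I_N -> space3 R -> space3 R) (a b : 'I_N -> R -> R)
    (f0 fd chi : space6 R -> R)
    (state : (R -> space3 R -> space3 R) -> R -> space6 R -> R)
    (lam : 'I_N -> R) (ubar : 'I_N -> R -> R) (gbar : R -> space6 R -> R)
    (T_gt0 : 0 < T) (beta_gt3 : 3 < beta) (N_ge1 : (1 <= N)%N) (M_gt0 : 0 < M)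
    (m_W2 : forall i, vsobolev 2 beta (m i))
    (m_le : forall i, (vsobolev_norm 2 beta (m i) <= M%:E)%E)
    (m_div : forall i, divergence_free (m i))
    (a_L2 : forall i, L2 T (a i)) (b_L2 : forall i, L2 T (b i))
    (ab0 : forall i, {ae lebesgue_measure, forall t, t \in `[0, T] ->
                        a i t <= 0 <= b i t})
    (f0_C2c : class_Cc (@basis6 R) 2 f0) (fd_C2c : class_Cc (@basis6 R) 2 fd)
    (f0_ge0 : forall z, 0 <= f0 z)
    (f0_fd : forall p : \bar R, (1 <= p)%E ->
       ('N[@leb6 R]_p [EFin \o f0] = 'N[@leb6 R]_p [EFin \o fd])%E)
    (K_gt0 : 0 < K)
    (K_bound : forall u, admissible T a b u ->
       fields T beta (control_field m u) /\
       (field_norm T beta (control_field m u) < (K / 2)%:E)%E)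
    (stateP : forall B, field_ball T beta K B -> is_state T beta f0 B (state B))
    (r_gt0 : 0 < r)
    (r_supp : forall B, field_ball T beta K B -> forall t : R, t \in `[0, T] ->
       tsupport (state B t) `<=` @ball6 R r)
    (rZ_ge : r <= rZ) (rZ_flow : flow_bound T beta K r rZ state)
    (chi_C2c : class_Cc (@basis6 R) 2 chi) (chi_01 : forall z, 0 <= chi z <= 1)
    (chi_1 : forall z, ball6 rZ z -> chi z = 1)
    (chi_supp : tsupport chi `<=` @ball6 R (2 * rZ))
    (lam_gt0 : forall i, 0 < lam i)
    (ubar_adm : admissible T a b ubar)
    (gbarP : is_costate T chi fd (control_field m ubar)
               (state (control_field m ubar)) gbar) :
  let f_ u := state (control_field m u) in
  let p := p_fun m (f_ ubar) gbar in
  let J := cost T lam fd f_ in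
  [/\ forall i, {within `[0, T], continuous (p i)},
      variational_inequality T lam a b p ubar <->
        projection_formula T lam a b p ubar &
      locally_optimal T a b J ubar ->
        variational_inequality T lam a b p ubar /\
        projection_formula T lam a b p ubar].
Proof.
move=> f_ p J.
have beta2 : 2 <= beta by apply: ltW; lra.
have mloc i k := vsobolev_loc k beta2 (m_W2 i).
have m1 k : loc_intble_field (m k) by move=> i; exact: (mloc k i).1.
have m2 k i : loc_intble3 (fun x => coord (m k x) i ^+ 2) by exact: (mloc k i).2.
have ball u : admissible T a b u -> field_ball T beta K (control_field m u).
  move=> uadm; have [uF uK] := K_bound _ uadm; split=> //.
  by apply: le_trans (ltW uK) _; rewrite lee_fin ler_pdivrMr// ler_peMr ?(ltW K_gt0)// ler1n.
have stP u : admissible T a b u -> exists2 ft, solution_space T beta (f_ u) ft &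
    vlasov_on m T u (f_ u) (f_ u) ft (fun _ _ => 0) /\ f_ u 0 = f0.
  by move=> /ball/stateP[[ft sol [eq init]] _]; exists ft.
have supp u : admissible T a b u -> forall t : R, t \in `[0, T] ->
    tsupport (f_ u t) `<=` @ball6 R r by move=> /ball; exact: r_supp.
have [ft solf [vf fi]] := stP _ ubar_adm.
have [[gt solg [vg gT]] _] := gbarP.
have [_ cf _ _] := solf; have [_ cg _ [rg suppg]] := solg.
(* A common radius for the supports of the states and of the costate, so that products stay in one
   box. *)
pose rho := Num.max r rg.
have rho0 : 0 < rho by rewrite lt_max r_gt0.
have r_rho : r <= rho by rewrite le_max lexx.
have [Cf /(_ _ r_rho) rf] := solution_time_regular T_gt0 solf (supp _ ubar_adm).
have [Cg Hg] := solution_time_regular T_gt0 solg suppg.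
have {Hg}rgt := Hg rho; have {rgt}rg' : time_regular T rho Cg gbar gt.
  by apply: rgt; rewrite le_max lexx orbT.
have cp i : {within `[0, T], continuous (p i)} by exact: p_fun_continuous m1 cf cg rf rg'.
have pL i : L2 T (p i) by exact: L2_cont (cp i).
have vip : variational_inequality T lam a b p ubar <-> projection_formula T lam a b p ubar.
  exact: vi_projection.
suff opt : locally_optimal T a b J ubar -> variational_inequality T lam a b p ubar.
  by split=> // /opt vi; split=> //; exact: vip.1.
move=> [_ [delta delta0 opt]] u uadm i.
(* [Kp] is fixed here, before the step [h] and the perturbed state are introduced. *)
have [Kp Kp0 pert] := state_perturbation m1 m2 T_gt0 rho0 rf rg' vf vg pL.
(* Only the [i]-th control is varied: the other terms of the summed inequality vanish, and the one
   for [i] remains. *)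
pose v k := if k == i then u i else ubar k.
have vadm : admissible T a b v by move=> k; rewrite /v; case: eqP => [->|_]; [exact: uadm|exact: ubar_adm].
pose w k t := v k t - ubar k t.
have wL k : L2 T (w k).
  have [vL _] := vadm k; have [ubL _] := ubar_adm k.
  by have := L2_add (-1) vL ubL; congr (L2 T); apply/funext => t; rewrite mulN1r.
have ubL k : L2 T (ubar k) by have [] := ubar_adm k.
have JJ := meas_itv `[0, T].
pose W := \sum_k sqnorm_L2 T (w k).
have W0 : 0 <= W by apply: sumr_ge0 => k _; exact: sqnorm_L2_ge0.
pose A k := \int[lebesgue_measure]_(t in `[0, T]) ((lam k * ubar k t - p k t) * w k t).
(* The coefficient of [h^2]: half the square of the state increment, the error of the duality
   formula, and the quadratic part of the control cost. *)
pose M0 := 2^-1 * (Kp * W) + Kp * W + \sum_k lam k / 2 * sqnorm_L2 T (w k).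
have -> : \int[lebesgue_measure]_(t in `[0, T]) ((lam i * ubar i t - p i t) * (u i t - ubar i t)) = \sum_k A k.
  rewrite (bigD1 i)//= big1 ?addr0 => [|k ki].
    by apply: eq_Rintegral => t _; rewrite /w /v eqxx.
  by apply: Rint_eq0 => t _; rewrite /w /v (negbTE ki) subrr mulr0.
apply: (@first_order_nonneg R _ M0 (Num.sqrt W) delta) => // h /andP[h0 h1] hW.
have h01 : 0 <= h <= 1 by rewrite (ltW h0).
pose uh k t := ubar k t + h * w k t.
have uhadm : admissible T a b uh by exact: admissible_segment.
pose e k t := h * w k t.
have eL k : L2 T (e k).
  by have := L2_add (h - 1) (wL k) (wL k); congr (L2 T); apply/funext => t; rewrite /e; ring.
have eW : \sum_k sqnorm_L2 T (e k) = h ^+ 2 * W.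
  by rewrite mulr_sumr; apply: eq_bigr => k _; exact: sqnorm_L2Z.
have [fht solh [vh fhi]] := stP _ uhadm.
have [Ch /(_ _ r_rho) rh] := solution_time_regular T_gt0 solh (supp _ uhadm).
have TT : 0 <= T <= T by rewrite lexx ltW.
have out u' t z : admissible T a b u' -> 0 <= t <= T -> ~ ball6 rZ z -> f_ u' t z = 0.
  move=> u'adm tT zr; apply/eqP/negPn/negP => fz; apply: zr.
  have : ball6 r z by apply: (supp _ u'adm t tT); exact: subset_closure.
  by move=> /lt_le_trans; exact.
(* Both states are supported in the ball of radius [r <= rZ], where the cut-off equals [1]. *)
have chi1 t z : 0 <= t <= T -> chi z = 1 \/ (f_ ubar t z = 0 /\ f_ uh t z = 0).
  move=> tT; have [zr|zr] := pselect (ball6 rZ z); [by left; exact: chi_1|right].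
  by split; exact: out.
have [b1 b2] := pert Ch (f_ uh) fht e rh eL chi1 vh (fun z => congr1 (@^~ z) (etrans fhi (esym fi))).
rewrite eW in b1 b2.
have J1 : J ubar <= J uh.
  (* The distance between [ubar] and [uh] is [h] times the square root of [W]. *)
  apply: opt => //; apply: le_lt_trans hW.
  rewrite (eq_bigr (fun k => h ^+ 2 * sqnorm_L2 T (w k))); last first.
    move=> k _; rewrite -sqrrN -sqnorm_L2Z//; congr (sqnorm_L2 T); apply/funext => t.
    by rewrite /uh; ring.
  by rewrite -mulr_sumr sqrtrM ?sqr_ge0// sqrtr_sqr ger0_norm// ltW.
pose d z := f_ uh T z - f_ ubar T z.
have cd := tr_c1 (time_regularB rh rf) TT.
have cgT := tr_c1 rg' TT.
have gE z : gbar T z = f_ ubar T z - fd z by rewrite gT.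
(* The terminal condition of the costate makes the cross term of the square equal to the pairing of
   [d] with [g(T)]. *)
have Ih : \int[@leb6 R]_z ((f_ uh T z - fd z) ^+ 2) = \int[@leb6 R]_z (d z ^+ 2) +
    2 * \int[@leb6 R]_z (d z * gbar T z) + \int[@leb6 R]_z ((f_ ubar T z - fd z) ^+ 2).
  transitivity (\int[@leb6 R]_z ((d z + gbar T z) ^+ 2)).
    by apply: eq_Rintegral => z _; rewrite gE /d; congr (_ ^+ 2); ring.
  rewrite (Rint_sqrD cd cgT); congr (_ + _).
  by apply: eq_Rintegral => z _; rewrite gE.
have AE k : A k = lam k * \int[lebesgue_measure]_(t in `[0, T]) (ubar k t * w k t) -
    \int[lebesgue_measure]_(t in `[0, T]) (p k t * w k t).
  have i1 := L2_mul (ubL k) (wL k); have i2 := L2_mul (pL k) (wL k).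
  rewrite -(RintegralZl _ JJ i1) -(RintegralB JJ (intbleZ (lam k) JJ i1) i2).
  by apply: eq_Rintegral => t _; ring.
have eE k : \int[lebesgue_measure]_(t in `[0, T]) (e k t * p_fun m (f_ ubar) gbar k t) =
    h * \int[lebesgue_measure]_(t in `[0, T]) (p k t * w k t).
  rewrite -(RintegralZl _ JJ (L2_mul (pL k) (wL k))).
  by apply: eq_Rintegral => t _; rewrite /e /p; ring.
(* The sum of the integrals of [e_k p_k] is added to the pairing and subtracted from the control
   part, so that the bracket is the quantity bounded by [b2] and the linear term is exactly [h]
   times the sum of the [A k]. *)
have JE : J uh - J ubar = 2^-1 * \int[@leb6 R]_z (d z ^+ 2) +
    (\int[@leb6 R]_z (d z * gbar T z) + \sum_k \int[lebesgue_measure]_(t in `[0, T]) (e k t * p_fun m (f_ ubar) gbar k t))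
    + h * \sum_k A k + h ^+ 2 * \sum_k lam k / 2 * sqnorm_L2 T (w k).
  rewrite /J /cost Ih.
  have -> : \sum_k lam k / 2 * sqnorm_L2 T (uh k) = \sum_k lam k / 2 * sqnorm_L2 T (ubar k) +
      \sum_k \int[lebesgue_measure]_(t in `[0, T]) (e k t * p_fun m (f_ ubar) gbar k t) +
      h * \sum_k A k + h ^+ 2 * \sum_k lam k / 2 * sqnorm_L2 T (w k).
    rewrite !mulr_sumr -!big_split; apply: eq_bigr => k _ /=.
    rewrite (sqnorm_L2D h (ubL k) (wL k)) eE AE.
    by field.
  by field.
have : 0 <= J uh - J ubar by rewrite subr_ge0.
rewrite JE; move: b1 b2; rewrite ler_norml => b1 /andP[_ b2].
rewrite -/d in b1; rewrite /M0.
move: b1 b2.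
set X1 := \int[@leb6 R]_z (d z ^+ 2); set X2 := \int[@leb6 R]_z (d z * gbar T z) + _.
set X3 := \sum_k A k; set X4 := \sum_k lam k / 2 * _.
move=> b1 b2 b3; have {}b2 : X2 <= Kp * (h ^+ 2 * W) by [].
have {}b1 : X1 <= Kp * (h ^+ 2 * W) by [].
move: b1 b2 b3; clearbody X1 X2 X3 X4 W; clear => *; lra.
Qed.
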